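(* Let $|\beta|\le \frac12$, let $\psi$ be a Ma-Minda function, and let $r_1$ be the radius of the largest disk centred at $1$ inside $\psi(\mathbb{D})$. Let $U_\beta,V_\beta,W_\beta$ be the normalized functions, built from the Struve function $\mathbf{H}_\beta$ of the first kind, given by $$U_{\beta}(z)=\left(\sqrt{\pi}\,2^{\beta}\Gamma(\beta+\tfrac32)\mathbf{H}_{\beta}(z)\right)^{\frac1{\beta+1}},\quad V_{\beta}(z)=\sqrt{\pi}\,2^{\beta}z^{-\beta}\Gamma(\beta+\tfrac32)\mathbf{H}_{\beta}(z),$$ $$W_{\beta}(z)=\sqrt{\pi}\,2^{\beta}z^{\frac{1-\beta}2}\Gamma(\beta+\tfrac32)\mathbf{H}_{\beta}(\sqrt z).$$ Let $r_\psi(U_\beta)$, $r_\psi(V_\beta)$, $r_\psi(W_\beta)$ be the smallest positive roots of the following equations, respectively: (i) $r\mathbf{H}'_{\beta}(r)-(1-r_1)(\beta+1)\mathbf{H}_{\beta}(r)=0$; (ii) $r\mathbf{H}'_{\beta}(r)-((1+\beta)-r_1)\mathbf{H}_{\beta}(r)=0$; (iii) $\sqrt r\,\mathbf{H}'_{\beta}(\sqrt r)-(1+\beta-2r_1)\mathbf{H}_{\beta}(\sqrt r)=0$. Then $U_\beta$, $V_\beta$, $W_\beta$ belong to $\mathcal{S}^*(\psi)$ in $|z|<r_\psi(U_\beta)$, $|z|<r_\psi(V_\beta)$, $|z|<r_\psi(W_\beta)$, respectively. Moreover, these radii are sharp when $\psi(-1)=1-r_1$, i.e. in that case they are exactly the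 $\mathcal{S}^*(\psi)$-radii of $U_\beta,V_\beta,W_\beta$.
   Context: $\mathbb{D}=\{z:|z|<1\}$. A Ma-Minda function is an analytic univalent function $\psi$ on $\mathbb{D}$ with $\psi(0)=1$, $\operatorname{Re}\psi>0$, such that $\psi(\mathbb{D})$ is symmetric with respect to the real axis and starlike with respect to $1$; $\psi(-1)$ denotes the boundary value at $-1$. The number $r_1$ is the largest radius with $\{w:|w-1|<r_1\}\subseteq\psi(\mathbb{D})$. $\mathcal{S}^*(\psi)$ is the class of analytic $f$ on $\mathbb{D}$ with $f(0)=0$, $f'(0)=1$ and $zf'(z)/f(z)\prec\psi(z)$ (subordination). A normalized function $g$ ($g(0)=0$, $g'(0)=1$) belongs to $\mathcal{S}^*(\psi)$ in $|z|<r$ if $g$ is analytic there and $zg'(z)/g(z)\in\psi(\mathbb{D})$ for all $|z|<r$; the $\mathcal{S}^*(\psi)$-radius of $g$ is the supremum of all such $r$. The Struve function is $$\mathbf{H}_{\beta}(z)=\frac{(z/2)^{\beta+1}}{\sqrt{\pi/4}\;\Gamma(\beta+\frac32)}\;{}_1F_2\left(1;\tfrac32,\beta+\tfrac32;-\tfrac{z^2}4\right),$$ where ${}_1F_2$ is the generalized hypergeometric function. Branches are chosen so that $U_\beta,V_\beta,W_\beta$ have the form $z+\cdots$ near $0$. *)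

(* Defs.v *)
From Stdlib Require Export Reals Factorial.
From Coquelicot Require Export Coquelicot.

Open Scope R_scope.

(** * Complex elementary functions *)

Definition Cexp (z : C) : C :=
  (exp (Re z) * cos (Im z), exp (Re z) * sin (Im z)).

(** Principal argument in (-PI, PI] (its value at 0 is irrelevant). *)
Definition Carg (z : C) : R :=
  if Rle_dec 0 (Im z) then acos (Re z / Cmod z) else - acos (Re z / Cmod z).

Definition Clog (z : C) : C := (ln (Cmod z), Carg z).

(** Principal branch of [z ^ a] for real [a]; it is set to 0 at [z = 0], so that
    the products [z^(-beta) * H_beta z] and [z^((1-beta)/2) * H_beta (sqrt z)]
    below take at 0 the value of their analytic extension. *)
Definition Cpower (z : C) (a : R) : C :=
  if Ceq_dec z 0 then 0%C else Cexp (a * Clog z)%C.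

(** [v] is one of the values of the multivalued power [w ^ a], [a > 0]. *)
Definition is_power_value (w : C) (a : R) (v : C) : Prop :=
  (w = 0%C /\ v = 0%C) \/ exists l : C, Cexp l = w /\ v = Cexp (a * l)%C.

(** Sum of a convergent complex series. *)
Definition CSeries (a : nat -> C) : C :=
  (Series (fun n => Re (a n)), Series (fun n => Im (a n))).

(** * The Struve function *)

Definition Gamma (x : R) : R :=
  RInt_gen (fun t => Rpower t (x - 1) * exp (- t))
           (at_right 0) (Rbar_locally p_infty).

(** [a (a+1) ... (a+n-1)] *)
Fixpoint pochhammer (a : R) (n : nat) : R :=
  match n with
  | O => 1
  | S m => pochhammer a m * (a + INR m)
  end.

Definition hyp1F2 (a b c : R) (z : C) : C :=
  CSeries (fun n =>
    RtoC (pochhammer a n / (pochhammer b n * pochhammer c n * INR (fact n)))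
    * z ^ n)%C.

Definition struveH (beta : R) (z : C) : C :=
  (Cpower (z / 2) (beta + 1)
   / RtoC (sqrt (PI / 4) * Gamma (beta + 3 / 2))
   * hyp1F2 1 (3 / 2) (beta + 3 / 2) (- (z ^ 2) / 4))%C.

(** * Ma-Minda functions and the classes S*(psi) *)

Definition analytic_on_disk (r : R) (f : C -> C) : Prop :=
  forall z : C, Cmod z < r -> ex_derive f z.

(** [w] belongs to [psi(D)], [D] the unit disk. *)
Definition disk_image (psi : C -> C) (w : C) : Prop :=
  exists z : C, Cmod z < 1 /\ psi z = w.

Record MaMinda (psi : C -> C) : Prop := {
  MaMinda_analytic : analytic_on_disk 1 psi;
  MaMinda_univalent : forall z w : C,
    Cmod z < 1 -> Cmod w < 1 -> psi z = psi w -> z = w;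
  MaMinda_0 : psi 0%C = 1%C;
  MaMinda_Re_pos : forall z : C, Cmod z < 1 -> 0 < Re (psi z);
  MaMinda_symmetric : forall w : C,
    disk_image psi w -> disk_image psi (Cconj w);
  MaMinda_starlike : forall (w : C) (t : R),
    disk_image psi w -> 0 <= t <= 1 ->
    disk_image psi (1 + t * (w - 1))%C
}.

Definition disk_in_image (psi : C -> C) (r : R) : Prop :=
  forall w : C, Cmod (w - 1)%C < r -> disk_image psi w.

Definition largest_disk_radius (psi : C -> C) (r1 : R) : Prop :=
  disk_in_image psi r1 /\ forall r : R, disk_in_image psi r -> r <= r1.

(** The boundary value [psi(-1)] is the radial limit of [psi] at [-1]. *)
Definition boundary_value_at_m1 (psi : C -> C) (w : C) : Prop :=
  filterlim (fun x : R => psi (RtoC x)) (at_right (-1)) (locally w).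

Definition normalized (g : C -> C) : Prop :=
  g 0%C = 0%C /\ is_derive g (0%C : C) (1%C : C).

(** [g] belongs to S*(psi) in [|z| < r]. At [z = 0] the analytic extension of
    [z g'(z) / g(z)] has the value [1 = psi 0], so only [z <> 0] needs stating;
    there [g z <> 0] is part of the requirement that the quotient makes sense. *)
Definition Sstar_in (psi : C -> C) (g : C -> C) (r : R) : Prop :=
  analytic_on_disk r g /\ normalized g /\
  forall z : C, Cmod z < r -> z <> 0%C ->
    g z <> 0%C /\ disk_image psi (z * C_derive g z / g z)%C.

(** [r] is the supremum of the positive radii satisfying [P]. *)
Definition is_radius (P : R -> Prop) (r : R) : Prop :=
  is_lub (fun rho => 0 < rho /\ P rho) r.

(** * The normalized Struve functions *)

Definition struve_const (beta : R) : R :=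
  sqrt PI * Rpower 2 beta * Gamma (beta + 3 / 2).

(** [u] is, on [|z| < r], the analytic branch with [u z = z + ...] of
    [(struve_const beta * H_beta z) ^ (1 / (beta + 1))]. For [beta > 0] the
    composition of the two principal powers is not analytic at 0, hence the
    description by values of the multivalued power; on a given disk these
    conditions determine [u] uniquely. *)
Definition U_branch (beta r : R) (u : C -> C) : Prop :=
  analytic_on_disk r u /\ normalized u /\
  forall z : C, Cmod z < r ->
    is_power_value (struve_const beta * struveH beta z)%C (1 / (beta + 1)) (u z).

Definition U_Sstar_in (psi : C -> C) (beta r : R) : Prop :=
  exists u : C -> C, U_branch beta r u /\ Sstar_in psi u r.

(** With principal powers the jumps across the negative real axis cancel:
    [V] and [W] are analytic there. *)
Definition V (beta : R) (z : C) : C :=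
  (RtoC (sqrt PI * Rpower 2 beta) * Cpower z (- beta)
   * RtoC (Gamma (beta + 3 / 2)) * struveH beta z)%C.

Definition W (beta : R) (z : C) : C :=
  (RtoC (sqrt PI * Rpower 2 beta) * Cpower z ((1 - beta) / 2)
   * RtoC (Gamma (beta + 3 / 2)) * struveH beta (Cpower z (1 / 2)))%C.

Definition smallest_positive_root (E : R -> C) (r : R) : Prop :=
  0 < r /\ E r = 0%C /\ forall s : R, 0 < s -> E s = 0%C -> r <= s.

Definition eqU (beta r1 r : R) : C :=
  (r * C_derive (struveH beta) r
   - RtoC ((1 - r1) * (beta + 1)) * struveH beta r)%C.

Definition eqV (beta r1 r : R) : C :=
  (r * C_derive (struveH beta) r
   - RtoC ((1 + beta) - r1) * struveH beta r)%C.

Definition eqW (beta r1 r : R) : C :=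
  (sqrt r * C_derive (struveH beta) (sqrt r)
   - RtoC (1 + beta - 2 * r1) * struveH beta (sqrt r))%C.

(* Main.v *)
Require Import Defs.
From Stdlib Require Import Lra Lia List ClassicalEpsilon.

(** The functions [V], [W] and [U ^ (beta + 1)] are [z Phi (z ^ 2)], [z Phi z] and
    [z ^ (beta + 1) Phi (z ^ 2) ], up to analytic continuation, where
    [Phi w = 1F2 (1; 3/2, beta + 3/2; - w / 4)] is entire. Everything rests on the
    inequality [|w Phi' w / Phi w| <= - x Phi' x / Phi x], [x = |w|], valid up to the first
    positive zero of [Phi]; it puts the values of [z f' / f] on [|z| < r] in the disk
    [|w - 1| < r1] as soon as the equation defining the radius has no root in [(0, r)].

    For a product of factors [1 - v w], [v > 0], the inequality is immediate, in the
    integrated form [|P w / P (s w) - 1| <= P (s x) / P x - 1] which makes sense without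
    derivatives and passes to limits. So [Phi] is approximated by polynomials with positive
    roots: up to a constant, [Phi (z ^ 2)] is the integral of [(1 - t ^ 2) ^ (beta - 1/2) sin (z t) / z]
    over [0, 1], and [cos z] is replaced by [Re (1 + i z / 2M) ^ 2M]. As the weight is
    monotone, the resulting polynomials alternate in sign at the points
    [z = 2M tan (m PI / 2M)], which accounts for all their roots (this is Polya's
    argument for the reality of the zeros of the Struve function).

    For sharpness, and for [r1 > 0], one needs that [psi] is open; this follows from the
    maximum principle for [1 / (psi - w)], itself a consequence of Goursat's theorem. *)

(** * Complex differentiation and the exponential *)

(** The hypothesis on [beta] enters as [b = beta + 3/2] in [[1, 2]]. In the variable [tau = t ^ 2]
    the normalized weight [(b - 1) (1 - tau) ^ (b - 2)] is nondecreasing for [1 < b <= 2] and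
    concentrates at 1 when [b = 1], where the integral turns into a derivative. This weight is never
    integrated: only its moments appear. All three equations become [log_gap b T = 0], that is
    [- x phi' x = T phi x], with [T] equal to [r1 (beta + 1) / 2], [r1 / 2] and [r1]. The products
    also give [phi x <= phi (x / 2) ^ 2], which serves twice. It makes [phi] decay faster than
    [x ^ (- T)], so a root exists. It also keeps [Phi] in the right half-plane up to and including
    the radius of [U], where a fractional power of [Phi] must be a single analytic branch; this
    works for [T <= 3/4], which is what [r1 <= 1] and [beta <= 1/2] provide. For the sharpness of
    [U] the competing function is an arbitrary branch on a larger disk. Its modulus is prescribed,
    and the modulus determines the logarithmic derivative. *)

Lemma is_Cderive_AbsRing (f : C -> C) (z l : C) :
  is_derive f z l <->
  is_derive (K := C_AbsRing) (V := AbsRing_NormedModule C_AbsRing) f z l.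
Proof.
  split; intros [_ H]; (split; [apply is_linear_scal_l | exact H]).
Qed.

(** The general rule expects the inner derivative in the module that [C_AbsRing] is over itself,
    while [is_derive] on complex functions is read with [C_NormedModule]. The limit clauses are
    convertible, so [is_Cderive_AbsRing] passes from one to the other. *)
Lemma is_Cderive_comp (f g : C -> C) (z df dg : C) :
  is_derive f (g z) df -> is_derive g z dg ->
  is_derive (fun x => f (g x)) z (dg * df)%C.
Proof.
  intros Hf Hg.
  exact (is_derive_comp (K:=C_AbsRing) (V:=C_NormedModule) f g z df dg Hf
           (proj1 (is_Cderive_AbsRing _ _ _) Hg)).
Qed.

Lemma is_Cderive_mult (f g : C -> C) (z df dg : C) :
  is_derive f z df -> is_derive g z dg ->
  is_derive (fun x => f x * g x)%C z (df * g z + f z * dg)%C.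
Proof.
  rewrite !is_Cderive_AbsRing; intros Hf Hg.
  exact (is_derive_mult (K:=C_AbsRing) f g z df dg Hf Hg Cmult_comm).
Qed.
Lemma is_Cderive_id (z : C) : is_derive (fun x : C => x) z (1%C : C).
Proof. apply is_Cderive_AbsRing. exact (is_derive_id (K:=C_AbsRing) z). Qed.

Lemma is_Cderive_eps (f : C -> C) (z l : C) :
  is_derive f z l <->
  forall eps, 0 < eps -> exists d, 0 < d /\ forall h, Cmod h < d ->
    Cmod (f (z + h)%C - f z - l * h)%C <= eps * Cmod h.
Proof.
split.
- intros [_ H] eps He.
  destruct (H z (fun P HP => HP) (mkposreal eps He)) as [d Hd].
  exists d; split; [apply cond_pos|]. intros h Hh.
  assert (E : (z + h - z)%C = h) by ring.
  specialize (Hd (z + h)%C).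
  change (Cmod (z + h - z)%C < d -> Cmod (f (z + h)%C - f z - (z + h - z) * l)%C <= eps * Cmod (z + h - z)%C) in Hd.
  rewrite E, (Cmult_comm h) in Hd. now apply Hd.
- intros H. split. { apply is_linear_scal_l. }
  intros x Hx. assert (Ex : z = x) by (apply (is_filter_lim_locally_unique (V := AbsRing_NormedModule C_AbsRing)); exact Hx). subst x.
  intros eps. destruct (H eps (cond_pos eps)) as [d [Hd0 Hd]].
  exists (mkposreal d Hd0). intros y Hy.
  specialize (Hd (y - z)%C Hy).
  assert (E : forall v : C, (z + (v - z))%C = v) by (intro; ring).
  rewrite E in Hd.
  rewrite (Cmult_comm l) in Hd. exact Hd.
Qed.

Lemma is_Cderive_plus (f g : C -> C) (z df dg : C) :
  is_derive f z df -> is_derive g z dg ->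
  is_derive (fun x => f x + g x)%C z (df + dg)%C.
Proof. exact (is_derive_plus (K:=C_AbsRing) (V:=C_NormedModule) f g z df dg). Qed.

Lemma is_Cderive_minus (f g : C -> C) (z df dg : C) :
  is_derive f z df -> is_derive g z dg ->
  is_derive (fun x => f x - g x)%C z (df - dg)%C.
Proof. exact (is_derive_minus (K:=C_AbsRing) (V:=C_NormedModule) f g z df dg). Qed.

Lemma is_Cderive_const (a z : C) : is_derive (fun _ : C => a) z (0%C : C).
Proof. exact (is_derive_const (K:=C_AbsRing) (V:=C_NormedModule) a z). Qed.

Lemma is_Cderive_scal (a : C) (f : C -> C) (z l : C) :
  is_derive f z l -> is_derive (fun x => a * f x)%C z (a * l)%C.
Proof.
  intros H.
  replace (a * l)%C with (0 * f z + a * l)%C by ring.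
  apply (is_Cderive_mult (fun _ => a)); [apply is_Cderive_const | exact H].
Qed.

Lemma is_Cderive_ext_near (f g : C -> C) (z l : C) (d : R) : 0 < d ->
  (forall x, Cmod (x - z)%C < d -> f x = g x) ->
  is_derive f z l -> is_derive g z l.
Proof.
  intros Hd E. apply is_derive_ext_loc.
  exists (mkposreal d Hd). intros y Hy. now apply E.
Qed.

Lemma is_Cderive_eq (f : C -> C) (z l l' : C) :
  is_derive f z l -> l = l' -> is_derive f z l'.
Proof. now intros H <-. Qed.

Lemma Cderive_cont (f : C -> C) (z : C) : ex_derive f z ->
  forall eps, 0 < eps -> exists d, 0 < d /\ forall h, Cmod h < d ->
    Cmod (f (z + h)%C - f z)%C < eps.
Proof.
  intros [l Hl] eps He.
  destruct (proj1 (is_Cderive_eps f z l) Hl 1 Rlt_0_1) as [d [Hd0 Hd]].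
  pose proof (Cmod_ge_0 l) as Hl0.
  assert (Hq : 0 < eps / (Cmod l + 2)) by (apply Rdiv_lt_0_compat; lra).
  exists (Rmin d (eps / (Cmod l + 2))). split; [now apply Rmin_pos|].
  intros h Hh.
  assert (H1 := Hd h (Rlt_le_trans _ _ _ Hh (Rmin_l _ _))).
  assert (H2 := Rlt_le_trans _ _ _ Hh (Rmin_r _ _)).
  replace (f (z + h) - f z)%C with (f (z + h) - f z - l * h + l * h)%C by ring.
  eapply Rle_lt_trans; [apply Cmod_triangle|]. rewrite Cmod_mult.
  apply Rlt_div_r in H2; [|lra].
  pose proof (Cmod_ge_0 h). nra.
Qed.

Lemma is_Cderive_Cinv (z : C) : z <> 0%C ->
  is_derive (fun x : C => / x)%C z (- (/ z * / z))%C.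
Proof.
  intros Hz. apply is_Cderive_eps. intros eps He.
  assert (Hm : 0 < Cmod z) by now apply Cmod_gt_0.
  exists (Rmin (Cmod z / 2) (eps * Cmod z ^ 3 / 2)). split.
  { apply Rmin_pos; [lra|]. apply Rdiv_lt_0_compat; [|lra].
    apply Rmult_lt_0_compat; [lra|now apply pow_lt]. }
  intros h Hh.
  assert (H1 := Rlt_le_trans _ _ _ Hh (Rmin_l _ _)).
  assert (H2 := Rlt_le_trans _ _ _ Hh (Rmin_r _ _)).
  assert (H3 : Cmod z / 2 < Cmod (z + h)%C).
  { pose proof (Cmod_triangle (z + h)%C (- h)%C) as H.
    replace (z + h + - h)%C with z in H by ring. rewrite Cmod_opp in H. lra. }
  assert (Hzh : (z + h)%C <> 0%C) by (apply Cmod_gt_0; lra).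
  replace (/ (z + h) - / z - - (/ z * / z) * h)%C with (h * h / ((z * z) * (z + h)))%C
    by (field_simplify_eq; [reflexivity|auto]).
  assert (Hzz : (z * z)%C <> 0%C) by now apply Cmult_neq_0.
  rewrite Cmod_div, !Cmod_mult by now apply Cmult_neq_0.
  pose proof (Cmod_ge_0 h).
  apply Rmult_le_reg_r with (Cmod z * Cmod z * Cmod (z + h)%C);
    [repeat apply Rmult_lt_0_compat; lra|].
  unfold Rdiv. rewrite Rmult_assoc, Rinv_l, Rmult_1_r
    by (apply Rgt_not_eq; repeat apply Rmult_lt_0_compat; lra).
  assert (Cmod h <= eps * (Cmod z * Cmod z * Cmod (z + h)%C)).
  { apply Rle_trans with (eps * (Cmod z * Cmod z * (Cmod z / 2))).
    - simpl in H2; lra.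
    - apply Rmult_le_compat_l; [lra|]. apply Rmult_le_compat_l; [nra|lra]. }
  nra.
Qed.

Lemma is_Cderive_inv (f : C -> C) (z l : C) : f z <> 0%C ->
  is_derive f z l -> is_derive (fun x => / f x)%C z (- (l * (/ f z * / f z)))%C.
Proof.
  intros Hz H. eapply is_Cderive_eq.
  - apply (is_Cderive_comp (fun x => / x)%C f); [now apply is_Cderive_Cinv|exact H].
  - ring.
Qed.

Lemma is_Cderive_div (f g : C -> C) (z df dg : C) : g z <> 0%C ->
  is_derive f z df -> is_derive g z dg ->
  is_derive (fun x => f x / g x)%C z ((df * g z - f z * dg) / (g z * g z))%C.
Proof.
  intros Hz Hf Hg. eapply is_Cderive_eq.
  - apply is_Cderive_mult; [exact Hf|]. now apply is_Cderive_inv, Hg.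
  - cbv beta. field; auto.
Qed.

Lemma is_Cderive_sqr (z : C) : is_derive (fun x : C => x ^ 2)%C z (2 * z)%C.
Proof.
  assert (E : forall t : C, (t * t)%C = (t ^ 2)%C) by (intros; ring).
  apply (is_derive_ext (fun x : C => x * x)%C _ _ _ E).
  eapply is_Cderive_eq; [apply (is_Cderive_mult (fun x => x) (fun x => x)); apply is_Cderive_id|ring].
Qed.

Lemma Cexp_plus (a b : C) : Cexp (a + b)%C = (Cexp a * Cexp b)%C.
Proof.
  unfold Cexp, Cmult, Cplus, Re, Im; simpl.
  rewrite exp_plus, cos_plus, sin_plus. f_equal; ring.
Qed.

Lemma Cexp_RtoC (x : R) : Cexp (RtoC x) = RtoC (exp x).
Proof.
  unfold Cexp, RtoC, Re, Im; simpl. rewrite cos_0, sin_0. f_equal; ring.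
Qed.

Lemma Cmod_Cexp (z : C) : Cmod (Cexp z) = exp (Re z).
Proof.
  unfold Cmod, Cexp; simpl fst; simpl snd.
  replace (_ + _) with (exp (Re z) ^ 2).
  - rewrite sqrt_pow2; [easy|]. left; apply exp_pos.
  - pose proof (sin2_cos2 (Im z)) as H. unfold Rsqr in H.
    transitivity (exp (Re z) ^ 2 * (sin (Im z) * sin (Im z) + cos (Im z) * cos (Im z))); [|ring].
    rewrite H; ring.
Qed.

Lemma Cexp_neq_0 (z : C) : Cexp z <> 0%C.
Proof. apply Cmod_gt_0. rewrite Cmod_Cexp. apply exp_pos. Qed.

Lemma is_derive_eps_0 (f : R -> R) (l : R) : is_derive f 0 l ->
  forall eps, 0 < eps -> exists d, 0 < d /\ forall h, Rabs h < d ->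
    Rabs (f h - f 0 - l * h) <= eps * Rabs h.
Proof.
  intros H eps He. apply is_derive_Reals in H.
  destruct (H eps He) as [d Hd]. exists d; split; [apply cond_pos|].
  intros h Hh. destruct (Req_dec h 0) as [->|Hn].
  - rewrite Rabs_R0, Rmult_0_r, Rmult_0_r, Rminus_diag, Rminus_0_r, Rabs_R0; lra.
  - specialize (Hd h Hn Hh). rewrite Rplus_0_l in Hd.
    replace (f h - f 0 - l * h) with (((f h - f 0) / h - l) * h) by (field; auto).
    rewrite Rabs_mult. apply Rmult_le_compat_r; [apply Rabs_pos|lra].
Qed.

Lemma Cmod_le_Re_Im (z : C) : Cmod z <= Rabs (Re z) + Rabs (Im z).
Proof.
  destruct z as [x y]. unfold Cmod, Re, Im; simpl fst; simpl snd.
  apply Rsqr_incr_0_var; [|pose proof (Rabs_pos x); pose proof (Rabs_pos y); lra].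
  rewrite Rsqr_sqrt by nra. unfold Rsqr.
  rewrite <- (pow2_abs x), <- (pow2_abs y).
  pose proof (Rabs_pos x); pose proof (Rabs_pos y); nra.
Qed.

Lemma im_le_Cmod (z : C) : Rabs (Im z) <= Cmod z.
Proof. eapply Rle_trans; [apply Rmax_r|apply (Rmax_Cmod z)]. Qed.


Lemma is_Cderive_Cexp (z : C) : is_derive Cexp z (Cexp z).
Proof.
  apply is_Cderive_eps. intros eps He.
  assert (Hz : 0 < Cmod (Cexp z)) by apply Cmod_gt_0, Cexp_neq_0.
  (* The expansions of [exp], [cos] and [sin] at 0 are used with error constant [e]. They add up to
     at most [6 e |h|]; the product [(exp x - 1) sin y] is of second order and is absorbed by
     requiring [|h| < e / 2]. *)
  set (e := Rmin 1 (eps / Cmod (Cexp z) / 8)).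
  assert (He' : 0 < e) by (apply Rmin_pos; [lra|]; repeat apply Rdiv_lt_0_compat; lra).
  assert (He1 : e <= 1) by apply Rmin_l.
  destruct (is_derive_eps_0 exp 1) with (eps := e) as [d1 [Hd1 H1]]; auto.
  { apply is_derive_Reals. rewrite <- exp_0. apply derivable_pt_lim_exp. }
  destruct (is_derive_eps_0 cos 0) with (eps := e) as [d2 [Hd2 H2]]; auto.
  { apply is_derive_Reals. pose proof (derivable_pt_lim_cos 0) as D.
    now rewrite sin_0, Ropp_0 in D. }
  destruct (is_derive_eps_0 sin 1) with (eps := e) as [d3 [Hd3 H3]]; auto.
  { apply is_derive_Reals. rewrite <- cos_0. apply derivable_pt_lim_sin. }
  exists (Rmin (Rmin d1 d2) (Rmin d3 (e / 2))). split.
  { repeat apply Rmin_pos; lra. }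
  intros h Hh.
  apply Rmin_Rgt in Hh. destruct Hh as [Hh Hh']. apply Rmin_Rgt in Hh, Hh'.
  destruct Hh as [A1 A2], Hh' as [A3 A4].
  replace (Cexp (z + h) - Cexp z - Cexp z * h)%C with (Cexp z * (Cexp h - 1 - h))%C
    by (rewrite Cexp_plus; ring).
  rewrite Cmod_mult.
  pose proof (re_le_Cmod h) as Bx. pose proof (im_le_Cmod h) as By.
  specialize (H1 (Re h)). specialize (H2 (Im h)). specialize (H3 (Im h)).
  rewrite exp_0 in H1. rewrite cos_0 in H2. rewrite sin_0 in H3.
  specialize (H1 ltac:(lra)). specialize (H2 ltac:(lra)). specialize (H3 ltac:(lra)).
  assert (H : Cmod (Cexp h - 1 - h)%C <= 8 * e * Cmod h).
  { eapply Rle_trans; [apply Cmod_le_Re_Im|].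
    set (m := Cmod h) in *. destruct h as [x y].
    unfold Cexp, Cminus, Cplus, Copp, RtoC, Re, Im in *; simpl in *.
    set (E := exp x - 1 - 1 * x) in *. set (c := cos y - 1 - 0 * y) in *.
    set (s := sin y - 0 - 1 * y) in *.
    replace (exp x * cos y + - (1) + - x) with (E + (E + x + 1) * c) by (unfold E, c; ring).
    replace (exp x * sin y + - 0 + - y) with (s + (E + x) * (s + y)) by (unfold E, s; ring).
    pose proof (Rabs_pos x). pose proof (Rabs_pos y).
    assert (E1 : Rabs E <= e * m) by nra.
    assert (E2 : Rabs c <= e * m) by nra.
    assert (E3 : Rabs s <= e * m) by nra.
    assert (F1 : Rabs (E + x) <= 2 * m) by (eapply Rle_trans; [apply Rabs_triang|]; nra).
    assert (F2 : Rabs (s + y) <= 2 * m) by (eapply Rle_trans; [apply Rabs_triang|]; nra).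
    assert (F3 : Rabs (E + x + 1) <= 2).
    { eapply Rle_trans; [apply Rabs_triang|]. rewrite Rabs_R1. lra. }
    assert (G1 : Rabs (E + (E + x + 1) * c) <= 3 * e * m).
    { eapply Rle_trans; [apply Rabs_triang|]. rewrite Rabs_mult.
      pose proof (Rmult_le_compat _ _ _ _ (Rabs_pos _) (Rabs_pos _) F3 E2). lra. }
    assert (G2 : Rabs (s + (E + x) * (s + y)) <= 3 * e * m).
    { eapply Rle_trans; [apply Rabs_triang|]. rewrite Rabs_mult.
      pose proof (Rmult_le_compat _ _ _ _ (Rabs_pos _) (Rabs_pos _) F1 F2). nra. }
    nra. }
  assert (He2 : e * Cmod (Cexp z) * 8 <= eps).
  { pose proof (Rmin_r 1 (eps / Cmod (Cexp z) / 8)) as Q. fold e in Q.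
    apply Rmult_le_compat_r with (r := Cmod (Cexp z) * 8) in Q; [|lra].
    replace (eps / Cmod (Cexp z) / 8 * (Cmod (Cexp z) * 8)) with eps in Q by (field; lra). lra. }
  pose proof (Cmod_ge_0 h).
  apply Rle_trans with (Cmod (Cexp z) * (8 * e * Cmod h)); [apply Rmult_le_compat_l; lra|nra].
Qed.

(** * The principal logarithm *)

Lemma Re_div_Cmod_bound (z : C) : -1 <= Re z / Cmod z <= 1.
Proof.
  pose proof (re_le_Cmod z) as H. pose proof (Cmod_ge_0 z).
  destruct (Req_dec (Cmod z) 0) as [E|E].
  - rewrite E. unfold Rdiv. rewrite Rinv_0. lra.
  - apply Rabs_le_between in H.
    split; [apply Rle_div_r|apply Rle_div_l]; lra.
Qed.

Lemma Cexp_Clog (z : C) : z <> 0%C -> Cexp (Clog z) = z.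
Proof.
  intros Hz. apply Cmod_gt_0 in Hz.
  pose proof (Re_div_Cmod_bound z) as Hb.
  pose proof (Cmod2_alt z) as H2.
  assert (Hs : Cmod z * sqrt (1 - (Re z / Cmod z)²) = Rabs (Im z)).
  { rewrite <- (sqrt_pow2 (Cmod z)) at 1 by lra. rewrite <- sqrt_mult_alt by (apply pow2_ge_0).
    replace (Cmod z ^ 2 * (1 - (Re z / Cmod z)²)) with (Im z * Im z).
    - apply (sqrt_Rsqr_abs (Im z)).
    - unfold Rsqr. field_simplify; [|lra]. rewrite H2. ring. }
  unfold Clog, Cexp, Carg; simpl. rewrite exp_ln by exact Hz.
  destruct z as [x y]. simpl Re in *; simpl Im in *.
  destruct (Rle_dec 0 y) as [Hy|Hy]; simpl.
  - rewrite cos_acos, sin_acos by exact Hb. rewrite Hs, Rabs_pos_eq by exact Hy.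
    f_equal. field. lra.
  - rewrite cos_neg, sin_neg, cos_acos, sin_acos by exact Hb.
    rewrite <- Ropp_mult_distr_r, Hs, Rabs_left by lra.
    f_equal; [field|]; lra.
Qed.

Lemma Carg_scal (t : R) (z : C) : 0 < t -> Carg (t * z)%C = Carg z.
Proof.
  intros Ht. unfold Carg. rewrite Cmod_mult, Cmod_R, Rabs_pos_eq by lra.
  destruct z as [x y]. unfold Cmult, RtoC, Re, Im; simpl fst; simpl snd.
  rewrite Rmult_0_l, Rmult_0_l, Rminus_0_r, Rplus_0_r.
  replace (t * x / (t * Cmod (x, y))) with (x / Cmod (x, y)).
  - destruct (Rle_dec 0 y), (Rle_dec 0 (t * y)); try reflexivity; exfalso; nra.
  - destruct (Req_dec (Cmod (x, y)) 0) as [->|E]; [|field; lra].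
    unfold Rdiv. rewrite Rmult_0_r, Rinv_0. ring.
Qed.

Lemma Clog_scal (t : R) (z : C) : 0 < t -> z <> 0%C ->
  Clog (t * z)%C = (RtoC (ln t) + Clog z)%C.
Proof.
  intros Ht Hz. apply Cmod_gt_0 in Hz. unfold Clog.
  rewrite Carg_scal, Cmod_mult, Cmod_R, Rabs_pos_eq, ln_mult by lra.
  unfold RtoC, Cplus; simpl. now rewrite Rplus_0_l.
Qed.

Lemma Clog_Cexp (l : C) : - PI < Im l <= PI -> Clog (Cexp l) = l.
Proof.
  intros Hl. unfold Clog. rewrite Cmod_Cexp, ln_exp.
  destruct l as [x y]. unfold Carg. rewrite Cmod_Cexp. simpl Re in *. simpl Im in *.
  pose proof (exp_pos x) as He.
  replace (exp x * cos y / exp x) with (cos y) by (field; lra).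
  f_equal. destruct (Rle_dec 0 (exp x * sin y)) as [H|H].
  - destruct (Rle_dec 0 y); [apply acos_cos; lra|].
    pose proof (sin_gt_0 (- y) ltac:(lra) ltac:(lra)) as Hs. rewrite sin_neg in Hs. exfalso; nra.
  - destruct (Rle_dec 0 y) as [Hy|Hy].
    + pose proof (sin_ge_0 y Hy ltac:(lra)). exfalso; nra.
    + rewrite <- cos_neg, acos_cos by lra. ring.
Qed.

Lemma Carg_bound (z : C) : z <> 0%C -> - PI < Carg z <= PI.
Proof.
  intros Hz. unfold Carg. pose proof (acos_bound (Re z / Cmod z)) as Ha. pose proof PI_RGT_0.
  destruct (Rle_dec 0 (Im z)) as [Hi|Hi]; [lra|].
  split; [|lra]. apply Ropp_lt_contravar.
  destruct Ha as [_ [Ha|Ha]]; [exact Ha|exfalso].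
  apply (f_equal cos) in Ha. rewrite cos_acos, cos_PI in Ha by apply Re_div_Cmod_bound.
  assert (Hm : 0 < Cmod z) by now apply Cmod_gt_0.
  assert (E : Re z = - Cmod z) by (apply Rmult_eq_reg_r with (/ Cmod z); [unfold Rdiv in Ha; rewrite Ha; field; lra | apply Rinv_neq_0_compat; lra]).
  pose proof (Cmod2_alt z) as E2. rewrite E in E2. nra.
Qed.

(** The logarithm is differentiated only in the right half-plane. There its argument is an
    arctangent, so its continuity is that of a composition of real functions. *)
Lemma Clog_Re_pos (z : C) : 0 < Re z -> Clog z = (ln (Cmod z), atan (Im z / Re z)).
Proof.
  intros Hz. pose proof (atan_bound (Im z / Re z)) as Ha.
  assert (Hz0 : z <> 0%C) by (intros E; rewrite E in Hz; simpl in Hz; lra).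
  assert (Hm : 0 < Cmod z) by now apply Cmod_gt_0.
  rewrite <- (Clog_Cexp (ln (Cmod z), atan (Im z / Re z))) by (simpl; pose proof PI_RGT_0; lra).
  f_equal. unfold Cexp. simpl fst; simpl snd. unfold Re at 2 3, Im at 2 3; simpl.
  rewrite exp_ln by exact Hm.
  rewrite cos_atan, sin_atan.
  assert (E : sqrt (1 + (Im z / Re z)²) = Cmod z / Re z).
  { rewrite <- (sqrt_Rsqr (Cmod z / Re z)) by (apply Rlt_le, Rdiv_lt_0_compat; lra).
    f_equal. pose proof (Cmod2_alt z). unfold Rsqr.
    apply Rmult_eq_reg_r with (Re z ^ 2); [|apply pow_nonzero; lra].
    field_simplify; lra. }
  destruct z as [x y]; simpl in *. rewrite E. f_equal; field; lra.
Qed.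

Lemma continuous_C_eps (f : C -> R) (z : C) : continuous f z ->
  forall eps, 0 < eps -> exists d, 0 < d /\ forall h, Cmod h < d -> Rabs (f (z + h)%C - f z) < eps.
Proof.
  intros H eps He.
  destruct (proj1 (filterlim_locally _ _) H (mkposreal eps He)) as [d Hd].
  exists d; split; [apply cond_pos|]. intros h Hh. apply Hd.
  apply C_NormedModule_mixin_compat1. unfold minus, plus, opp; simpl.
  now replace (z + h + - z)%C with h by ring.
Qed.

Lemma continuous_Cmod (z : C) : continuous Cmod z.
Proof.
  apply (continuous_comp (fun z : C => fst z ^ 2 + snd z ^ 2) sqrt).
  - apply (continuous_plus (V := R_NormedModule) (fun z : C => fst z ^ 2) (fun z : C => snd z ^ 2)).
    + apply (continuous_comp (fst : C -> R) (fun x => x ^ 2)); [apply continuous_fst|].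
      apply (ex_derive_continuous (V := R_NormedModule)). auto_derive; auto.
    + apply (continuous_comp (snd : C -> R) (fun x => x ^ 2)); [apply continuous_snd|].
      apply (ex_derive_continuous (V := R_NormedModule)). auto_derive; auto.
  - apply continuous_sqrt.
Qed.

Lemma Clog_cont (z : C) : 0 < Re z ->
  forall eps, 0 < eps -> exists d, 0 < d /\ forall h, Cmod h < d ->
    Cmod (Clog (z + h) - Clog z)%C < eps.
Proof.
  intros Hz eps He.
  assert (Hm : 0 < Cmod z) by (apply Cmod_gt_0; intros E; rewrite E in Hz; simpl in Hz; lra).
  destruct (continuous_C_eps (fun z => ln (Cmod z)) z) with (eps := eps / 2) as [d1 [Hd1 H1]].
  { apply (continuous_comp Cmod ln); [apply continuous_Cmod|].
    apply (ex_derive_continuous (V := R_NormedModule)). auto_derive; auto. }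
  { lra. }
  destruct (continuous_C_eps (fun z => atan (Im z / Re z)) z) with (eps := eps / 2) as [d2 [Hd2 H2]].
  { apply (continuous_comp (fun z : C => Im z / Re z) atan).
    - apply (continuous_mult (K := R_AbsRing) (fun z : C => Im z) (fun z : C => / Re z)); [apply continuous_snd|].
      apply (continuous_comp (fun z : C => Re z) Rinv); [apply continuous_fst|].
      apply (ex_derive_continuous (V := R_NormedModule)). auto_derive; lra.
    - apply (ex_derive_continuous (V := R_NormedModule)). auto_derive; auto. }
  { lra. }
  exists (Rmin (Re z) (Rmin d1 d2)). split; [repeat apply Rmin_pos; lra|].
  intros h Hh. apply Rmin_Rgt in Hh. destruct Hh as [Hh0 Hh]. apply Rmin_Rgt in Hh.
  specialize (H1 h ltac:(lra)). specialize (H2 h ltac:(lra)).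
  rewrite (Clog_Re_pos z) by exact Hz. rewrite Clog_Re_pos.
  - eapply Rle_lt_trans; [apply Cmod_le_Re_Im|].
    change (Rabs (ln (Cmod (z + h)%C) - ln (Cmod z)) +
      Rabs (atan (Im (z + h)%C / Re (z + h)%C) - atan (Im z / Re z)) < eps). lra.
  - pose proof (re_le_Cmod h) as B. apply Rabs_le_between in B.
    change (0 < Re z + Re h). lra.
Qed.

Lemma is_Cderive_inverse (f g : C -> C) (z l : C) (d : R) :
  0 < d -> (forall h, Cmod h < d -> f (g (z + h))%C = (z + h)%C) ->
  (forall eps, 0 < eps -> exists d, 0 < d /\ forall h, Cmod h < d ->
    Cmod (g (z + h) - g z)%C < eps) ->
  is_derive f (g z) l -> l <> 0%C -> is_derive g z (/ l)%C.
Proof.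
  intros Hd Hfg Hg Hf Hl. apply is_Cderive_eps. intros eps He.
  assert (Hm : 0 < Cmod l) by now apply Cmod_gt_0.
  (* For the increment [k] of [g], an error constant at most [|l| / 2] gives [|k| <= 2 |h| / |l|];
     the other bound then brings the error, divided by [|l|], below [eps |h|]. *)
  assert (He1 : 0 < Rmin (Cmod l / 2) (eps * Cmod l ^ 2 / 2)).
  { apply Rmin_pos; [lra|]. apply Rdiv_lt_0_compat; [|lra]. apply Rmult_lt_0_compat; [lra|now apply pow_lt]. }
  destruct (proj1 (is_Cderive_eps _ _ _) Hf _ He1) as [d1 [Hd1 H1]].
  destruct (Hg _ Hd1) as [d2 [Hd2 H2]].
  exists (Rmin d d2); split; [now apply Rmin_pos|]. intros h Hh. apply Rmin_Rgt in Hh.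
  specialize (H2 h ltac:(lra)). specialize (H1 _ H2).
  replace (g z + (g (z + h)%C - g z))%C with (g (z + h)%C) in H1 by ring.
  rewrite Hfg in H1 by lra.
  assert (E0 : f (g z) = z).
  { specialize (Hfg (RtoC 0)). rewrite Cmod_0, Cplus_0_r in Hfg. now apply Hfg. }
  rewrite E0 in H1. set (k := (g (z + h) - g z)%C) in *.
  replace (z + h - z - l * k)%C with (h - l * k)%C in H1 by ring.
  replace (k - / l * h)%C with (- ((h - l * k) / l))%C by (field; auto).
  rewrite Cmod_opp, Cmod_div by auto.
  pose proof (Rmin_l (Cmod l / 2) (eps * Cmod l ^ 2 / 2)) as B1.
  pose proof (Rmin_r (Cmod l / 2) (eps * Cmod l ^ 2 / 2)) as B2.
  set (e := Rmin _ _) in *.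
  pose proof (Cmod_ge_0 k) as Hk. pose proof (Cmod_ge_0 h) as Hh0.
  assert (Hkh : Cmod k * Cmod l <= 2 * Cmod h).
  { pose proof (Cmod_triangle (l * k - h)%C h) as T.
    replace (l * k - h + h)%C with (l * k)%C in T by ring.
    replace (l * k - h)%C with (- (h - l * k))%C in T by ring.
    rewrite Cmod_opp, Cmod_mult in T. nra. }
  apply Rmult_le_reg_r with (Cmod l); [exact Hm|].
  unfold Rdiv. rewrite Rmult_assoc, Rinv_l, Rmult_1_r by lra.
  apply Rmult_le_reg_r with (Cmod l); [exact Hm|].
  apply Rle_trans with (e * (2 * Cmod h)); [nra|].
  simpl in B2. nra.
Qed.

Lemma is_Cderive_Clog (z : C) : 0 < Re z -> is_derive Clog z (/ z)%C.
Proof.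
  intros Hz.
  assert (Hn : forall z : C, 0 < Re z -> z <> 0%C) by (intros w Hw E; rewrite E in Hw; simpl in Hw; lra).
  apply (is_Cderive_inverse Cexp Clog z z (Re z)).
  - exact Hz.
  - intros h Hh. apply Cexp_Clog, Hn.
    pose proof (re_le_Cmod h) as B. apply Rabs_le_between in B. change (0 < Re z + Re h). lra.
  - now apply Clog_cont.
  - rewrite <- (Cexp_Clog z) at 2 by now apply Hn. apply is_Cderive_Cexp.
  - now apply Hn.
Qed.

(** * Power series with real coefficients *)

Lemma Series_eq_0 (u : nat -> R) : (forall n, u n = 0) -> Series u = 0.
Proof.
  intros H. rewrite (Series_ext _ (fun n => 0 * u n)), Series_scal_l; [ring|].
  intros n. rewrite H. ring.
Qed.

Lemma Series_ge_0 (u : nat -> R) : (forall n, 0 <= u n) -> ex_series u -> 0 <= Series u.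
Proof.
  intros H Hu. rewrite <- (Series_eq_0 (fun _ => 0)) by auto.
  apply Series_le; [|exact Hu]. intros n; split; [lra|apply H].
Qed.

Definition Cabs_series (a : nat -> C) : Prop := ex_series (fun n => Cmod (a n)).

Lemma Cabs_series_le (a : nat -> C) (b : nat -> R) :
  (forall n, Cmod (a n) <= b n) -> ex_series b -> Cabs_series a.
Proof.
  intros H Hb. apply (ex_series_le (V := R_CompleteNormedModule)) with b; [|exact Hb].
  intros n. change (Rabs (Cmod (a n)) <= b n). rewrite Rabs_pos_eq; [apply H|apply Cmod_ge_0].
Qed.

Lemma Cabs_series_Re (a : nat -> C) : Cabs_series a -> ex_series (fun n => Re (a n)).
Proof.
  apply (ex_series_le (V := R_CompleteNormedModule)). intros n. apply re_le_Cmod.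
Qed.

Lemma Cabs_series_Im (a : nat -> C) : Cabs_series a -> ex_series (fun n => Im (a n)).
Proof.
  apply (ex_series_le (V := R_CompleteNormedModule)). intros n. apply im_le_Cmod.
Qed.

Lemma CSeries_ext (a b : nat -> C) : (forall n, a n = b n) -> CSeries a = CSeries b.
Proof. intros H. unfold CSeries. f_equal; apply Series_ext; intros n; now rewrite H. Qed.

Lemma CSeries_minus (a b : nat -> C) : Cabs_series a -> Cabs_series b ->
  CSeries (fun n => a n - b n)%C = (CSeries a - CSeries b)%C.
Proof.
  intros Ha Hb. unfold CSeries.
  apply injective_projections;
    [ refine (Series_minus (fun n => Re (a n)) (fun n => Re (b n)) _ _)
    | refine (Series_minus (fun n => Im (a n)) (fun n => Im (b n)) _ _) ];
    auto using Cabs_series_Re, Cabs_series_Im.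
Qed.

Lemma CSeries_scal (c : C) (a : nat -> C) : Cabs_series a ->
  CSeries (fun n => c * a n)%C = (c * CSeries a)%C.
Proof.
  intros Ha. unfold CSeries, Cmult; simpl.
  assert (H1 := Cabs_series_Re _ Ha). assert (H2 := Cabs_series_Im _ Ha).
  assert (S : forall (x : R) (u : nat -> R), ex_series u -> ex_series (fun n => x * u n)).
  { intros x u. apply (ex_series_scal (V := R_NormedModule)). }
  rewrite <- !Series_scal_l. f_equal.
  - rewrite <- Series_minus by now apply S. reflexivity.
  - rewrite <- Series_plus by now apply S. reflexivity.
Qed.

Lemma CSeries_incr_1 (a : nat -> C) : Cabs_series a ->
  CSeries a = (a 0%nat + CSeries (fun n => a (S n)))%C.
Proof.
  intros Ha. unfold CSeries.
  apply injective_projections;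
    [ refine (Series_incr_1 (fun n => Re (a n)) _)
    | refine (Series_incr_1 (fun n => Im (a n)) _) ];
    auto using Cabs_series_Re, Cabs_series_Im.
Qed.

Lemma Cmod_dot_le (x y : C) : Rabs (Re x * Re y + Im x * Im y) <= Cmod x * Cmod y.
Proof.
  rewrite <- (Cmod_conj x), <- Cmod_mult.
  replace (Re x * Re y + Im x * Im y) with (Re (Cconj x * y)%C)
    by (destruct x, y; simpl; ring).
  apply re_le_Cmod.
Qed.

(** The sum is defined by components, so the triangle inequality is obtained by projecting on the
    direction of the sum [S]: [|S| ^ 2] is the series of the scalar products of [S] with [a n], each
    at most [|S| b n]. *)
Lemma Cmod_CSeries_le (a : nat -> C) (b : nat -> R) :
  (forall n, Cmod (a n) <= b n) -> ex_series b -> Cmod (CSeries a) <= Series b.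
Proof.
  intros H Hb. assert (Ha := Cabs_series_le _ _ H Hb).
  assert (H1 := Cabs_series_Re _ Ha). assert (H2 := Cabs_series_Im _ Ha).
  set (S := CSeries a).
  assert (S0 : 0 <= Cmod S) by apply Cmod_ge_0.
  assert (SC : forall (x : R) (u : nat -> R), ex_series u -> ex_series (fun n => x * u n)).
  { intros x u. apply (ex_series_scal (V := R_NormedModule)). }
  assert (B : forall n, Rabs (Re S * Re (a n) + Im S * Im (a n)) <= Cmod S * b n).
  { intros n. eapply Rle_trans; [|apply Rmult_le_compat_l, H; exact S0].
    apply Cmod_dot_le. }
  assert (E : Cmod S * Cmod S <= Cmod S * Series b).
  { replace (Cmod S * Cmod S) with
      (Series (fun n => Re S * Re (a n) + Im S * Im (a n))).
    - rewrite <- Series_scal_l.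
      eapply Rle_trans; [apply Rle_abs|]. eapply Rle_trans.
      + apply Series_Rabs.
        apply (ex_series_le (V := R_CompleteNormedModule)) with (fun n => Cmod S * b n); [|now apply SC].
        intros n. change (Rabs (Rabs (Re S * Re (a n) + Im S * Im (a n))) <= Cmod S * b n).
        rewrite Rabs_Rabsolu. apply B.
      + apply Series_le; [|now apply SC]. intros n. split; [apply Rabs_pos|apply B].
    - rewrite Series_plus, !Series_scal_l by now apply SC.
      change (Re S * Re S + Im S * Im S = Cmod S * Cmod S).
      pose proof (Cmod2_alt S). lra. }
  destruct S0 as [S0|S0]; [now apply Rmult_le_reg_l with (Cmod S)|].
  rewrite <- S0. apply Series_ge_0; [|exact Hb].
  intros n. eapply Rle_trans; [apply Cmod_ge_0|apply H].
Qed.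

Definition CPS (a : nat -> R) (z : C) : C := CSeries (fun n => RtoC (a n) * z ^ n)%C.

Lemma CPS_RtoC (a : nat -> R) (x : R) : CPS a (RtoC x) = RtoC (PSeries a x).
Proof.
  unfold CPS.
  rewrite (CSeries_ext _ (fun n => RtoC (a n * x ^ n)))
    by (intros n; now rewrite RtoC_mult, RtoC_pow).
  apply injective_projections; [reflexivity|]. now apply Series_eq_0.
Qed.

Lemma CPS_abs (a : nat -> R) (z : C) : CV_radius a = p_infty ->
  Cabs_series (fun n => RtoC (a n) * z ^ n)%C.
Proof.
  intros Ha. apply Cabs_series_le with (fun n => Rabs (a n * Cmod z ^ n)).
  - intros n. rewrite Cmod_mult, Cmod_pow, Cmod_R, Rabs_mult, <- RPow_abs.
    rewrite (Rabs_pos_eq (Cmod z)) by apply Cmod_ge_0. lra.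
  - apply CV_disk_inside. rewrite Ha. exact I.
Qed.

(** The remainder for [n + 1] is [z + h] times the one for [n], plus [h ^ 2 n z ^ (n - 1)]; and
    [n ^ 2 + n <= (n + 1) ^ 2]. As [R0 >= 1], lower powers may be raised to the common one. *)
Lemma Cpow_taylor (R0 : R) (z h : C) (n : nat) :
  1 <= R0 -> Cmod z + Cmod h <= R0 ->
  Cmod ((z + h) ^ n - z ^ n - h * (INR n * z ^ pred n))%C <= INR n ^ 2 * R0 ^ n * Cmod h ^ 2.
Proof.
  intros HR Hzh. pose proof (Cmod_ge_0 h) as Hh. pose proof (Cmod_ge_0 z) as Hz.
  induction n as [|n IH].
  - simpl. replace (1 - 1 - h * (0 * 1))%C with (RtoC 0) by ring. rewrite Cmod_0. lra.
  - replace ((z + h) ^ S n - z ^ S n - h * (INR (S n) * z ^ pred (S n)))%C with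
      ((z + h) * ((z + h) ^ n - z ^ n - h * (INR n * z ^ pred n)) + h * h * (INR n * z ^ pred n))%C.
    + eapply Rle_trans; [apply Cmod_triangle|]. rewrite !Cmod_mult, Cmod_pow, Cmod_R, Rabs_pos_eq by apply pos_INR.
      assert (H1 : Cmod (z + h)%C <= R0) by (eapply Rle_trans; [apply Cmod_triangle|exact Hzh]).
      assert (H2 : Cmod z ^ pred n <= R0 ^ S n).
      { apply Rle_trans with (R0 ^ pred n); [apply pow_incr; lra|apply Rle_pow; [lra|lia]]. }
      pose proof (Rmult_le_compat _ _ _ _ (Cmod_ge_0 _) (Cmod_ge_0 _) H1 IH) as H3.
      pose proof (Rmult_le_compat_l _ _ _ (pos_INR n) H2) as H4.
      rewrite S_INR. pose proof (pos_INR n). assert (0 <= R0 ^ S n) by (apply pow_le; lra).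
      change (R0 ^ S n) with (R0 * R0 ^ n) in *.
      assert (0 <= Cmod h * Cmod h) by nra.
      pose proof (Rmult_le_compat_l _ _ _ H5 H4).
      assert (0 <= (INR n + 1) * (R0 * R0 ^ n * (Cmod h * Cmod h)))
        by (apply Rmult_le_pos; [lra|now apply Rmult_le_pos]).
      lra.
    + rewrite S_INR, RtoC_plus. destruct n as [|n]; simpl pred; [simpl; ring|].
      rewrite !Cpow_S. ring.
Qed.

Lemma is_Cderive_CPS (a : nat -> R) (z : C) : CV_radius a = p_infty ->
  is_derive (CPS a) z (CPS (PS_derive a) z).
Proof.
  intros Ha.
  assert (Ha' : CV_radius (PS_derive a) = p_infty) by now rewrite CV_radius_derive.
  apply is_Cderive_eps. intros eps He.
  set (R0 := Cmod z + 1). pose proof (Cmod_ge_0 z) as Hz.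
  assert (HR : 1 <= R0) by (unfold R0; lra).
  (* The factor [n ^ 2] is at most [4 ^ n], and the infinite radius of convergence allows evaluation
     at [4 R0]. *)
  assert (Hb : ex_series (fun n => Rabs (a n) * (INR n ^ 2 * R0 ^ n))).
  { apply (ex_series_le (V := R_CompleteNormedModule)) with (fun n => Rabs (a n * (4 * R0) ^ n)).
    - intros n. change (Rabs (Rabs (a n) * (INR n ^ 2 * R0 ^ n)) <= Rabs (a n * (4 * R0) ^ n)).
      assert (0 <= R0 ^ n) by (apply pow_le; lra).
      assert (Hn : INR n ^ 2 <= 4 ^ n).
      { replace 4 with (2 ^ 2) by ring. rewrite <- pow_mult, Nat.mul_comm, pow_mult.
        apply pow_incr. split; [apply pos_INR|]. apply Rlt_le. clear.
        induction n as [|n IH]; [simpl; lra|]. rewrite S_INR. simpl.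
        pose proof (pow_R1_Rle 2 n ltac:(lra)). lra. }
      rewrite (Rabs_mult (a n) ((4 * R0) ^ n)), Rabs_mult, Rabs_Rabsolu, Rpow_mult_distr.
      apply Rmult_le_compat_l; [apply Rabs_pos|].
      rewrite !Rabs_pos_eq; [|apply Rmult_le_pos; [apply pow_le; lra|auto]|
        apply Rmult_le_pos; [apply pow2_ge_0|auto]].
      now apply Rmult_le_compat_r.
    - apply CV_disk_inside. now rewrite Ha. }
  set (K := Series (fun n => Rabs (a n) * (INR n ^ 2 * R0 ^ n))).
  assert (HK : 0 <= K).
  { apply Series_ge_0; [|exact Hb]. intros n. apply Rmult_le_pos; [apply Rabs_pos|].
    apply Rmult_le_pos; [apply pow2_ge_0|apply pow_le; lra]. }
  exists (Rmin 1 (eps / (K + 1))). split; [apply Rmin_pos; [lra|apply Rdiv_lt_0_compat; lra]|].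
  intros h Hh. apply Rmin_Rgt in Hh. destruct Hh as [Hh1 Hh2]. pose proof (Cmod_ge_0 h) as Hh.
  assert (Hs : Cabs_series (fun n => RtoC (a n) * (INR n * z ^ pred n))%C).
  { apply Cabs_series_le with (fun n => Rabs (a n) * (INR n ^ 2 * R0 ^ n)); [|exact Hb].
    intros n. rewrite !Cmod_mult, !Cmod_R. apply Rmult_le_compat_l; [apply Rabs_pos|].
    destruct n as [|n]; [simpl; rewrite Rabs_R0; lra|].
    rewrite Rabs_pos_eq by apply pos_INR. rewrite Cmod_pow. simpl pred.
    pose proof (pos_INR n). rewrite S_INR.
    assert (Cmod z ^ n <= R0 ^ S n).
    { apply Rle_trans with (R0 ^ n); [apply pow_incr; unfold R0; lra|apply Rle_pow; [lra|lia]]. }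
    assert (0 <= R0 ^ S n) by (apply pow_le; lra).
    pose proof (pow_le (Cmod z) n Hz). nra. }
  assert (E : CPS (PS_derive a) z = CSeries (fun n => RtoC (a n) * (INR n * z ^ pred n))%C).
  { rewrite (CSeries_incr_1 _ Hs). unfold CPS.
    replace (RtoC (a 0%nat) * (INR 0 * z ^ pred 0))%C with (RtoC 0) by (simpl; ring).
    rewrite Cplus_0_l. apply CSeries_ext. intros n.
    unfold PS_derive. rewrite RtoC_mult. simpl pred. ring. }
  assert (D : Cmod (CPS a (z + h)%C - CPS a z - CPS (PS_derive a) z * h)%C <= K * Cmod h ^ 2).
  { rewrite E, (Cmult_comm _ h). unfold CPS.
    assert (Hs1 := CPS_abs a z Ha). assert (Hs2 := CPS_abs a (z + h)%C Ha).
    rewrite <- CSeries_scal by exact Hs.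
    assert (Hs3 : Cabs_series (fun n => h * (RtoC (a n) * (INR n * z ^ pred n)))%C).
    { apply Cabs_series_le with (fun n => Cmod h * Cmod (RtoC (a n) * (INR n * z ^ pred n))%C).
      - intros n. rewrite Cmod_mult. lra.
      - now apply (ex_series_scal (V := R_NormedModule)). }
    rewrite <- CSeries_minus by assumption.
    rewrite <- CSeries_minus; [|apply Cabs_series_le with
      (fun n => Cmod (RtoC (a n) * (z + h) ^ n)%C + Cmod (RtoC (a n) * z ^ n)%C)|assumption].
    - unfold K. rewrite Rmult_comm, <- Series_scal_l.
      apply Cmod_CSeries_le; [|now apply (ex_series_scal (V := R_NormedModule))].
      intros n.
      replace (RtoC (a n) * (z + h) ^ n - RtoC (a n) * z ^ n - h * (RtoC (a n) * (INR n * z ^ pred n)))%C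
        with (RtoC (a n) * ((z + h) ^ n - z ^ n - h * (INR n * z ^ pred n)))%C by ring.
      rewrite Cmod_mult, Cmod_R.
      assert (T := Cpow_taylor R0 z h n HR ltac:(unfold R0; lra)).
      apply Rmult_le_compat_l with (r := Rabs (a n)) in T; [lra|apply Rabs_pos].
    - intros n. unfold Cminus. eapply Rle_trans; [apply Cmod_triangle|]. rewrite Cmod_opp. lra.
    - now apply (ex_series_plus (V := R_NormedModule)). }
  eapply Rle_trans; [exact D|].
  apply Rlt_div_r in Hh2; [|lra]. nra.
Qed.

(** * Goursat's theorem for rectangles *)

Definition CInt (f : R -> C) (a b : R) : C := RInt (V := C_R_CompleteNormedModule) f a b.
Definition ex_CInt (f : R -> C) (a b : R) : Prop := ex_RInt (V := C_R_CompleteNormedModule) f a b.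

Lemma Cmod_CInt_le (f : R -> C) (a b M : R) : a <= b -> ex_CInt f a b ->
  (forall x, a <= x <= b -> Cmod (f x) <= M) -> Cmod (CInt f a b) <= (b - a) * M.
Proof.
  intros Hab Hf HM.
  assert (N : forall z : C_R_NormedModule, norm z = Cmod z).
  { intros [x y]. change (sqrt (Rabs x ^ 2 + Rabs y ^ 2) = sqrt (x ^ 2 + y ^ 2)).
    now rewrite !pow2_abs. }
  rewrite <- N. apply norm_RInt_le_const with (f := f : R -> C_R_NormedModule); [exact Hab| |].
  - intros x Hx. rewrite N. now apply HM.
  - now apply (RInt_correct (V := C_R_CompleteNormedModule)).
Qed.

Lemma CInt_minus (f g : R -> C) (a b : R) : ex_CInt f a b -> ex_CInt g a b ->
  CInt (fun x => f x - g x)%C a b = (CInt f a b - CInt g a b)%C.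
Proof. exact (RInt_minus (V := C_R_CompleteNormedModule) f g a b). Qed.

Lemma CInt_Chasles (f : R -> C) (a b c : R) : ex_CInt f a b -> ex_CInt f b c ->
  (CInt f a b + CInt f b c)%C = CInt f a c.
Proof. exact (RInt_Chasles (V := C_R_CompleteNormedModule) f a b c). Qed.

Lemma is_CInt_affine (u v : C) (a b : R) :
  is_RInt (V := C_R_NormedModule) (fun x : R => u + v * x)%C a b
    (u * RtoC (b - a) + v * RtoC ((b ^ 2 - a ^ 2) / 2))%C.
Proof.
  assert (A : forall m k : R, is_RInt (fun x => m + k * x) a b (m * (b - a) + k * ((b ^ 2 - a ^ 2) / 2))).
  { intros m k.
    replace (m * (b - a) + k * ((b ^ 2 - a ^ 2) / 2))
      with (minus (m * b + k * (b ^ 2 / 2)) (m * a + k * (a ^ 2 / 2)))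
      by (unfold minus, plus, opp; simpl; field).
    apply (is_RInt_derive (V := R_CompleteNormedModule) (fun x => m * x + k * (x ^ 2 / 2))).
    - intros x _. auto_derive; [exact I|field].
    - intros x _. apply (ex_derive_continuous (V := R_NormedModule)). auto_derive; exact I. }
  destruct u as [u1 u2], v as [v1 v2].
  unfold Cplus, Cmult, RtoC; simpl fst; simpl snd.
  apply (is_RInt_fct_extend_pair (U := R_NormedModule) (V := R_NormedModule)); simpl.
  - replace (u1 * (b - a) - u2 * 0 + (v1 * ((b * (b * 1) - a * (a * 1)) / 2) - v2 * 0))
      with (u1 * (b - a) + v1 * ((b ^ 2 - a ^ 2) / 2)) by field.
    apply is_RInt_ext with (2 := A u1 v1).
    intros x _. match goal with |- _ = ?r => change (u1 + v1 * x = r) end. ring.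
  - replace (u1 * 0 + u2 * (b - a) + (v1 * 0 + v2 * ((b * (b * 1) - a * (a * 1)) / 2)))
      with (u2 * (b - a) + v2 * ((b ^ 2 - a ^ 2) / 2)) by field.
    apply is_RInt_ext with (2 := A u2 v2).
    intros x _. match goal with |- _ = ?r => change (u2 + v2 * x = r) end. ring.
Qed.

Lemma continuous_path (F : C -> C) (g : R -> C) (t : R) : ex_derive F (g t) ->
  (forall s, Cmod (g s - g t)%C <= Rabs (s - t)) ->
  continuous (U := C_R_NormedModule) (fun s => F (g s)) t.
Proof.
  intros HF Hg. apply filterlim_locally. intros eps.
  destruct (Cderive_cont F (g t) HF eps (cond_pos eps)) as [d [Hd H]].
  exists (mkposreal d Hd). intros s Hs.
  apply C_NormedModule_mixin_compat1.
  specialize (H (g s - g t)%C). replace (g t + (g s - g t))%C with (g s) in H by ring.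
  apply H. eapply Rle_lt_trans; [apply Hg|exact Hs].
Qed.

Definition horiz_int (F : C -> C) (a b y : R) : C := CInt (fun x => F (x, y)) a b.
Definition vert_int (F : C -> C) (x c d : R) : C := CInt (fun y => F (x, y)) c d.

Definition rect_int (F : C -> C) (a b c d : R) : C :=
  (horiz_int F a b c - horiz_int F a b d + Ci * (vert_int F b c d - vert_int F a c d))%C.

Definition holo_rect (F : C -> C) (a b c d : R) : Prop :=
  forall x y, a <= x <= b -> c <= y <= d -> ex_derive F ((x, y) : C).

Lemma ex_horiz_int (F : C -> C) (a b y : R) : a <= b ->
  (forall x, a <= x <= b -> ex_derive F ((x, y) : C)) -> ex_CInt (fun x => F (x, y)) a b.
Proof.
  intros Hab H. apply (ex_RInt_continuous (V := C_R_CompleteNormedModule)).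
  intros t Ht. rewrite Rmin_left, Rmax_right in Ht by exact Hab.
  apply (continuous_path F (fun x => (x, y))); [now apply H|].
  intros s. replace ((s, y) - (t, y))%C with (RtoC (s - t))
    by (apply injective_projections; simpl; ring).
  rewrite Cmod_R; lra.
Qed.

Lemma ex_vert_int (F : C -> C) (x c d : R) : c <= d ->
  (forall y, c <= y <= d -> ex_derive F ((x, y) : C)) -> ex_CInt (fun y => F (x, y)) c d.
Proof.
  intros Hab H. apply (ex_RInt_continuous (V := C_R_CompleteNormedModule)).
  intros t Ht. rewrite Rmin_left, Rmax_right in Ht by exact Hab.
  apply (continuous_path F (fun y => (x, y))); [now apply H|].
  intros s. replace ((x, s) - (x, t))%C with (Ci * RtoC (s - t))%C
    by (apply injective_projections; simpl; ring).
  rewrite Cmod_mult, Cmod_Ci, Cmod_R; lra.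
Qed.

Lemma rect_int_split_x (F : C -> C) (a m b c d : R) : a <= m <= b -> c <= d ->
  holo_rect F a b c d -> rect_int F a b c d = (rect_int F a m c d + rect_int F m b c d)%C.
Proof.
  intros Hm Hcd HF. unfold rect_int, horiz_int.
  rewrite <- (CInt_Chasles (fun x => F (x, c)) a m b), <- (CInt_Chasles (fun x => F (x, d)) a m b);
    try (apply ex_horiz_int; [lra|intros x Hx; apply HF; lra]).
  ring.
Qed.

Lemma rect_int_split_y (F : C -> C) (a b c m d : R) : a <= b -> c <= m <= d ->
  holo_rect F a b c d -> rect_int F a b c d = (rect_int F a b c m + rect_int F a b m d)%C.
Proof.
  intros Hab Hm HF. unfold rect_int, vert_int.
  rewrite <- (CInt_Chasles (fun y => F (a, y)) c m d), <- (CInt_Chasles (fun y => F (b, y)) c m d);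
    try (apply ex_vert_int; [lra|intros y Hy; apply HF; lra]).
  ring.
Qed.

Lemma holo_rect_sub (F : C -> C) (a b c d a' b' c' d' : R) :
  holo_rect F a b c d -> a <= a' -> b' <= b -> c <= c' -> d' <= d -> holo_rect F a' b' c' d'.
Proof. intros H ? ? ? ? x y ? ?. apply H; lra. Qed.

(** The side integrals of an affine function are explicit and cancel around the rectangle. Only the
    deviation of [F] from it remains, at most [e] times the perimeter. *)
Lemma rect_int_near_affine (F : C -> C) (u v : C) (a b c d e : R) : a <= b -> c <= d ->
  holo_rect F a b c d ->
  (forall x y, a <= x <= b -> c <= y <= d -> Cmod (F (x, y) - (u + v * (x, y)))%C <= e) ->
  Cmod (rect_int F a b c d) <= 2 * (b - a + (d - c)) * e.
Proof.
  intros Hab Hcd HF He.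
  assert (Hh : forall y, c <= y <= d ->
    is_RInt (V := C_R_NormedModule) (fun x : R => u + v * (x, y))%C a b
      ((u + v * (Ci * y)) * RtoC (b - a) + v * RtoC ((b ^ 2 - a ^ 2) / 2))%C).
  { intros y _. apply is_RInt_ext with (2 := is_CInt_affine (u + v * (Ci * y))%C v a b).
    intros x _. apply injective_projections; simpl; ring. }
  assert (Hv : forall x, a <= x <= b ->
    is_RInt (V := C_R_NormedModule) (fun y : R => u + v * (x, y))%C c d
      ((u + v * x) * RtoC (d - c) + v * Ci * RtoC ((d ^ 2 - c ^ 2) / 2))%C).
  { intros x _. apply is_RInt_ext with (2 := is_CInt_affine (u + v * x)%C (v * Ci)%C c d).
    intros y _. apply injective_projections; simpl; ring. }
  assert (Bh : forall y, c <= y <= d ->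
    Cmod (horiz_int F a b y - ((u + v * (Ci * y)) * RtoC (b - a) + v * RtoC ((b ^ 2 - a ^ 2) / 2)))%C
      <= (b - a) * e).
  { intros y Hy. rewrite <- (is_RInt_unique (V := C_R_CompleteNormedModule) _ _ _ _ (Hh y Hy)).
    assert (X : ex_CInt (fun x => F (x, y)) a b) by (apply ex_horiz_int; auto).
    assert (Y : ex_CInt (fun x : R => u + v * (x, y))%C a b) by (eexists; apply (Hh y Hy)).
    unfold horiz_int. change (RInt (V := C_R_CompleteNormedModule)) with CInt.
    rewrite <- CInt_minus by assumption.
    apply Cmod_CInt_le; [exact Hab| |now intros; apply He].
    now apply (ex_RInt_minus (V := C_R_CompleteNormedModule)). }
  assert (Bv : forall x, a <= x <= b ->
    Cmod (vert_int F x c d - ((u + v * x) * RtoC (d - c) + v * Ci * RtoC ((d ^ 2 - c ^ 2) / 2)))%C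
      <= (d - c) * e).
  { intros x Hx. rewrite <- (is_RInt_unique (V := C_R_CompleteNormedModule) _ _ _ _ (Hv x Hx)).
    assert (X : ex_CInt (fun y => F (x, y)) c d) by (apply ex_vert_int; auto).
    assert (Y : ex_CInt (fun y : R => u + v * (x, y))%C c d) by (eexists; apply (Hv x Hx)).
    unfold vert_int. change (RInt (V := C_R_CompleteNormedModule)) with CInt.
    rewrite <- CInt_minus by assumption.
    apply Cmod_CInt_le; [exact Hcd| |now intros; apply He].
    now apply (ex_RInt_minus (V := C_R_CompleteNormedModule)). }
  assert (T : forall p q r s : C, Cmod (p - q + Ci * (r - s))%C <= Cmod p + Cmod q + Cmod r + Cmod s).
  { intros. eapply Rle_trans; [apply Cmod_triangle|]. rewrite Cmod_mult, Cmod_Ci, Rmult_1_l.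
    unfold Cminus. pose proof (Cmod_triangle p (- q)). pose proof (Cmod_triangle r (- s)).
    rewrite Cmod_opp in *. lra. }
  specialize (T
    (horiz_int F a b c - ((u + v * (Ci * c)) * RtoC (b - a) + v * RtoC ((b ^ 2 - a ^ 2) / 2)))%C
    (horiz_int F a b d - ((u + v * (Ci * d)) * RtoC (b - a) + v * RtoC ((b ^ 2 - a ^ 2) / 2)))%C
    (vert_int F b c d - ((u + v * b) * RtoC (d - c) + v * Ci * RtoC ((d ^ 2 - c ^ 2) / 2)))%C
    (vert_int F a c d - ((u + v * a) * RtoC (d - c) + v * Ci * RtoC ((d ^ 2 - c ^ 2) / 2)))%C).
  unfold rect_int.
  match type of T with Cmod ?X <= _ => replace (horiz_int F a b c - horiz_int F a b d + Ci * (vert_int F b c d - vert_int F a c d))%C with X end.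
  - eapply Rle_trans; [exact T|].
    pose proof (Bh c ltac:(lra)). pose proof (Bh d ltac:(lra)).
    pose proof (Bv a ltac:(lra)). pose proof (Bv b ltac:(lra)). lra.
  - rewrite !RtoC_minus. ring.
Qed.

(** Rectangles are given by a corner and side lengths, so the sides at stage [n] are exactly
    [p / 2 ^ n] and [q / 2 ^ n]. The lower left corners never decrease, the opposite ones never
    increase, and the suprema of the former give a point common to all stages. *)
Lemma nested_rect_bisection (bad : R -> R -> R -> R -> Prop) (a c p q : R) :
  0 <= p -> 0 <= q ->
  (forall a c p q, bad a c p q ->
     bad a c (p / 2) (q / 2) \/ bad (a + p / 2) c (p / 2) (q / 2) \/
     bad a (c + q / 2) (p / 2) (q / 2) \/ bad (a + p / 2) (c + q / 2) (p / 2) (q / 2)) ->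
  bad a c p q ->
  exists x y, forall n, exists a' c',
    bad a' c' (p / 2 ^ n) (q / 2 ^ n) /\
    a <= a' <= x /\ x <= a' + p / 2 ^ n /\ a' + p / 2 ^ n <= a + p /\
    c <= c' <= y /\ y <= c' + q / 2 ^ n /\ c' + q / 2 ^ n <= c + q.
Proof.
  intros Hp Hq Hstep H0.
  assert (Hpow : forall n, 0 < 2 ^ n) by (intros; apply pow_lt; lra).
  set (good_pt := fun n (s : R * R) => bad (fst s) (snd s) (p / 2 ^ n) (q / 2 ^ n)).
  assert (Hnext : forall n s, good_pt n s -> { s' | good_pt (S n) s' /\
      (fst s' = fst s \/ fst s' = fst s + p / 2 ^ S n) /\
      (snd s' = snd s \/ snd s' = snd s + q / 2 ^ S n) }).
  { intros n [x y] Hs. apply constructive_indefinite_description.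
    assert (Ep : p / 2 ^ n / 2 = p / 2 ^ S n) by (simpl; field; apply Rgt_not_eq, Hpow).
    assert (Eq : q / 2 ^ n / 2 = q / 2 ^ S n) by (simpl; field; apply Rgt_not_eq, Hpow).
    destruct (Hstep _ _ _ _ Hs) as [H|[H|[H|H]]]; simpl fst in *; simpl snd in *; rewrite ?Ep, ?Eq in H.
    - exists (x, y); auto.
    - exists (x + p / 2 ^ S n, y); auto.
    - exists (x, y + q / 2 ^ S n); auto.
    - exists (x + p / 2 ^ S n, y + q / 2 ^ S n); auto. }
  assert (H0' : good_pt 0%nat (a, c)) by (unfold good_pt; simpl; now rewrite !Rdiv_1_r).
  pose (seq := fix seq n : { s | good_pt n s } :=
    match n with
    | O => exist _ (a, c) H0'
    | S m => let (s, Hs) := seq m in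
             let (s', Hs') := Hnext m s Hs in exist _ s' (proj1 Hs')
    end).
  set (u := fun n => fst (proj1_sig (seq n))). set (v := fun n => snd (proj1_sig (seq n))).
  assert (Hu : forall n, u (S n) = u n \/ u (S n) = u n + p / 2 ^ S n).
  { intros n. unfold u. simpl seq. destruct (seq n) as [s Hs]. destruct (Hnext n s Hs) as [s' [? [? ?]]]. auto. }
  assert (Hv : forall n, v (S n) = v n \/ v (S n) = v n + q / 2 ^ S n).
  { intros n. unfold v. simpl seq. destruct (seq n) as [s Hs]. destruct (Hnext n s Hs) as [s' [? [? ?]]]. auto. }
  assert (Lim : forall (w : nat -> R) (r w0 : R), 0 <= r -> w O = w0 ->
    (forall n, w (S n) = w n \/ w (S n) = w n + r / 2 ^ S n) ->
    exists l, forall n, w0 <= w n <= l /\ l <= w n + r / 2 ^ n /\ w n + r / 2 ^ n <= w0 + r).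
  { clear - Hpow. intros w r w0 Hr E0 Hw.
    assert (Eh : forall n, r / 2 ^ n = 2 * (r / 2 ^ S n)).
    { intros n. simpl. field. apply Rgt_not_eq, Hpow. }
    assert (Hr' : forall n, 0 <= r / 2 ^ n).
    { intros n. apply Rmult_le_pos; [exact Hr|]. apply Rlt_le, Rinv_0_lt_compat, Hpow. }
    assert (Hinc : forall n, w n <= w (S n)).
    { intros n. specialize (Hr' (S n)). destruct (Hw n); lra. }
    assert (Hdec : forall n, w (S n) + r / 2 ^ S n <= w n + r / 2 ^ n).
    { intros n. specialize (Hr' (S n)). rewrite (Eh n). destruct (Hw n); lra. }
    assert (Hinc' : forall n m, (n <= m)%nat -> w n <= w m).
    { intros n m H. induction H; [lra|]. specialize (Hinc m). lra. }
    assert (Hdec' : forall n m, (n <= m)%nat -> w m + r / 2 ^ m <= w n + r / 2 ^ n).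
    { intros n m H. induction H; [lra|]. specialize (Hdec m). lra. }
    assert (Hbd : forall n m, w m <= w n + r / 2 ^ n).
    { intros n m. destruct (Nat.le_ge_cases n m) as [H|H].
      - specialize (Hdec' _ _ H). specialize (Hr' m). lra.
      - specialize (Hinc' _ _ H). specialize (Hr' n). lra. }
    destruct (completeness (fun x => exists n, x = w n)) as [l [Hl1 Hl2]].
    - exists (w O + r / 2 ^ O). intros x [n ->]. apply Hbd.
    - exists (w O). now exists O.
    - exists l. intros n. split; [split|split].
      + rewrite <- E0. apply Hinc'. lia.
      + apply Hl1. now exists n.
      + apply Hl2. intros x [m ->]. apply Hbd.
      + specialize (Hdec' O n ltac:(lia)). simpl in Hdec'. rewrite E0 in Hdec'. lra. }
  destruct (Lim u p a Hp eq_refl Hu) as [x Hx]. destruct (Lim v q c Hq eq_refl Hv) as [y Hy].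
  exists x, y. intros n. exists (u n), (v n). specialize (Hx n). specialize (Hy n).
  split; [|lra]. exact (proj2_sig (seq n)).
Qed.

Theorem goursat_rect (F : C -> C) (a b c d : R) : a <= b -> c <= d ->
  holo_rect F a b c d -> rect_int F a b c d = 0%C.
Proof.
  intros Hab Hcd HF. apply Cmod_eq_0.
  set (A := Cmod (rect_int F a b c d)).
  destruct (Cmod_ge_0 (rect_int F a b c d)) as [HA|HA]; [exfalso|auto].
  set (p := b - a). set (q := d - c).
  (* The integral is at least [A] times the squared ratio of the half-perimeters. One of the four
     quarters inherits this, because the half-perimeter is halved and the four integrals add up to
     the whole. *)
  set (bad := fun a' c' p' q' =>
    0 <= p' /\ 0 <= q' /\ a <= a' /\ a' + p' <= b /\ c <= c' /\ c' + q' <= d /\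
    A * (p' + q') ^ 2 <= (p + q) ^ 2 * Cmod (rect_int F a' (a' + p') c' (c' + q'))).
  destruct (nested_rect_bisection bad a c p q) as [x [y Hxy]].
  - unfold p; lra.
  - unfold q; lra.
  - intros a' c' p' q' (H1 & H2 & H3 & H4 & H5 & H6 & H7).
    assert (HF' : holo_rect F a' (a' + p') c' (c' + q')) by (eapply holo_rect_sub; eauto; lra).
    rewrite (rect_int_split_x F a' (a' + p' / 2)) in H7 by (try assumption; lra).
    rewrite (rect_int_split_y F a' (a' + p' / 2) c' (c' + q' / 2)) in H7
      by (try (eapply holo_rect_sub; [exact HF'|..]); lra).
    rewrite (rect_int_split_y F (a' + p' / 2) (a' + p') c' (c' + q' / 2)) in H7
      by (try (eapply holo_rect_sub; [exact HF'|..]); lra).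
    assert (Ep : a' + p' = a' + p' / 2 + p' / 2) by field.
    assert (Eq : c' + q' = c' + q' / 2 + q' / 2) by field.
    rewrite Ep, Eq in H7.
    set (z1 := rect_int F a' (a' + p' / 2) c' (c' + q' / 2)) in *.
    set (z2 := rect_int F a' (a' + p' / 2) (c' + q' / 2) (c' + q' / 2 + q' / 2)) in *.
    set (z3 := rect_int F (a' + p' / 2) (a' + p' / 2 + p' / 2) c' (c' + q' / 2)) in *.
    set (z4 := rect_int F (a' + p' / 2) (a' + p' / 2 + p' / 2) (c' + q' / 2) (c' + q' / 2 + q' / 2)) in *.
    assert (T : Cmod (z1 + z2 + (z3 + z4))%C <= Cmod z1 + Cmod z2 + Cmod z3 + Cmod z4).
    { pose proof (Cmod_triangle (z1 + z2) (z3 + z4)). pose proof (Cmod_triangle z1 z2).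
      pose proof (Cmod_triangle z3 z4). lra. }
    assert (Hpq : 0 <= (p + q) ^ 2) by apply pow2_ge_0.
    apply Rmult_le_compat_l with (r := (p + q) ^ 2) in T; [|exact Hpq].
    replace (A * (p' + q') ^ 2) with (4 * (A * (p' / 2 + q' / 2) ^ 2)) in H7 by field.
    unfold bad.
    destruct (Rle_dec (A * (p' / 2 + q' / 2) ^ 2) ((p + q) ^ 2 * Cmod z1)); [left; repeat split; try assumption; lra|].
    destruct (Rle_dec (A * (p' / 2 + q' / 2) ^ 2) ((p + q) ^ 2 * Cmod z3)); [right; left; repeat split; try assumption; lra|].
    destruct (Rle_dec (A * (p' / 2 + q' / 2) ^ 2) ((p + q) ^ 2 * Cmod z2)); [right; right; left; repeat split; try assumption; lra|].
    destruct (Rle_dec (A * (p' / 2 + q' / 2) ^ 2) ((p + q) ^ 2 * Cmod z4)); [right; right; right; repeat split; try assumption; lra|].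
    exfalso; lra.
  - repeat split; try (unfold p, q; lra).
    replace (a + p) with b by (unfold p; ring). replace (c + q) with d by (unfold q; ring).
    fold A. lra.
  - assert (Hx : a <= x <= b /\ c <= y <= d).
    { destruct (Hxy O) as (a' & c' & _ & H). simpl in H. unfold p, q in H. lra. }
    destruct (HF x y) as [l Hl]; [tauto|tauto|].
    assert (Hpq : 0 < (p + q) ^ 2).
    { destruct (Hxy O) as (a' & c' & (H1 & H2 & _) & _). simpl in H1, H2. rewrite Rdiv_1_r in H1, H2.
      destruct (Req_dec (p + q) 0) as [E|E]; [|apply pow2_gt_0, E].
      exfalso. unfold p, q in *.
      assert (a = b) by lra. assert (c = d) by lra. subst b d.
      assert (rect_int F a a c c = 0%C).
      { unfold rect_int, horiz_int, vert_int, CInt. rewrite !RInt_point.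
        change (@zero (CompleteNormedModule.AbelianMonoid _ C_R_CompleteNormedModule)) with (RtoC 0). ring. }
      rewrite H in HA. rewrite Cmod_0 in HA. lra. }
    (* With this constant the affine estimate bounds the integral over a small bad rectangle by half
       of the lower bound that badness imposes. *)
    set (e := A / (4 * (p + q) ^ 2)).
    assert (He : 0 < e) by (apply Rdiv_lt_0_compat; [exact HA|lra]).
    destruct (proj1 (is_Cderive_eps _ _ _) Hl e He) as [dl [Hdl Hd]].
    assert (Hn : exists n, (p + q) / 2 ^ n < dl).
    { destruct (pow_lt_1_zero (1 / 2) ltac:(rewrite Rabs_pos_eq; lra) (dl / (p + q + 1))) as [n Hn].
      - apply Rdiv_lt_0_compat; [lra|]. unfold p, q; lra.
      - exists n. specialize (Hn n (le_n _)).
        rewrite Rabs_pos_eq in Hn by (apply pow_le; lra).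
        replace ((p + q) / 2 ^ n) with ((p + q) * (1 / 2) ^ n).
        + assert (0 <= p + q) by (unfold p, q; lra). assert (0 < (1 / 2) ^ n) by (apply pow_lt; lra).
          apply Rlt_div_r in Hn; [nra|lra].
        + unfold Rdiv. rewrite Rmult_1_l, pow_inv. ring. }
    destruct Hn as [n Hn]. destruct (Hxy n) as (a' & c' & (H1 & H2 & H3 & H4 & H5 & H6 & H7) & Hloc).
    set (p' := p / 2 ^ n) in *. set (q' := q / 2 ^ n) in *.
    replace ((p + q) / 2 ^ n) with (p' + q') in Hn by (unfold p', q'; field; apply pow_nonzero; lra).
    assert (B : Cmod (rect_int F a' (a' + p') c' (c' + q')) <= 2 * (p' + q') * (e * (p' + q'))).
    { replace (2 * (p' + q')) with (2 * (a' + p' - a' + (c' + q' - c'))) by ring.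
      apply rect_int_near_affine with (u := (F (x, y) - l * (x, y))%C) (v := l); try lra.
      - eapply holo_rect_sub; [exact HF|..]; lra.
      - intros s t Hs Ht.
        assert (Hh : Cmod ((s, t) - (x, y))%C <= p' + q').
        { eapply Rle_trans; [apply Cmod_le_Re_Im|]. simpl.
          apply Rplus_le_compat; apply Rabs_le; lra. }
        specialize (Hd ((s, t) - (x, y))%C ltac:(lra)).
        assert (E : forall u v : C, (u + (v - u))%C = v) by (intros; ring).
        rewrite E in Hd.
        replace (F (s, t) - (F (x, y) - l * (x, y) + l * (s, t)))%C
          with (F (s, t) - F (x, y) - l * ((s, t) - (x, y)))%C by ring.
        eapply Rle_trans; [exact Hd|]. apply Rmult_le_compat_l; lra. }
    assert (Hpq0 : p + q <> 0) by (intros E; rewrite E in Hpq; lra).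
    assert (HA' : A = 4 * (p + q) ^ 2 * e) by (unfold e; field; exact Hpq0).
    assert (Hpq' : 0 < p' + q').
    { replace (p' + q') with ((p + q) / 2 ^ n) by (unfold p', q'; field; apply pow_nonzero; lra).
      apply Rdiv_lt_0_compat; [|apply pow_lt; lra].
      destruct (Rle_lt_dec (p + q) 0); [|assumption].
      assert (E : p + q = 0) by (unfold p, q in *; lra). rewrite E in Hpq. lra. }
    apply Rmult_le_compat_l with (r := (p + q) ^ 2) in B; [|lra].
    rewrite HA' in H7.
    assert (0 < (p + q) ^ 2 * e * (p' + q') ^ 2) by
      (apply Rmult_lt_0_compat; [apply Rmult_lt_0_compat; assumption|now apply pow_lt]).
    lra.
Qed.

(** * The maximum principle and open mappings *)

(* Applying Goursat's theorem to [f (z0 + exp _)] on a rectangle of height [2 PI]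
   whose left side recedes to infinity gives the mean value property. *)
Lemma max_modulus_center (f : C -> C) (z0 : C) (rho M : R) : 0 < rho ->
  (forall z, Cmod (z - z0)%C <= rho -> ex_derive f z) ->
  (forall z, Cmod (z - z0)%C = rho -> Cmod (f z) <= M) ->
  Cmod (f z0) <= M.
Proof.
  intros Hrho Hf HM.
  pose proof PI_RGT_0 as Hpi.
  apply le_epsilon. intros eps Heps.
  destruct (Cderive_cont f z0) with (eps := eps) as [d [Hd Hc]].
  { apply Hf. replace (z0 - z0)%C with (RtoC 0) by ring. rewrite Cmod_0. lra. }
  { exact Heps. }
  (* The right side of the rectangle is mapped to the circle of radius [rho], the left side to one
     of radius below [d], where [f] differs from [f z0] by less than [eps]. *)
  set (b := ln rho). set (a := Rmin b (ln (d / 2))).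
  assert (Hab : a <= b) by apply Rmin_l.
  assert (Ha : exp a < d).
  { apply Rle_lt_trans with (exp (ln (d / 2))).
    - destruct (Rmin_r b (ln (d / 2))) as [H|H]; [left; now apply exp_increasing|right].
      unfold a; now rewrite H.
    - rewrite exp_ln by lra. lra. }
  assert (Hexp : forall x, x <= b -> exp x <= rho).
  { intros x [H|H]; [left|right].
    - rewrite <- (exp_ln rho) by exact Hrho. now apply exp_increasing.
    - rewrite H. now apply exp_ln. }
  set (F := fun z : C => f (z0 + Cexp z)%C).
  assert (HF : holo_rect F a b 0 (2 * PI)).
  { intros x y Hx Hy.
    destruct (Hf (z0 + Cexp (x, y))%C) as [l Hl].
    - replace (z0 + Cexp (x, y) - z0)%C with (Cexp (x, y)) by ring.
      rewrite Cmod_Cexp. apply Hexp. simpl; lra.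
    - eexists. apply (is_Cderive_comp f (fun z => z0 + Cexp z)%C); [exact Hl|].
      apply is_Cderive_plus; [apply is_Cderive_const|apply is_Cderive_Cexp]. }
  assert (H := goursat_rect F a b 0 (2 * PI) Hab ltac:(lra) HF).
  (* The horizontal sides cancel by periodicity of [Cexp], so the means over the two circles
     agree. *)
  assert (Eh : horiz_int F a b (2 * PI) = horiz_int F a b 0).
  { unfold horiz_int. f_equal. apply FunctionalExtensionality.functional_extensionality. intros x.
    unfold F, Cexp; simpl. now rewrite cos_2PI, sin_2PI, cos_0, sin_0. }
  unfold rect_int in H. rewrite Eh in H.
  assert (Ev : vert_int F b 0 (2 * PI) = vert_int F a 0 (2 * PI)).
  { assert (N : Ci <> 0%C) by (intros E; apply (f_equal Im) in E; simpl in E; lra).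
    assert (E : (Ci * (vert_int F b 0 (2 * PI) - vert_int F a 0 (2 * PI)))%C = 0%C) by (rewrite <- H; ring).
    destruct (Ceq_dec (vert_int F b 0 (2 * PI) - vert_int F a 0 (2 * PI))%C 0) as [E'|E'];
      [|now destruct (Cmult_neq_0 _ _ N E')].
    replace (vert_int F b 0 (2 * PI)) with
      (vert_int F b 0 (2 * PI) - vert_int F a 0 (2 * PI) + vert_int F a 0 (2 * PI))%C by ring.
    rewrite E'. ring. }
  assert (Xb : ex_CInt (fun y => F (b, y)) 0 (2 * PI)) by (apply ex_vert_int; [lra|intros; apply HF; lra]).
  assert (Xa : ex_CInt (fun y => F (a, y)) 0 (2 * PI)) by (apply ex_vert_int; [lra|intros; apply HF; lra]).
  assert (Bb : Cmod (vert_int F b 0 (2 * PI)) <= (2 * PI - 0) * M).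
  { apply Cmod_CInt_le; [lra|exact Xb|]. intros y _. apply HM.
    replace (z0 + Cexp (b, y) - z0)%C with (Cexp (b, y)) by ring.
    rewrite Cmod_Cexp. apply exp_ln, Hrho. }
  assert (Ic := is_CInt_affine (f z0) 0 0 (2 * PI)).
  assert (Ba : Cmod (vert_int F a 0 (2 * PI) - f z0 * RtoC (2 * PI))%C <= (2 * PI - 0) * eps).
  { replace (f z0 * RtoC (2 * PI))%C with (CInt (fun x : R => f z0 + 0 * x)%C 0 (2 * PI)).
    - unfold vert_int. rewrite <- CInt_minus; [|exact Xa|eexists; exact Ic].
      apply Cmod_CInt_le; [lra| |].
      + apply (ex_RInt_minus (V := C_R_CompleteNormedModule)); [exact Xa|eexists; exact Ic].
      + intros y _. replace (F (a, y) - (f z0 + 0 * y))%C with (f (z0 + Cexp (a, y)) - f z0)%C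
          by (unfold F; ring).
        left. apply Hc. rewrite Cmod_Cexp. exact Ha.
    - unfold CInt. rewrite (is_RInt_unique (V := C_R_CompleteNormedModule) _ _ _ _ Ic).
      rewrite Rminus_0_r. ring. }
  assert (T : Cmod (f z0 * RtoC (2 * PI))%C <= 2 * PI * M + 2 * PI * eps).
  { replace (f z0 * RtoC (2 * PI))%C with
      (vert_int F b 0 (2 * PI) + - (vert_int F a 0 (2 * PI) - f z0 * RtoC (2 * PI)))%C by (rewrite Ev; ring).
    eapply Rle_trans; [apply Cmod_triangle|]. rewrite Cmod_opp. lra. }
  rewrite Cmod_mult, Cmod_R, Rabs_pos_eq in T by lra.
  apply Rmult_le_reg_r with (2 * PI); lra.
Qed.

(* If [w] were omitted, [1 / (f - w)] would violate the maximum principle. *)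
Theorem open_mapping (f : C -> C) (z0 : C) (rho : R) : 0 < rho ->
  (forall z, Cmod (z - z0)%C <= rho -> ex_derive f z) ->
  (forall z, Cmod (z - z0)%C = rho -> f z <> f z0) ->
  exists m, 0 < m /\ forall w, Cmod (w - f z0)%C < m ->
    exists z, Cmod (z - z0)%C <= rho /\ f z = w.
Proof.
  intros Hrho Hf Hne. pose proof PI_RGT_0 as Hpi.
  set (g := fun t => (z0 + Cexp (ln rho, t))%C).
  assert (Hg : forall t, Cmod (g t - z0)%C = rho).
  { intros t. unfold g. replace (z0 + Cexp (ln rho, t) - z0)%C with (Cexp (ln rho, t)) by ring.
    rewrite Cmod_Cexp. apply exp_ln, Hrho. }
  destruct (continuity_ab_min (fun t => Cmod (f (g t) - f z0)%C) (- PI) PI) as [t0 [Hmin _]].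
  { lra. }
  { intros t _ eps He.
    destruct (Hf (g t)) as [l Hl]; [rewrite Hg; lra|].
    destruct (Cderive_cont (fun z => f (z0 + Cexp z)%C) (ln rho, t)) with (eps := eps) as [d [Hd H]].
    - eexists. apply (is_Cderive_comp f (fun z => z0 + Cexp z)%C); [exact Hl|].
      apply is_Cderive_plus; [apply is_Cderive_const|apply is_Cderive_Cexp].
    - exact He.
    - exists d. split; [exact Hd|]. intros s [_ Hs].
      unfold dist in *; simpl in *. unfold Rdist in *.
      specialize (H (Ci * RtoC (s - t))%C).
      rewrite Cmod_mult, Cmod_Ci, Cmod_R, Rmult_1_l in H. specialize (H Hs).
      assert (E : ((ln rho, t) + Ci * RtoC (s - t))%C = ((ln rho, s) : C))
        by (apply injective_projections; simpl; ring).
      rewrite E in H. fold (g s) in H. fold (g t) in H.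
      eapply Rle_lt_trans; [|exact H].
      apply Rabs_le.
      pose proof (Cmod_triangle (f (g s) - f (g t)) (f (g t) - f z0)) as T1.
      pose proof (Cmod_triangle (- (f (g s) - f (g t))) (f (g s) - f z0)) as T2.
      rewrite Cmod_opp in T2.
      replace (f (g s) - f (g t) + (f (g t) - f z0))%C with (f (g s) - f z0)%C in T1 by ring.
      replace (- (f (g s) - f (g t)) + (f (g s) - f z0))%C with (f (g t) - f z0)%C in T2 by ring.
      lra. }
  set (m := Cmod (f (g t0) - f z0)%C) in Hmin.
  assert (Hm : 0 < m).
  { apply Cmod_gt_0. intros E. apply (Hne (g t0) (Hg t0)).
    replace (f (g t0)) with (f (g t0) - f z0 + f z0)%C by ring. rewrite E. ring. }
  assert (Hcirc : forall z, Cmod (z - z0)%C = rho -> m <= Cmod (f z - f z0)%C).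
  { intros z Hz.
    assert (Hz0 : (z - z0)%C <> 0%C) by (apply Cmod_gt_0; lra).
    replace z with (g (Carg (z - z0)%C)).
    - apply Hmin. pose proof (Carg_bound _ Hz0). lra.
    - unfold g. rewrite <- Hz. change (z0 + Cexp (Clog (z - z0)) = z)%C.
      rewrite Cexp_Clog by exact Hz0. ring. }
  (* For such [w], [|f - w|] is at least [m / 2] on the circle but smaller than [m / 2] at the
     centre. *)
  exists (m / 2). split; [lra|]. intros w Hw.
  destruct (Classical_Prop.classic (exists z, Cmod (z - z0)%C <= rho /\ f z = w)) as [H|H]; [exact H|exfalso].
  assert (Hnz : forall z, Cmod (z - z0)%C <= rho -> (f z - w)%C <> 0%C).
  { intros z Hz E. apply H. exists z. split; [exact Hz|].
    replace (f z) with (f z - w + w)%C by ring. rewrite E. ring. }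
  assert (B : Cmod (/ (f z0 - w))%C <= / (m / 2)).
  { apply (max_modulus_center (fun z => / (f z - w))%C z0 rho); [exact Hrho| |].
    - intros z Hz. destruct (Hf z Hz) as [l Hl]. eexists.
      apply (is_Cderive_inv (fun z => f z - w)%C); [now apply Hnz|].
      apply is_Cderive_minus; [exact Hl|apply is_Cderive_const].
    - intros z Hz. rewrite Cmod_inv by (apply Hnz; lra).
      apply Rinv_le_contravar; [lra|].
      specialize (Hcirc z Hz).
      pose proof (Cmod_triangle (f z - w) (w - f z0)) as T.
      replace (f z - w + (w - f z0))%C with (f z - f z0)%C in T by ring. lra. }
  assert (Hz0 : Cmod (z0 - z0)%C <= rho).
  { replace (z0 - z0)%C with (RtoC 0) by ring. rewrite Cmod_0. lra. }
  specialize (Hnz z0 Hz0).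
  rewrite Cmod_inv in B by exact Hnz.
  assert (P : 0 < Cmod (f z0 - w)%C) by now apply Cmod_gt_0.
  assert (Cmod (w - f z0)%C = Cmod (f z0 - w)%C).
  { rewrite <- Cmod_opp. f_equal. ring. }
  assert (/ (m / 2) < / Cmod (f z0 - w)%C) by (apply Rinv_lt_contravar; [apply Rmult_lt_0_compat; lra|lra]).
  lra.
Qed.

(** Univalence supplies the hypothesis of [open_mapping] on the circle. The preimages are located in
    a closed disk inside the unit disk, which is what excludes the boundary value from the image. *)
Lemma disk_image_open (psi : C -> C) (z0 : C) (rho : R) : MaMinda psi ->
  0 < rho -> Cmod z0 + rho < 1 ->
  exists m, 0 < m /\ forall w, Cmod (w - psi z0)%C < m ->
    exists z, Cmod z <= Cmod z0 + rho /\ psi z = w.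
Proof.
  intros Hpsi Hrho Hz0.
  assert (B : forall z, Cmod (z - z0)%C <= rho -> Cmod z <= Cmod z0 + rho).
  { intros z Hz. pose proof (Cmod_triangle (z - z0) z0) as T.
    replace (z - z0 + z0)%C with z in T by ring. lra. }
  destruct (open_mapping psi z0 rho Hrho) as [m [Hm H]].
  - intros z Hz. apply (MaMinda_analytic _ Hpsi). specialize (B z Hz). lra.
  - intros z Hz E. apply (MaMinda_univalent _ Hpsi) in E.
    + rewrite E in Hz. replace (z0 - z0)%C with (RtoC 0) in Hz by ring. rewrite Cmod_0 in Hz. lra.
    + specialize (B z ltac:(lra)). lra.
    + lra.
  - exists m. split; [exact Hm|]. intros w Hw. destruct (H w Hw) as [z [Hz E]].
    exists z. auto.
Qed.

(** The image is open at [psi 0 = 1], and it omits 0 because real parts are positive there. *)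
Lemma largest_disk_radius_bounds (psi : C -> C) (r1 : R) : MaMinda psi ->
  largest_disk_radius psi r1 -> 0 < r1 <= 1.
Proof.
  intros Hpsi [H1 H2]. split.
  - destruct (disk_image_open psi 0%C (1 / 2) Hpsi) as [m [Hm H]]; [lra|rewrite Cmod_0; lra|].
    apply Rlt_le_trans with m; [exact Hm|]. apply H2. intros w Hw.
    destruct (H w) as [z [Hz E]]; [now rewrite (MaMinda_0 _ Hpsi)|].
    exists z. split; [rewrite Cmod_0 in Hz; lra|exact E].
  - destruct (Rle_lt_dec r1 1) as [H|H]; [exact H|exfalso].
    destruct (H1 0%C) as [z [Hz E]].
    + replace (0 - 1)%C with (- (1))%C by ring. now rewrite Cmod_m1.
    + pose proof (MaMinda_Re_pos _ Hpsi z Hz) as P. rewrite E in P. simpl in P. lra.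
Qed.

(** If [w = psi z0], all values near [w] are taken at points of a disk of radius less than 1 about
    0. But [psi x] is near [w] for real [x] close to [-1], outside that disk, against univalence. *)
Lemma boundary_value_not_in_image (psi : C -> C) (w : C) : MaMinda psi ->
  boundary_value_at_m1 psi w -> ~ disk_image psi w.
Proof.
  intros Hpsi Hb [z0 [Hz0 E]].
  set (rho := (1 - Cmod z0) / 2).
  destruct (disk_image_open psi z0 rho Hpsi) as [m [Hm H]]; [unfold rho; lra|unfold rho; lra|].
  rewrite E in H.
  pose proof (proj1 (filterlim_locally _ _) Hb) as Hb'.
  (* The balls of [locally] on [C] are squares: membership in the one of radius [m / 2] only bounds
     the modulus by [sqrt 2 * (m / 2)], which is still at most [m]. *)
  assert (Hm2 : 0 < m / 2) by lra.
  destruct (Hb' (mkposreal _ Hm2)) as [d Hd].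
  pose proof (cond_pos d) as Hd0. pose proof (Cmod_ge_0 z0).
  set (x := -1 + Rmin (d / 2) ((1 - Cmod z0 - rho) / 2)).
  assert (Hx : 0 < Rmin (d / 2) ((1 - Cmod z0 - rho) / 2)) by (apply Rmin_pos; unfold rho; lra).
  pose proof (Rmin_l (d / 2) ((1 - Cmod z0 - rho) / 2)) as X1.
  pose proof (Rmin_r (d / 2) ((1 - Cmod z0 - rho) / 2)) as X2.
  specialize (Hd x).
  assert (B : ball w (m / 2) (psi (RtoC x))).
  { apply Hd; [|unfold x; lra].
    change (Rabs (x - -1) < d). apply Rabs_lt_between. unfold x; lra. }
  apply (C_NormedModule_mixin_compat2 w (psi (RtoC x)) (mkposreal _ Hm2)) in B. simpl in B.
  destruct (H (psi (RtoC x))) as [z [Hz E']].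
  - change (Cmod (psi (RtoC x) - w)%C < sqrt 2 * (m / 2)) in B.
    eapply Rlt_le_trans; [exact B|].
    assert (sqrt 2 <= 2).
    { rewrite <- (sqrt_Rsqr 2) at 2 by lra. apply sqrt_le_1_alt. unfold Rsqr; lra. }
    nra.
  - assert (Hx1 : Cmod (RtoC x) = - x) by (rewrite Cmod_R, Rabs_left; [reflexivity|unfold x, rho in *; lra]).
    apply (MaMinda_univalent _ Hpsi) in E'.
    + rewrite E', Hx1 in Hz. unfold x in Hz. lra.
    + unfold rho in Hz. lra.
    + rewrite Hx1. unfold x. lra.
Qed.

(** * Real-rooted polynomials *)

(** [P] is a polynomial function of degree at most [n] with real coefficients,
    [a] being the coefficient of degree [n]. *)
Fixpoint is_poly (n : nat) (a : R) (P : C -> C) : Prop :=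
  match n with
  | O => forall x, P x = RtoC a
  | S m => exists b Q, is_poly m a Q /\ forall x, P x = (RtoC b + x * Q x)%C
  end.

Lemma is_poly_div (n : nat) (a : R) (P : C -> C) (c : R) : is_poly (S n) a P ->
  exists r Q, is_poly n a Q /\ forall x, P x = (RtoC r + (x - c) * Q x)%C.
Proof.
  revert P. induction n as [|n IH]; intros P [b [Q [HQ HP]]].
  - exists (b + c * a), (fun _ => RtoC a). split; [now simpl|].
    intros x. rewrite HP, HQ, RtoC_plus, RtoC_mult. ring.
  - destruct (IH Q HQ) as [r [Q1 [HQ1 E]]].
    exists (b + c * r), (fun x => r + x * Q1 x)%C. split.
    + exists r, Q1. auto.
    + intros x. rewrite HP, E, RtoC_plus, RtoC_mult. ring.
Qed.

Lemma is_poly_real (n : nat) (a : R) (P : C -> C) (x : R) :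
  is_poly n a P -> P (RtoC x) = RtoC (Re (P (RtoC x))).
Proof.
  revert P. induction n as [|n IH]; intros P HP.
  - now rewrite HP.
  - destruct HP as [b [Q [HQ HP]]]. rewrite HP, (IH Q HQ), <- RtoC_mult, <- RtoC_plus. reflexivity.
Qed.

Lemma continuity_fext (f g : R -> R) : (forall x, f x = g x) -> continuity f -> continuity g.
Proof. intros H Hf x. apply (continuity_pt_ext f g); [exact H|apply Hf]. Qed.

Lemma is_poly_continuity (n : nat) (a : R) (P : C -> C) :
  is_poly n a P -> continuity (fun x => Re (P (RtoC x))).
Proof.
  revert P. induction n as [|n IH]; intros P HP.
  - apply (continuity_fext (fun _ => a)); [intros x; now rewrite HP|].
    apply continuity_const. now intros ? ?.
  - destruct HP as [b [Q [HQ HP]]].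
    apply (continuity_fext (fun x => b + x * Re (Q (RtoC x)))).
    + intros x. rewrite HP, (is_poly_real n a Q x HQ). simpl. ring.
    + apply continuity_plus; [apply continuity_const; now intros ? ?|].
      apply continuity_mult; [apply derivable_continuous, derivable_id|now apply IH].
Qed.

Definition prod_roots (vs : list R) (z : C) : C :=
  fold_right (fun v p => (z - RtoC v) * p)%C (RtoC 1) vs.

(** A sign change between the first two points gives a root [c]. The quotient by [x - c] has the
    signs of [P] at the remaining points, which lie to the right of [c], so it alternates there and
    the induction applies with [- s]. *)
Lemma is_poly_alternating (n : nat) (a s : R) (P : C -> C) (x : nat -> R) :
  is_poly n a P ->
  (forall i, (i < n)%nat -> x i < x (S i)) ->
  (forall i, (i <= n)%nat -> 0 < s * (-1) ^ i * Re (P (RtoC (x i)))) ->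
  exists vs, length vs = n /\ (forall v, In v vs -> x O < v) /\
    forall z, P z = (RtoC a * prod_roots vs z)%C.
Proof.
  revert s P x. induction n as [|n IH]; intros s P x HP Hx Hs.
  - exists nil. split; [reflexivity|]. split; [intros v []|].
    intros z. rewrite HP. simpl. ring.
  - assert (S0 := Hs O ltac:(lia)). assert (S1 := Hs 1%nat ltac:(lia)).
    assert (X01 := Hx O ltac:(lia)). simpl in S0, S1.
    destruct (IVT_cor (fun t => Re (P (RtoC t))) (x O) (x 1%nat)) as [c [Hc Ec]].
    + now apply is_poly_continuity with (S n) a.
    + lra.
    + destruct (Rle_lt_dec (Re (P (RtoC (x 0%nat))) * Re (P (RtoC (x 1%nat)))) 0) as [H|H]; [exact H|exfalso].
      assert (0 < (s * s) * (Re (P (RtoC (x 0%nat))) * Re (P (RtoC (x 1%nat))))).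
      { apply Rmult_lt_0_compat; [|exact H].
        assert (s <> 0) by (intros ->; lra). nra. }
      assert (0 < (s * 1 * Re (P (RtoC (x 0%nat)))) * (s * (-1 * 1) * Re (P (RtoC (x 1%nat)))))
        by now apply Rmult_lt_0_compat.
      lra.
    + assert (Hc0 : x O < c).
      { destruct Hc as [[H|H] _]; [exact H|exfalso]. rewrite <- H in Ec. rewrite Ec in S0. lra. }
      assert (Hc1 : c < x 1%nat).
      { destruct Hc as [_ [H|H]]; [exact H|exfalso]. rewrite H in Ec. rewrite Ec in S1. lra. }
      destruct (is_poly_div n a P c HP) as [r [Q [HQ E]]].
      assert (Er : r = 0).
      { specialize (E (RtoC c)). rewrite (is_poly_real _ _ _ c HP), Ec in E.
        replace (RtoC r + (RtoC c - RtoC c) * Q (RtoC c))%C with (RtoC r) in E by ring.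
        now apply RtoC_inj in E. }
      subst r.
      destruct (IH (- s) Q (fun i => x (S i)) HQ) as [vs [Hl [Hv Ev]]].
      * intros i Hi. apply Hx. lia.
      * intros i Hi. specialize (Hs (S i) ltac:(lia)).
        assert (Hm : forall j, (j <= i)%nat -> x 1%nat <= x (S j)).
        { induction j as [|j IHj]; intros Hj; [lra|].
          specialize (IHj ltac:(lia)). specialize (Hx (S j) ltac:(lia)). lra. }
        specialize (Hm i (le_n _)).
        rewrite E, (is_poly_real _ _ _ (x (S i)) HQ), <- RtoC_minus, <- RtoC_mult, <- RtoC_plus in Hs.
        unfold RtoC at 1 in Hs; simpl Re in Hs.
        apply Rmult_lt_reg_l with (x (S i) - c); [lra|]. simpl in Hs. lra.
      * exists (c :: vs). split; [simpl; now rewrite Hl|]. split.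
        -- intros v [<-|Hv']; [exact Hc0|]. specialize (Hv v Hv'). lra.
        -- intros z. rewrite E, Ev. simpl. ring.
Qed.

(** For the polynomial with coefficients [e j], these are the reciprocal polynomial, the homogeneous
    form [sum e j A ^ (n - j) B ^ j], and the polynomial itself. The signs will be known at
    [A = cos ^ 2], [B = sin ^ 2]. The reciprocal polynomial is evaluated at squared cotangents, so
    the angle [PI / 2], where the tangent is infinite, is an ordinary point. *)
Fixpoint rev_poly (e : nat -> R) (n : nat) (z : C) : C :=
  match n with
  | O => RtoC (e O)
  | S m => (RtoC (e n) + z * rev_poly e m z)%C
  end.

Fixpoint hom_poly (e : nat -> R) (n : nat) (A B : R) : R :=
  match n with
  | O => e O
  | S m => A * hom_poly e m A B + e n * B ^ n
  end.

Fixpoint poly_eval (e : nat -> R) (n : nat) (z : C) : C :=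
  match n with
  | O => RtoC (e O)
  | S m => (poly_eval e m z + RtoC (e n) * z ^ n)%C
  end.

Lemma is_poly_rev_poly (e : nat -> R) (n : nat) : is_poly n (e O) (rev_poly e n).
Proof.
  induction n as [|n IH]; [now simpl|]. exists (e (S n)), (rev_poly e n). auto.
Qed.

Lemma hom_poly_rev (e : nat -> R) (n : nat) (A B : R) : B <> 0 ->
  RtoC (hom_poly e n A B) = (RtoC (B ^ n) * rev_poly e n (RtoC (A / B)))%C.
Proof.
  intros HB. induction n as [|n IH]; simpl; [ring|].
  rewrite RtoC_plus, RtoC_mult, IH, !RtoC_mult.
  assert (E : (RtoC B * RtoC (A / B))%C = RtoC A) by (rewrite <- RtoC_mult; f_equal; field; auto).
  rewrite <- E. ring.
Qed.

Definition prod_inv_roots (vs : list R) (z : C) : C :=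
  fold_right (fun v p => (1 - RtoC v * z) * p)%C (RtoC 1) vs.

Lemma poly_eval_rev (e : nat -> R) (n : nat) (z : C) : z <> 0%C ->
  poly_eval e n z = (z ^ n * rev_poly e n (/ z))%C.
Proof.
  intros Hz. induction n as [|n IH]; [simpl; ring|].
  simpl poly_eval. simpl rev_poly. rewrite IH, ?Cpow_S. field. exact Hz.
Qed.

Lemma poly_eval_factor (e : nat -> R) (n : nat) (vs : list R) : length vs = n ->
  (forall z, rev_poly e n z = (RtoC (e O) * prod_roots vs z)%C) ->
  forall z, poly_eval e n z = (RtoC (e O) * prod_inv_roots vs z)%C.
Proof.
  intros Hl H z. destruct (Ceq_dec z 0) as [->|Hz].
  - transitivity (RtoC (e O)).
    + clear H. induction n in vs, Hl |- *; [reflexivity|]. destruct vs as [|v vs]; [discriminate|].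
      simpl poly_eval. rewrite (IHn vs) by (now injection Hl). rewrite ?Cpow_S. ring.
    + clear H Hl. induction vs as [|v vs IH]; [simpl; ring|]. simpl.
      transitivity (RtoC (e O) * prod_inv_roots vs 0)%C; [exact IH|unfold prod_inv_roots; ring].
  - rewrite poly_eval_rev, H by exact Hz. clear H. subst n.
    assert (E : (z ^ length vs * prod_roots vs (/ z))%C = prod_inv_roots vs z).
    { induction vs as [|v vs IH]; [simpl; ring|].
      simpl length. simpl prod_roots. simpl prod_inv_roots.
      fold (prod_roots vs (/ z)%C). fold (prod_inv_roots vs z). rewrite <- IH, Cpow_S. field. exact Hz. }
    rewrite <- E. ring.
Qed.

(** * Binomial sums *)

(** Binomial coefficients as reals, with [bin n k = 0] for [k > n] (unlike [Binomial.C]). *)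
Fixpoint bin (n k : nat) : R :=
  match n, k with
  | _, O => 1
  | O, S _ => 0
  | S n, S k => bin n k + bin n (S k)
  end.

Lemma bin_0 (n : nat) : bin n 0 = 1.
Proof. now destruct n. Qed.

Lemma bin_gt (n k : nat) : (n < k)%nat -> bin n k = 0.
Proof.
  revert k. induction n as [|n IH]; intros [|k] H; try lia; simpl; [reflexivity|].
  rewrite !IH by lia. ring.
Qed.

Lemma bin_absorb (n k : nat) : bin n (S k) * (INR k + 1) = bin n k * (INR n - INR k).
Proof.
  revert k. induction n as [|n IH]; intros [|k].
  - simpl. ring.
  - simpl bin. ring.
  - rewrite S_INR. simpl. rewrite bin_0. specialize (IH O). rewrite bin_0 in IH. simpl in IH. lra.
  - rewrite !S_INR. change (bin (S n) (S (S k))) with (bin n (S k) + bin n (S (S k))).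
    change (bin (S n) (S k)) with (bin n k + bin n (S k)).
    pose proof (IH k) as H1. pose proof (IH (S k)) as H2. rewrite S_INR in H2.
    replace ((bin n (S k) + bin n (S (S k))) * (INR k + 1 + 1))
      with (bin n (S k) * (INR k + 1 + 1) + bin n (S (S k)) * (INR k + 1 + 1)) by ring.
    rewrite H2. replace (bin n (S k) * (INR k + 1 + 1)) with (bin n (S k) * (INR k + 1) + bin n (S k)) by ring.
    replace ((bin n k + bin n (S k)) * (INR n + 1 - (INR k + 1)))
      with (bin n k * (INR n - INR k) + bin n (S k) * (INR n - INR k)) by ring.
    rewrite <- H1. ring.
Qed.

(** [bin n k * k! / n ^ k] is the product of the [1 - i / n], [i < k]. *)
Definition falling_ratio (n k : nat) : R := bin n k * INR (fact k) / INR n ^ k.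

Lemma falling_ratio_0 (n : nat) : falling_ratio n 0 = 1.
Proof. unfold falling_ratio. rewrite bin_0. simpl. field. Qed.

Lemma falling_ratio_S (n k : nat) : (0 < n)%nat ->
  falling_ratio n (S k) = falling_ratio n k * (1 - INR k / INR n).
Proof.
  intros Hn. assert (0 < INR n) by now apply lt_0_INR.
  unfold falling_ratio. rewrite fact_simpl, mult_INR, S_INR.
  replace (bin n (S k) * ((INR k + 1) * INR (fact k))) with (bin n (S k) * (INR k + 1) * INR (fact k)) by ring.
  rewrite bin_absorb. simpl. field. split; try apply pow_nonzero; lra.
Qed.

Lemma falling_ratio_bounds (n k : nat) : (0 < n)%nat ->
  0 <= falling_ratio n k /\ 1 - INR k ^ 2 / INR n <= falling_ratio n k <= 1.
Proof.
  intros Hn. assert (Hn' : 0 < INR n) by now apply lt_0_INR.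
  destruct (Nat.le_gt_cases k n) as [Hk|Hk].
  - induction k as [|k IH].
    + rewrite falling_ratio_0. simpl. unfold Rdiv. rewrite !Rmult_0_l. lra.
    + destruct IH as [H1 [H2 H3]]; [lia|]. rewrite falling_ratio_S by exact Hn.
      assert (Hq : 0 <= INR k / INR n <= 1).
      { pose proof (pos_INR k). apply le_INR in Hk. rewrite S_INR in Hk.
        split; apply Rmult_le_reg_r with (INR n); unfold Rdiv; rewrite ?Rmult_assoc, ?Rinv_l; lra. }
      rewrite S_INR.
      replace ((INR k + 1) ^ 2 / INR n) with (INR k ^ 2 / INR n + 2 * (INR k / INR n) + / INR n) by (field; lra).
      pose proof (Rinv_0_lt_compat _ Hn'). nra.
  - unfold falling_ratio. rewrite bin_gt by exact Hk. unfold Rdiv. rewrite !Rmult_0_l.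
    split; [lra|split; [|lra]].
    apply Rplus_le_reg_r with (INR k ^ 2 * / INR n).
    apply lt_INR in Hk. apply Rmult_le_reg_r with (INR n); [lra|].
    ring_simplify. rewrite Rmult_assoc, Rinv_l by lra.
    assert (1 <= INR n) by (apply (le_INR 1); lia). nra.
Qed.

(** The expansion of [(a + y) ^ n] with the [j]-th power of [y] weighted by [g j]. Taking for [g]
    the components of [Ci ^ j] gives the real and imaginary parts of [(a + i y) ^ n]. *)
Definition binom_sum (n : nat) (a y : R) (g : nat -> R) : R :=
  sum_f_R0 (fun j => bin n j * a ^ (n - j) * y ^ j * g j) n.

Lemma sum_bin_S (n K : nat) (u : nat -> R) :
  sum_f_R0 (fun j => bin (S n) j * u j) (S K) =
  sum_f_R0 (fun j => bin n j * u j) (S K) + sum_f_R0 (fun j => bin n j * u (S j)) K.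
Proof.
  induction K as [|K IH].
  - simpl. rewrite bin_0. ring.
  - rewrite tech5, IH, (tech5 _ (S K)), (tech5 (fun j => bin n j * u (S j)) K). simpl bin. ring.
Qed.

Lemma binom_sum_S (n : nat) (a y : R) (g : nat -> R) :
  binom_sum (S n) a y g = a * binom_sum n a y g + y * binom_sum n a y (fun j => g (S j)).
Proof.
  unfold binom_sum.
  rewrite (sum_eq _ (fun j => bin (S n) j * (a ^ (S n - j) * y ^ j * g j))) by (intros; ring).
  rewrite sum_bin_S, tech5, bin_gt by lia. rewrite Rmult_0_l, Rplus_0_r, !scal_sum.
  f_equal; apply sum_eq; intros j Hj.
  - replace (S n - j)%nat with (S (n - j)) by lia. rewrite <- tech_pow_Rmult. ring.
  - replace (S n - S j)%nat with (n - j)%nat by lia. rewrite <- tech_pow_Rmult. ring.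
Qed.

Lemma binom_sum_ext (n : nat) (a y : R) (g g' : nat -> R) :
  (forall j, g j = g' j) -> binom_sum n a y g = binom_sum n a y g'.
Proof. intros H. apply sum_eq. intros. now rewrite H. Qed.

Lemma binom_sum_opp (n : nat) (a y : R) (g : nat -> R) :
  binom_sum n a y (fun j => - g j) = - binom_sum n a y g.
Proof.
  unfold binom_sum. replace (- sum_f_R0 (fun j => bin n j * a ^ (n - j) * y ^ j * g j) n)
    with (-1 * sum_f_R0 (fun j => bin n j * a ^ (n - j) * y ^ j * g j) n) by ring.
  rewrite scal_sum. apply sum_eq. intros. ring.
Qed.

Lemma Ci_mult (z : C) : (Ci * z)%C = (- Im z, Re z).
Proof. destruct z. apply injective_projections; simpl; ring. Qed.

Lemma binom_sum_Ci (n : nat) (a y : R) :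
  ((RtoC a + Ci * y) ^ n)%C =
  (binom_sum n a y (fun j => Re (Ci ^ j)%C), binom_sum n a y (fun j => Im (Ci ^ j)%C)).
Proof.
  induction n as [|n IH].
  - unfold binom_sum. simpl. apply injective_projections; simpl; ring.
  - rewrite Cpow_S, IH, !binom_sum_S.
    rewrite (binom_sum_ext n a y (fun j => Re (Ci ^ S j)%C) (fun j => - Im (Ci ^ j)%C))
      by (intros j; now rewrite Cpow_S, Ci_mult).
    rewrite (binom_sum_ext n a y (fun j => Im (Ci ^ S j)%C) (fun j => Re (Ci ^ j)%C))
      by (intros j; now rewrite Cpow_S, Ci_mult).
    rewrite binom_sum_opp.
    apply injective_projections; simpl; ring.
Qed.

Lemma sum_even (u : nat -> R) (M : nat) : (forall k, u (S (2 * k)) = 0) ->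
  sum_f_R0 u (2 * M) = sum_f_R0 (fun k => u (2 * k)%nat) M.
Proof.
  intros H. induction M as [|M IH]; [reflexivity|].
  replace (2 * S M)%nat with (S (S (2 * M))) by lia.
  rewrite !tech5, IH, H. replace (2 * S M)%nat with (S (S (2 * M))) by lia. ring.
Qed.

Lemma Ci_pow_even (k : nat) : (Ci ^ (2 * k))%C = RtoC ((-1) ^ k).
Proof.
  rewrite Cpow_mult_r, RtoC_pow. f_equal. apply injective_projections; simpl; ring.
Qed.

(** Real part of [(a + i y t) ^ (2 M)] as a functional of the powers of [tau = t ^ 2]. *)
Definition even_sum (M : nat) (a y : R) (f : nat -> R) : R :=
  sum_f_R0 (fun k => (-1) ^ k * bin (2 * M) (2 * k) * a ^ (2 * M - 2 * k) * y ^ (2 * k) * f k) M.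

Lemma even_sum_pow (M : nat) (a y t : R) :
  even_sum M a y (fun k => (t ^ 2) ^ k) = Re ((RtoC a + Ci * RtoC (y * t)) ^ (2 * M))%C.
Proof.
  transitivity (binom_sum (2 * M) a (y * t) (fun j => Re (Ci ^ j)%C));
    [|now rewrite binom_sum_Ci].
  unfold binom_sum. rewrite sum_even.
  - apply sum_eq. intros k _. rewrite Ci_pow_even, Rpow_mult_distr, (pow_mult t 2 k). simpl Re. ring.
  - intros k. rewrite Cpow_S, Ci_pow_even. simpl. ring.
Qed.

(** The value is the real part of the power [2 M] of [a + i y sqrt tau], whose squared modulus is
    [a ^ 2 + y ^ 2 tau]. *)
Lemma even_sum_bound (M : nat) (a y tau : R) : 0 <= tau ->
  Rabs (even_sum M a y (fun k => tau ^ k)) <= (a ^ 2 + y ^ 2 * tau) ^ M.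
Proof.
  intros Ht. replace tau with (sqrt tau ^ 2) by (now apply pow2_sqrt).
  rewrite even_sum_pow. eapply Rle_trans; [apply re_le_Cmod|].
  rewrite Cmod_pow, pow_mult. apply Req_le. f_equal.
  rewrite Cmod2_alt. simpl. ring.
Qed.

Lemma even_sum_unit (M : nat) (phi : R) :
  even_sum M (cos phi) (sin phi) (fun _ => 1) = cos (INR (2 * M) * phi).
Proof.
  transitivity (even_sum M (cos phi) (sin phi) (fun k => (1 ^ 2) ^ k)).
  - apply sum_eq. intros k _. rewrite !pow1. ring.
  - rewrite even_sum_pow, Rmult_1_r.
    assert (E : forall n, ((RtoC (cos phi) + Ci * RtoC (sin phi)) ^ n)%C = (cos (INR n * phi), sin (INR n * phi))).
    { induction n as [|n IH].
      - simpl. rewrite Rmult_0_l, cos_0, sin_0. reflexivity.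
      - rewrite Cpow_S, IH, S_INR.
        replace ((INR n + 1) * phi) with (phi + INR n * phi) by ring.
        rewrite cos_plus, sin_plus. apply injective_projections; simpl; ring. }
    now rewrite E.
Qed.

(** * Positivity of a Beta functional *)

(** For [b > 1], [moment_weight b k] is the integral over [0, 1] of
    [(b - 1) * (1 - tau) ^ (b - 2) * k * tau ^ (k - 1)]. *)
Definition moment_weight (b : R) (k : nat) : R :=
  match k with
  | O => 0
  | S j => INR (fact k) / pochhammer b j
  end.

Lemma pochhammer_pos (b : R) (n : nat) : 0 < b -> 0 < pochhammer b n.
Proof.
  intros Hb. induction n as [|n IH]; simpl; [lra|].
  apply Rmult_lt_0_compat; [exact IH|]. pose proof (pos_INR n). lra.
Qed.

Lemma pochhammer_1 (n : nat) : pochhammer 1 n = INR (fact n).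
Proof.
  induction n as [|n IH]; [reflexivity|].
  change (pochhammer 1 n * (1 + INR n) = INR (fact (S n))).
  rewrite IH, fact_simpl, mult_INR, S_INR. ring.
Qed.

Lemma sum_f_R0_derive (c : nat -> R) (f df : nat -> R -> R) (x : R) (M : nat) :
  (forall k, is_derive (f k) x (df k x)) ->
  is_derive (fun t => sum_f_R0 (fun k => c k * f k t) M) x (sum_f_R0 (fun k => c k * df k x) M).
Proof.
  intros H. induction M as [|M IH]; simpl.
  - apply is_derive_scal, H.
  - apply (is_derive_plus (V := R_NormedModule)); [exact IH|apply is_derive_scal, H].
Qed.

Fixpoint beta_poly (al : R) (j : nat) (t : R) : R :=
  match j with
  | O => / (al + 1)
  | S i => (INR j * beta_poly al i t + t ^ j) / (al + INR j + 1)
  end.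

(* [- (1 - t) ^ (al + 1) * beta_poly al j t] is an antiderivative of [(1 - t) ^ al * t ^ j]. *)
Lemma beta_poly_derive (al : R) (j : nat) (t : R) : -1 < al ->
  exists l, is_derive (beta_poly al j) t l /\ (1 - t) * l = (al + 1) * beta_poly al j t - t ^ j.
Proof.
  intros Hal. induction j as [|j [l [IH E]]].
  - exists 0. split; [apply (is_derive_const (V := R_NormedModule))|]. simpl. field. lra.
  - assert (H : 0 < al + INR (S j) + 1) by (pose proof (lt_0_INR (S j) ltac:(lia)); lra).
    exists ((INR (S j) * l + INR (S j) * t ^ j) / (al + INR (S j) + 1)). split.
    + apply (is_derive_ext (fun t => (INR (S j) * beta_poly al j t + t ^ S j) / (al + INR (S j) + 1)));
        [reflexivity|].
      unfold Rdiv.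
      apply (is_derive_ext (fun t => / (al + INR (S j) + 1) * (INR (S j) * beta_poly al j t + t ^ S j)));
        [intros; apply Rmult_comm|].
      rewrite Rmult_comm. apply is_derive_scal.
      apply (is_derive_plus (V := R_NormedModule)); [now apply is_derive_scal|].
      apply is_derive_Reals. rewrite <- (Rmult_1_r (t ^ j)).
      replace (INR (S j) * (t ^ j * 1)) with (INR (S j) * t ^ pred (S j)) by (simpl pred; ring).
      apply derivable_pt_lim_pow.
    + change (beta_poly al (S j) t) with ((INR (S j) * beta_poly al j t + t ^ S j) / (al + INR (S j) + 1)).
      rewrite <- tech_pow_Rmult. set (n := INR (S j)) in *.
      transitivity ((n * ((1 - t) * l) + n * t ^ j * (1 - t)) / (al + n + 1)); [field; lra|].
      rewrite E. field. lra.
Qed.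

Lemma beta_poly_bound (al : R) (j : nat) (t : R) : -1 < al -> 0 <= t <= 1 ->
  0 <= beta_poly al j t <= / (al + 1).
Proof.
  intros Hal Ht. assert (Hi : 0 < / (al + 1)) by (apply Rinv_0_lt_compat; lra).
  induction j as [|j IH]; [simpl; lra|].
  change (beta_poly al (S j) t) with ((INR (S j) * beta_poly al j t + t ^ S j) / (al + INR (S j) + 1)).
  assert (Hj := pos_INR (S j)).
  assert (Hp : 0 <= t ^ S j <= 1).
  { split; [apply pow_le; lra|]. rewrite <- (pow1 (S j)). apply pow_incr. lra. }
  split.
  - apply Rmult_le_pos; [nra|]. apply Rlt_le, Rinv_0_lt_compat. lra.
  - apply Rle_div_l; [lra|].
    replace (/ (al + 1) * (al + INR (S j) + 1)) with (INR (S j) * / (al + 1) + 1) by (field; lra).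
    nra.
Qed.

(** Summing a geometric progression, the value at 0 is the integral over [[0, 1]] of
    [(1 - t) ^ (al - 1) * (1 - t ^ k)]. *)
Fixpoint beta_poly_sum (al : R) (k : nat) (t : R) : R :=
  match k with
  | O => 0
  | S j => beta_poly_sum al j t + beta_poly al j t
  end.

Lemma beta_poly_sum_derive (al : R) (k : nat) (t : R) : -1 < al ->
  exists l, is_derive (beta_poly_sum al k) t l /\
    (1 - t) * ((1 - t) * l - (al + 1) * beta_poly_sum al k t) = - (1 - t ^ k).
Proof.
  intros Hal. induction k as [|k [l [IH E]]].
  - exists 0. split; [apply (is_derive_const (V := R_NormedModule))|]. simpl. ring.
  - destruct (beta_poly_derive al k t Hal) as [l' [H' E']].
    exists (l + l'). split.
    + apply (is_derive_plus (V := R_NormedModule)); assumption.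
    + simpl.
      replace ((1 - t) * ((1 - t) * (l + l') - (al + 1) * (beta_poly_sum al k t + beta_poly al k t)))
        with ((1 - t) * ((1 - t) * l - (al + 1) * beta_poly_sum al k t)
              + (1 - t) * ((1 - t) * l' - (al + 1) * beta_poly al k t)) by ring.
      rewrite E, E'. ring.
Qed.

Lemma beta_poly_sum_bound (al : R) (k : nat) (t : R) : -1 < al -> 0 <= t <= 1 ->
  0 <= beta_poly_sum al k t <= INR k * / (al + 1).
Proof.
  intros Hal Ht. induction k as [|k IH]; [simpl; lra|].
  rewrite S_INR. simpl. pose proof (beta_poly_bound al k t Hal Ht). lra.
Qed.

(** This is the integration by parts of the integral behind [moment_weight], with [al = b - 2]:
    [1 - 0 ^ k] is the boundary term at 0, and [- al] comes from differentiating the weight. *)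
Lemma moment_weight_beta (al : R) (k : nat) : -1 < al ->
  moment_weight (al + 2) k = (al + 1) * ((1 - 0 ^ k) - al * beta_poly_sum al k 0).
Proof.
  intros Hal.
  assert (A : forall k, moment_weight (al + 2) (S k) = (al + 1) * (INR k + 1) * beta_poly al k 0).
  { induction k0 as [|j IH].
    - simpl. field. lra.
    - change (beta_poly al (S j) 0) with ((INR (S j) * beta_poly al j 0 + 0 ^ S j) / (al + INR (S j) + 1)).
      rewrite pow_i by lia. unfold moment_weight in *. rewrite fact_simpl, mult_INR.
      change (pochhammer (al + 2) (S j)) with (pochhammer (al + 2) j * (al + 2 + INR j)).
      pose proof (pochhammer_pos (al + 2) j ltac:(lra)). pose proof (pos_INR j).
      replace (INR (S (S j)) * INR (fact (S j)) / (pochhammer (al + 2) j * (al + 2 + INR j)))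
        with (INR (S (S j)) / (al + 2 + INR j) * (INR (fact (S j)) / pochhammer (al + 2) j)) by (field; lra).
      rewrite IH, !S_INR. field. lra. }
  assert (B : forall k, (INR k + 1) * beta_poly al k 0 = 1 - al * beta_poly_sum al (S k) 0).
  { induction k0 as [|j IH]; [simpl; field; lra|].
    change (beta_poly_sum al (S (S j)) 0) with (beta_poly_sum al (S j) 0 + beta_poly al (S j) 0).
    assert (E : (al + INR (S j) + 1) * beta_poly al (S j) 0 = INR (S j) * beta_poly al j 0).
    { change (beta_poly al (S j) 0) with ((INR (S j) * beta_poly al j 0 + 0 ^ S j) / (al + INR (S j) + 1)).
      rewrite pow_i by lia. pose proof (pos_INR (S j)). field. lra. }
    rewrite S_INR in *. lra. }
  destruct k as [|k]; [simpl; ring|].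
  rewrite A, pow_i by lia. rewrite Rmult_assoc, B. ring.
Qed.

Lemma sum_f_R0_Rabs_le (c u : nat -> R) (B : nat -> R) (M : nat) :
  (forall k, Rabs (u k) <= B k) ->
  Rabs (sum_f_R0 (fun k => c k * u k) M) <= sum_f_R0 (fun k => Rabs (c k) * B k) M.
Proof.
  intros H. eapply Rle_trans; [apply sum_f_R0_triangle|].
  apply sum_Rle. intros k _. rewrite Rabs_mult. apply Rmult_le_compat_l; [apply Rabs_pos|apply H].
Qed.

(** The conclusion concerns the integral of [(1 - t) ^ (al - 1)] times the nonnegative sum. Improper
    integrals are avoided by means of the primitive: [G] has minus this integrand as derivative,
    hence does not increase, and it tends to 0 at 1, so [G 0 = q 0] is nonnegative. *)
Lemma beta_functional_nonneg (al : R) (c : nat -> R) (M : nat) : -1 < al ->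
  (forall t, 0 <= t <= 1 -> 0 <= sum_f_R0 (fun k => c k * (1 - t ^ k)) M) ->
  0 <= sum_f_R0 (fun k => c k * beta_poly_sum al k 0) M.
Proof.
  intros Hal Hc.
  set (q := fun t => sum_f_R0 (fun k => c k * beta_poly_sum al k t) M).
  change (0 <= q 0).
  set (B := sum_f_R0 (fun k => Rabs (c k) * (INR k * / (al + 1))) M).
  assert (HB : forall t, 0 <= t <= 1 -> Rabs (q t) <= B).
  { intros t Ht. apply sum_f_R0_Rabs_le. intros k.
    pose proof (beta_poly_sum_bound al k t Hal Ht). rewrite Rabs_pos_eq; lra. }
  set (G := fun t => Rpower (1 - t) (al + 1) * q t).
  assert (HG : forall t, t < 1 -> exists l, is_derive G t l /\ (0 <= t -> l <= 0)).
  { intros t Ht.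
    assert (Hq : exists l, is_derive q t l /\
      (1 - t) * ((1 - t) * l - (al + 1) * q t) = - sum_f_R0 (fun k => c k * (1 - t ^ k)) M).
    { unfold q. clear - Hal. induction M as [|M [l [IH E]]].
      - exists (c O * 0). split; [apply is_derive_scal, (is_derive_const (V := R_NormedModule))|].
        simpl. ring.
      - destruct (beta_poly_sum_derive al (S M) t Hal) as [l' [H' E']].
        exists (l + c (S M) * l'). split.
        + apply (is_derive_plus (V := R_NormedModule)); [exact IH|now apply is_derive_scal].
        + rewrite !tech5, Ropp_plus_distr, <- E, Ropp_mult_distr_r, <- E'. ring. }
    destruct Hq as [l [Hl E]].
    assert (HP : is_derive (fun t => Rpower (1 - t) (al + 1)) t
              (- ((al + 1) * Rpower (1 - t) (al + 1) / (1 - t)))).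
    { unfold Rpower. auto_derive; [lra|]. unfold Rminus. field. lra. }
    exists (- ((al + 1) * Rpower (1 - t) (al + 1) / (1 - t)) * q t + Rpower (1 - t) (al + 1) * l). split.
    - apply (is_derive_mult (fun t => Rpower (1 - t) (al + 1)) q); [exact HP|exact Hl|exact Rmult_comm].
    - intros Ht0. specialize (Hc t ltac:(lra)).
      assert (0 < Rpower (1 - t) (al + 1)) by apply exp_pos.
      replace (- ((al + 1) * Rpower (1 - t) (al + 1) / (1 - t)) * q t + Rpower (1 - t) (al + 1) * l)
        with (Rpower (1 - t) (al + 1) / (1 - t) ^ 2 * ((1 - t) * ((1 - t) * l - (al + 1) * q t)))
        by (field; lra).
      rewrite E.
      assert (0 < Rpower (1 - t) (al + 1) / (1 - t) ^ 2) by (apply Rdiv_lt_0_compat; [auto|apply pow_lt; lra]).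
      nra. }
  destruct (Rle_lt_dec 0 (q 0)) as [H|Hq0]; [exact H|exfalso].
  assert (HB0 : 0 <= B) by (eapply Rle_trans; [apply Rabs_pos|apply (HB 0); lra]).
  (* The point [1 - s] is chosen so that [(1 - s) -> 1] is quantified: [s ^ (al + 1) = eta], hence
     [|G (1 - s)| <= eta B], at most half of [- q 0]. This contradicts
     [G (1 - s) <= G 0 = q 0 < 0]. *)
  set (eta := Rmin (1 / 2) (- q 0 / (2 * (B + 1)))).
  assert (He0 : 0 < eta) by (apply Rmin_pos; [lra|]; apply Rdiv_lt_0_compat; lra).
  set (s := Rpower eta (/ (al + 1))).
  assert (Hs0 : 0 < s) by apply exp_pos.
  assert (Hs1 : s < 1).
  { unfold s, Rpower. apply Rlt_le_trans with (exp 0); [apply exp_increasing|rewrite exp_0; lra].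
    assert (ln eta < 0) by (rewrite <- ln_1; apply ln_increasing; [lra|]; pose proof (Rmin_l (1 / 2) (- q 0 / (2 * (B + 1)))) as R; fold eta in R; lra).
    assert (0 < / (al + 1)) by (apply Rinv_0_lt_compat; lra). nra. }
  assert (Es : Rpower s (al + 1) = eta).
  { unfold s. rewrite Rpower_mult, Rinv_l by lra. now apply Rpower_1. }
  assert (Hmono : G (1 - s) <= G 0).
  { destruct (MVT_gen G 0 (1 - s) (fun t => Derive G t)) as [x [Hx E]].
    - intros x Hx. rewrite Rmin_left, Rmax_right in Hx by lra.
      destruct (HG x) as [l [Hl _]]; [lra|]. apply Derive_correct. now exists l.
    - intros x Hx. rewrite Rmin_left, Rmax_right in Hx by lra.
      destruct (HG x) as [l [Hl _]]; [lra|].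
      apply continuity_pt_filterlim. apply (ex_derive_continuous (V := R_NormedModule)). now exists l.
    - rewrite Rmin_left, Rmax_right in Hx by lra.
      destruct (HG x) as [l [Hl Hl0]]; [lra|]. rewrite (is_derive_unique _ _ _ Hl) in E.
      specialize (Hl0 ltac:(lra)). nra. }
  unfold G in Hmono. rewrite Rminus_0_r in Hmono.
  replace (1 - (1 - s)) with s in Hmono by ring. rewrite Es in Hmono.
  replace (Rpower 1 (al + 1)) with 1 in Hmono by (unfold Rpower; rewrite ln_1, Rmult_0_r, exp_0; reflexivity).
  specialize (HB (1 - s) ltac:(lra)). apply Rabs_le_between in HB.
  assert (He : eta * (2 * (B + 1)) <= - q 0).
  { pose proof (Rmin_r (1 / 2) (- q 0 / (2 * (B + 1)))) as R. fold eta in R.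
    apply Rle_div_r in R; [exact R|lra]. }
  nra.
Qed.

(** The hypothesis says that the polynomial with coefficients [c k] is maximal over [[0, 1]] at 1.
    After integration by parts the functional is a nonnegative combination of the value of the
    hypothesis at 0 and of the previous functional; the coefficient [2 - b] of the latter is
    nonnegative because the weight does not decrease. *)
Lemma moment_functional_nonneg (b : R) (c : nat -> R) (M : nat) : 1 <= b <= 2 ->
  (forall t, 0 <= t <= 1 -> 0 <= sum_f_R0 (fun k => c k * (1 - t ^ k)) M) ->
  0 <= sum_f_R0 (fun k => c k * moment_weight b k) M.
Proof.
  intros [[Hb1|Hb1] Hb2] Hc.
  - set (al := b - 2). assert (Hal : -1 < al) by (unfold al; lra).
    replace b with (al + 2) by (unfold al; ring).
    rewrite (sum_eq _ (fun k => (c k * (1 - 0 ^ k) + c k * beta_poly_sum al k 0 * (- al)) * (al + 1)))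
      by (intros k _; rewrite moment_weight_beta by exact Hal; ring).
    rewrite <- scal_sum, plus_sum, <- scal_sum.
    pose proof (beta_functional_nonneg al c M Hal Hc) as H1. specialize (Hc 0 ltac:(lra)).
    apply Rmult_le_pos; [lra|]. assert (al <= 0) by (unfold al; lra). nra.
  - subst b.
    (* At [b = 1] the functional is minus the derivative at [1]. *)
    set (l := sum_f_R0 (fun k => c k * moment_weight 1 k) M).
    destruct (Rle_lt_dec 0 l) as [H|Hl]; [exact H|exfalso].
    set (q := fun t => sum_f_R0 (fun k => c k * (1 - t ^ k)) M).
    assert (Hd : is_derive (fun h => q (1 + h)) 0 (- l)).
    { replace (- l) with (sum_f_R0 (fun k => c k * (fun k (_ : R) => - INR k) k 0) M).
      - apply (sum_f_R0_derive c (fun k h => 1 - (1 + h) ^ k) (fun k _ => - INR k) 0 M).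
        intros k. auto_derive; [exact I|]. rewrite Rplus_0_r, pow1. ring.
      - unfold l. replace (- sum_f_R0 (fun k => c k * moment_weight 1 k) M)
          with (-1 * sum_f_R0 (fun k => c k * moment_weight 1 k) M) by ring.
        rewrite scal_sum. apply sum_eq. intros k _. destruct k as [|k]; [simpl; ring|].
        unfold moment_weight. rewrite pochhammer_1, fact_simpl, mult_INR.
        pose proof (INR_fact_neq_0 k). field. assumption. }
    apply is_derive_Reals in Hd. destruct (Hd (- l / 2) ltac:(lra)) as [d Hd'].
    pose proof (cond_pos d) as Hd0.
    set (h := - (Rmin d 1 / 2)).
    assert (Hh : 0 < Rmin d 1) by (apply Rmin_pos; lra).
    pose proof (Rmin_l d 1). pose proof (Rmin_r d 1).
    specialize (Hd' h ltac:(unfold h; lra) ltac:(unfold h; rewrite Rabs_left; lra)).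
    rewrite Rplus_0_l, Rplus_0_r in Hd'.
    assert (Q1 : q 1 = 0).
    { unfold q. rewrite (sum_eq _ (fun k => 0 * 0)) by (intros; rewrite pow1; ring).
      rewrite <- scal_sum. ring. }
    assert (Qh : 0 <= q (1 + h)) by (apply Hc; unfold h; lra).
    rewrite Q1, Rminus_0_r in Hd'. apply Rabs_lt_between in Hd'.
    assert (q (1 + h) / h <= 0).
    { replace (q (1 + h) / h) with (- (q (1 + h) / - h)) by (field; unfold h; lra).
      assert (0 <= q (1 + h) / - h); [|lra].
      apply Rmult_le_pos; [exact Qh|]. apply Rlt_le, Rinv_0_lt_compat. unfold h; lra. }
    lra.
Qed.

(** * Polynomial approximation of the hypergeometric function *)

(** Let [L] be the linear functional sending [tau ^ k] to [moment_weight b k]. Applied termwise to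
    the series of [cos (z sqrt tau)], it gives [Phi (z ^ 2) = - 2 / z ^ 2 * L (cos (z sqrt tau))],
    and these are the coefficients. *)
Definition phi_coef (b : R) (k : nat) : R :=
  (-1) ^ k * (2 * moment_weight b (S k) / INR (fact (2 * k + 2))).

Lemma phi_coef_0 (b : R) : phi_coef b 0 = 1.
Proof. unfold phi_coef. simpl. field. Qed.

Lemma phi_coef_S (b : R) (k : nat) : 0 < b ->
  phi_coef b (S k) = - phi_coef b k / (4 * (3 / 2 + INR k) * (b + INR k)).
Proof.
  intros Hb. unfold phi_coef, moment_weight.
  replace (2 * S k + 2)%nat with (S (S (2 * k + 2))) by lia.
  rewrite (fact_simpl (S (2 * k + 2))), (fact_simpl (2 * k + 2)), (fact_simpl (S k)).
  change (pochhammer b (S k)) with (pochhammer b k * (b + INR k)).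
  rewrite !mult_INR, !S_INR, plus_INR, mult_INR. replace (INR 2) with 2 by (simpl; ring).
  pose proof (pos_INR k). pose proof (pochhammer_pos b k Hb).
  pose proof (INR_fact_neq_0 (2 * k + 2)).
  simpl pow. field. repeat split; try assumption; lra.
Qed.

Lemma phi_coef_hyp (b : R) (k : nat) : 0 < b ->
  pochhammer 1 k / (pochhammer (3 / 2) k * pochhammer b k * INR (fact k)) * (- (1 / 4)) ^ k = phi_coef b k.
Proof.
  intros Hb. rewrite pochhammer_1. pose proof (INR_fact_neq_0 k) as Hf.
  transitivity ((- (1 / 4)) ^ k / (pochhammer (3 / 2) k * pochhammer b k)).
  { pose proof (pochhammer_pos b k Hb). pose proof (pochhammer_pos (3 / 2) k ltac:(lra)). field. repeat split; lra. }
  clear Hf. induction k as [|k IH].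
  - rewrite phi_coef_0. simpl. field.
  - rewrite phi_coef_S, <- IH by exact Hb. simpl.
    pose proof (pochhammer_pos b k Hb). pose proof (pochhammer_pos (3 / 2) k ltac:(lra)).
    pose proof (pos_INR k). field. repeat split; lra.
Qed.

Lemma phi_coef_neq_0 (b : R) (k : nat) : 0 < b -> phi_coef b k <> 0.
Proof.
  intros Hb. induction k as [|k IH]; [rewrite phi_coef_0; lra|].
  rewrite phi_coef_S by exact Hb. pose proof (pos_INR k).
  unfold Rdiv. apply Rmult_integral_contrapositive_currified; [lra|].
  apply Rinv_neq_0_compat, Rgt_not_eq. apply Rmult_lt_0_compat; lra.
Qed.

Lemma phi_coef_entire (b : R) : 1 <= b -> CV_radius (phi_coef b) = p_infty.
Proof.
  intros Hb. apply CV_radius_infinite_DAlembert; [intros k; apply phi_coef_neq_0; lra|].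
  apply (is_lim_seq_le_le (fun _ => 0) _ (fun n => / (INR n + 1))).
  - intros n. split; [apply Rabs_pos|]. rewrite phi_coef_S by lra.
    pose proof (phi_coef_neq_0 b n ltac:(lra)) as Hc. pose proof (pos_INR n).
    assert (HD : 0 < 4 * (3 / 2 + INR n) * (b + INR n)) by (apply Rmult_lt_0_compat; lra).
    replace (- phi_coef b n / (4 * (3 / 2 + INR n) * (b + INR n)) / phi_coef b n)
      with (- / (4 * (3 / 2 + INR n) * (b + INR n))) by (field; repeat split; lra).
    rewrite Rabs_Ropp, Rabs_pos_eq by (apply Rlt_le, Rinv_0_lt_compat, HD).
    apply Rinv_le_contravar; [lra|]. nra.
  - apply is_lim_seq_const.
  - apply (is_lim_seq_ext (fun n => / INR (S n))); [intros n; now rewrite S_INR|].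
    apply -> (is_lim_seq_incr_1 (fun n => / INR n)).
    replace (Finite 0) with (Rbar_inv p_infty) by reflexivity.
    apply is_lim_seq_inv; [apply is_lim_seq_INR|discriminate].
Qed.

Lemma CV_radius_infinite_le (a b : nat -> R) : (forall n, Rabs (a n) <= Rabs (b n)) ->
  CV_radius b = p_infty -> CV_radius a = p_infty.
Proof.
  intros H Hb. pose proof (CV_radius_ge_0 a) as H0.
  destruct (CV_radius a) as [r| |] eqn:E; [exfalso|reflexivity|destruct H0].
  apply (CV_disk_outside a (Rabs r + 1)).
  - rewrite E. simpl. rewrite (Rabs_pos_eq (Rabs r + 1)) by (pose proof (Rabs_pos r); lra).
    pose proof (Rle_abs r). lra.
  - apply ex_series_lim_0.
    apply (ex_series_le (V := R_CompleteNormedModule)) with (fun n => Rabs (b n * (Rabs r + 1) ^ n)).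
    + intros n. change (Rabs (a n * (Rabs r + 1) ^ n) <= Rabs (b n * (Rabs r + 1) ^ n)).
      rewrite !Rabs_mult. apply Rmult_le_compat_r; [apply Rabs_pos|apply H].
    + apply CV_disk_inside. now rewrite Hb.
Qed.

Lemma CPS_poly_eval (a : nat -> R) (n : nat) (z : C) : CV_radius a = p_infty ->
  (forall k, (n < k)%nat -> a k = 0) -> CPS a z = poly_eval a n z.
Proof.
  intros Ha Hn.
  assert (E : forall m, CPS a z =
    (poly_eval a m z + CSeries (fun k => RtoC (a (S m + k)%nat) * z ^ (S m + k)))%C /\
    Cabs_series (fun k => RtoC (a (S m + k)%nat) * z ^ (S m + k))%C).
  { assert (A0 := CPS_abs a z Ha).
    induction m as [|m [IH1 IH2]].
    - split.
      + unfold CPS. rewrite (CSeries_incr_1 _ A0). simpl poly_eval. f_equal. simpl. ring.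
      + apply (ex_series_incr_1 (V := R_NormedModule) (fun k => Cmod (RtoC (a k) * z ^ k)%C)). exact A0.
    - split.
      + rewrite IH1, (CSeries_incr_1 _ IH2). simpl poly_eval.
        rewrite Nat.add_0_r, Cplus_assoc. f_equal.
        apply CSeries_ext. intros k. now rewrite Nat.add_succ_r.
      + apply (ex_series_incr_1 (V := R_NormedModule)) in IH2.
        eapply ex_series_ext; [|exact IH2]. intros k. simpl. now rewrite Nat.add_succ_r. }
  destruct (E n) as [E1 _]. rewrite E1.
  rewrite (CSeries_ext _ (fun _ => RtoC 0)) by (intros k; rewrite Hn by lia; ring).
  replace (CSeries (fun _ => RtoC 0)) with (RtoC 0); [ring|].
  unfold CSeries. apply injective_projections; simpl; symmetry; now apply Series_eq_0.
Qed.

(** With [M = n + 1], the effect on the coefficients of [Phi] of replacing [cos z] by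
    [Re (1 + i z / 2 M) ^ (2 M)]. *)
Definition approx_coef (b : R) (n k : nat) : R :=
  falling_ratio (2 * S n) (2 * k + 2) * phi_coef b k.

Definition approx_error (b x : R) : R :=
  Series (fun k => INR (2 * k + 2) ^ 2 * Rabs (phi_coef b k * x ^ k)).

Lemma approx_error_ex (b x : R) : 1 <= b ->
  ex_series (fun k => INR (2 * k + 2) ^ 2 * Rabs (phi_coef b k * x ^ k)).
Proof.
  intros Hb. apply (ex_series_le (V := R_CompleteNormedModule)) with
    (fun k => 4 * Rabs (phi_coef b k * (4 * x) ^ k)).
  - intros k. change (Rabs (INR (2 * k + 2) ^ 2 * Rabs (phi_coef b k * x ^ k))
      <= 4 * Rabs (phi_coef b k * (4 * x) ^ k)).
    rewrite Rabs_mult, Rabs_Rabsolu, (Rabs_pos_eq (INR (2 * k + 2) ^ 2)) by apply pow2_ge_0.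
    rewrite Rpow_mult_distr.
    replace (phi_coef b k * (4 ^ k * x ^ k)) with (4 ^ k * (phi_coef b k * x ^ k)) by ring.
    rewrite (Rabs_mult (4 ^ k)), (Rabs_pos_eq (4 ^ k)) by (apply pow_le; lra).
    rewrite <- Rmult_assoc. apply Rmult_le_compat_r; [apply Rabs_pos|].
    rewrite plus_INR, mult_INR. replace (INR 2) with 2 by (simpl; ring).
    replace ((2 * INR k + 2) ^ 2) with (4 * (INR k + 1) ^ 2) by ring.
    apply Rmult_le_compat_l; [lra|].
    replace (4 ^ k) with ((2 ^ k) ^ 2) by (rewrite <- pow_mult, Nat.mul_comm, pow_mult; f_equal; ring).
    apply pow_incr. split; [pose proof (pos_INR k); lra|].
    clear. induction k as [|k IH]; [simpl; lra|]. rewrite S_INR. simpl.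
    pose proof (pow_R1_Rle 2 k ltac:(lra)). lra.
  - apply (ex_series_scal (V := R_NormedModule)). apply CV_disk_inside. now rewrite phi_coef_entire.
Qed.

(** The coefficient of index [k] changes by a factor within [(2 k + 2) ^ 2 / INR (S n)] of 1. The
    polynomial factor does not affect convergence, so the error is of order [1 / n], uniformly on
    disks. *)
Lemma approx_error_bound (b : R) (n : nat) (z : C) (x : R) : 1 <= b -> Cmod z <= x ->
  Cmod (CPS (phi_coef b) z - poly_eval (approx_coef b n) n z)%C <= approx_error b x / INR (S n).
Proof.
  intros Hb Hz. pose proof (Cmod_ge_0 z) as Hz0.
  assert (Hn : 0 < INR (S n)) by (apply lt_0_INR; lia).
  assert (Ha := phi_coef_entire b Hb).
  assert (B : forall k, 0 <= falling_ratio (2 * S n) (2 * k + 2) <= 1 /\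
     1 - falling_ratio (2 * S n) (2 * k + 2) <= INR (2 * k + 2) ^ 2 / INR (S n)).
  { intros k. destruct (falling_ratio_bounds (2 * S n) (2 * k + 2) ltac:(lia)) as [B1 [B2 B3]].
    split; [lra|]. rewrite mult_INR in B2. replace (INR 2) with 2 in B2 by (simpl; ring).
    assert (INR (2 * k + 2) ^ 2 / (2 * INR (S n)) <= INR (2 * k + 2) ^ 2 / INR (S n)).
    { apply Rmult_le_compat_l; [apply pow2_ge_0|]. apply Rinv_le_contravar; lra. }
    lra. }
  assert (Ha' : CV_radius (approx_coef b n) = p_infty).
  { apply CV_radius_infinite_le with (phi_coef b); [|exact Ha].
    intros k. unfold approx_coef. rewrite Rabs_mult. destruct (B k) as [[B0 B1] _].
    rewrite (Rabs_pos_eq (falling_ratio _ _)) by exact B0.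
    pose proof (Rabs_pos (phi_coef b k)). nra. }
  rewrite <- CPS_poly_eval; [|exact Ha'|].
  - unfold CPS. rewrite <- CSeries_minus by now apply CPS_abs.
    unfold approx_error, Rdiv. rewrite Rmult_comm, <- Series_scal_l.
    apply Cmod_CSeries_le; [|apply (ex_series_scal (V := R_NormedModule)); now apply approx_error_ex].
    intros k. destruct (B k) as [B1 B2].
    replace (RtoC (phi_coef b k) * z ^ k - RtoC (approx_coef b n k) * z ^ k)%C
      with (RtoC ((1 - falling_ratio (2 * S n) (2 * k + 2)) * phi_coef b k) * z ^ k)%C
      by (unfold approx_coef; rewrite !RtoC_mult, RtoC_minus; ring).
    rewrite Cmod_mult, Cmod_R, Cmod_pow, !Rabs_mult, (Rabs_pos_eq (1 - _)) by lra.
    rewrite (Rabs_pos_eq (x ^ k)) by (apply pow_le; lra).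
    assert (P1 : 0 <= Rabs (phi_coef b k) * Cmod z ^ k).
    { apply Rmult_le_pos; [apply Rabs_pos|now apply pow_le]. }
    assert (P2 : Rabs (phi_coef b k) * Cmod z ^ k <= Rabs (phi_coef b k) * x ^ k).
    { apply Rmult_le_compat_l; [apply Rabs_pos|]. apply pow_incr. lra. }
    rewrite Rmult_assoc.
    apply Rle_trans with (INR (2 * k + 2) ^ 2 / INR (S n) * (Rabs (phi_coef b k) * x ^ k)).
    + apply Rmult_le_compat; lra.
    + unfold Rdiv. lra.
  - intros k Hk. unfold approx_coef, falling_ratio. rewrite bin_gt by lia. unfold Rdiv. ring.
Qed.

Lemma hom_poly_sum (e : nat -> R) (n : nat) (A B : R) :
  hom_poly e n A B = sum_f_R0 (fun j => e j * A ^ (n - j) * B ^ j) n.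
Proof.
  induction n as [|n IH]; [simpl; ring|].
  rewrite tech5, Nat.sub_diag. simpl hom_poly. rewrite IH, scal_sum. f_equal.
  - apply sum_eq. intros j Hj. replace (S n - j)%nat with (S (n - j)) by lia. simpl. ring.
  - simpl. ring.
Qed.

(** With [M = n + 1], applying the moment functional to the real part of
    [(a + i y sqrt tau) ^ (2 M)] gives [- y ^ 2] times the form with these coefficients in [a ^ 2]
    and [y ^ 2]. *)
Definition dual_coef (b : R) (n j : nat) : R :=
  (-1) ^ j * bin (2 * S n) (2 * j + 2) * moment_weight b (S j).

Lemma even_sum_moment (b : R) (n : nat) (a y : R) :
  even_sum (S n) a y (moment_weight b) = - (y ^ 2 * hom_poly (dual_coef b n) n (a ^ 2) (y ^ 2)).
Proof.
  unfold even_sum. rewrite decomp_sum by lia. simpl pred. simpl (moment_weight b 0).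
  rewrite Rmult_0_r, Rplus_0_l, hom_poly_sum.
  replace (- (y ^ 2 * sum_f_R0 (fun j => dual_coef b n j * (a ^ 2) ^ (n - j) * (y ^ 2) ^ j) n))
    with (- y ^ 2 * sum_f_R0 (fun j => dual_coef b n j * (a ^ 2) ^ (n - j) * (y ^ 2) ^ j) n) by ring.
  rewrite scal_sum. apply sum_eq. intros j Hj. unfold dual_coef.
  rewrite <- !pow_mult.
  replace (2 * S n - 2 * S j)%nat with (2 * (n - j))%nat by lia.
  replace (2 * S j)%nat with (2 * j + 2)%nat by lia.
  rewrite pow_add. simpl ((-1) ^ S j). ring.
Qed.

Lemma cos_INR_PI (m : nat) : cos (INR m * PI) = (-1) ^ m.
Proof.
  induction m as [|m IH]; [simpl; rewrite Rmult_0_l; apply cos_0|].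
  rewrite S_INR. replace ((INR m + 1) * PI) with (INR m * PI + PI) by ring.
  rewrite neg_cos, IH. simpl. ring.
Qed.

Lemma pow_m1_sqr (m : nat) : (-1) ^ m * (-1) ^ m = 1.
Proof. rewrite <- Rpow_mult_distr. replace (-1 * -1) with 1 by ring. apply pow1. Qed.

Lemma sum_delta_1 (c : R) (f : nat -> R) (n : nat) :
  sum_f_R0 (fun k => (if Nat.eqb k 1 then c else 0) * f k) (S n) = c * f 1%nat.
Proof.
  induction n as [|n IH]; [simpl; ring|].
  rewrite tech5, IH. simpl. ring.
Qed.

(* [+- Re (cos phi + i t sin phi) ^ 2M] is maximal at [t = 1] when [2 M phi] is a multiple of [PI]. *)
Lemma dual_alternates (b : R) (n m : nat) : 1 <= b <= 2 -> (m <= S n)%nat ->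
  let phi := INR m * PI / INR (2 * S n) in
  sin phi <> 0 ->
  0 < - (-1) ^ m * hom_poly (dual_coef b n) n (cos phi ^ 2) (sin phi ^ 2).
Proof.
  intros Hb Hm phi Hs.
  set (a := cos phi) in *. set (y := sin phi) in *. set (M := S n) in *.
  assert (Hay : a ^ 2 + y ^ 2 = 1).
  { pose proof (sin2_cos2 phi) as E. unfold Rsqr in E. unfold a, y. lra. }
  assert (Hy : 0 < y ^ 2) by now apply pow2_gt_0.
  set (eps := (-1) ^ m).
  assert (E1 : even_sum M a y (fun _ => 1) = eps).
  { unfold a, y. rewrite even_sum_unit. unfold phi.
    replace (INR (2 * M) * (INR m * PI / INR (2 * M))) with (INR m * PI); [apply cos_INR_PI|].
    unfold M. field. apply not_0_INR. lia. }
  set (ka := fun k => (-1) ^ k * bin (2 * M) (2 * k) * a ^ (2 * M - 2 * k) * y ^ (2 * k)).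
  (* The subtracted term [y ^ 2 t] makes the positivity strict. The polynomial remains maximal at 1,
     since its modulus at [t] is at most [a ^ 2 + y ^ 2 t], with value 1 at [t = 1] after
     multiplication by [eps]. As the first moment is 1, the functional of the original polynomial is
     at least [y ^ 2]. *)
  set (dl := fun k : nat => if Nat.eqb k 1 then y ^ 2 else 0).
  assert (Hdl : forall f, sum_f_R0 (fun k => dl k * f k) M = y ^ 2 * f 1%nat).
  { intros f. apply sum_delta_1. }
  assert (H : 0 <= sum_f_R0 (fun k => (eps * ka k - dl k) * moment_weight b k) M).
  { apply moment_functional_nonneg; [exact Hb|]. intros t Ht.
    replace (sum_f_R0 (fun k => (eps * ka k - dl k) * (1 - t ^ k)) M)
      with (eps * (even_sum M a y (fun _ => 1) - even_sum M a y (fun k => t ^ k)) - y ^ 2 * (1 - t ^ 1)).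
    - rewrite E1.
      pose proof (even_sum_bound M a y t ltac:(lra)) as B.
      assert (B' : (a ^ 2 + y ^ 2 * t) ^ M <= a ^ 2 + y ^ 2 * t).
      { assert (P : 0 <= a ^ 2 + y ^ 2 * t <= 1) by (pose proof (pow2_ge_0 a); nra).
        unfold M. set (p := a ^ 2 + y ^ 2 * t) in *. rewrite <- tech_pow_Rmult.
        assert (p ^ n <= 1) by (rewrite <- (pow1 n); apply pow_incr; exact P). nra. }
      assert (T : eps * even_sum M a y (fun k => t ^ k) <= Rabs (even_sum M a y (fun k => t ^ k))).
      { eapply Rle_trans; [apply Rle_abs|]. rewrite Rabs_mult. unfold eps. rewrite pow_1_abs. lra. }
      rewrite Rmult_minus_distr_l. unfold eps at 1 2. rewrite pow_m1_sqr.
      replace (t ^ 1) with t by ring. nra.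
    - rewrite <- (Hdl (fun k => 1 - t ^ k)). unfold even_sum. fold ka.
      rewrite <- minus_sum, scal_sum, <- minus_sum.
      apply sum_eq. intros k _. unfold ka. ring. }
  assert (Hd : sum_f_R0 (fun k => (eps * ka k - dl k) * moment_weight b k) M
     = eps * even_sum M a y (moment_weight b) - y ^ 2).
  { transitivity (eps * even_sum M a y (moment_weight b) - y ^ 2 * moment_weight b 1).
    - rewrite <- (Hdl (moment_weight b)). unfold even_sum. rewrite scal_sum, <- minus_sum.
      apply sum_eq. intros k _. unfold ka. ring.
    - replace (moment_weight b 1) with 1 by (simpl; field). ring. }
  rewrite Hd in H. unfold M in H. rewrite even_sum_moment in H. fold eps.
  set (h := hom_poly _ _ _ _) in *.
  apply Rmult_lt_reg_l with (y ^ 2); [exact Hy|]. nra.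
Qed.

(** The reciprocal polynomial of degree [n] alternates at the [M = n + 1] squared cotangents of
    [m PI / 2M], [1 <= m <= M]. They are indexed by [i = M - m] to be increasing; all roots exceed
    the least one, hence are positive. *)
Lemma approx_factor (b : R) (n : nat) : 1 <= b <= 2 ->
  exists vs, (forall v, In v vs -> 0 < v) /\
    forall z, poly_eval (approx_coef b n) n z =
      (RtoC (falling_ratio (2 * S n) 2) * prod_inv_roots vs z)%C.
Proof.
  intros Hb. set (M := S n).
  assert (HM : 0 < INR (2 * M)) by (apply lt_0_INR; unfold M; lia).
  set (phi := fun m : nat => INR m * PI / INR (2 * M)).
  pose proof PI_RGT_0 as Hpi.
  assert (Hphi : forall m, (1 <= m <= M)%nat -> 0 < phi m <= PI / 2).
  { intros m [H1 H2]. unfold phi. apply le_INR in H1, H2. simpl in H1. split.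
    - apply Rdiv_lt_0_compat; [nra|exact HM].
    - apply Rle_div_l; [exact HM|].
      rewrite mult_INR. replace (INR 2) with 2 by (simpl; ring). nra. }
  assert (Hsin : forall m, (1 <= m <= M)%nat -> 0 < sin (phi m)).
  { intros m H. specialize (Hphi m H). apply sin_gt_0; lra. }
  set (x := fun i => cos (phi (M - i)%nat) ^ 2 / sin (phi (M - i)%nat) ^ 2).
  destruct (is_poly_alternating n (dual_coef b n 0) ((-1) ^ S M) (rev_poly (dual_coef b n) n) x)
    as [vs [Hl [Hv E]]].
  - apply is_poly_rev_poly.
  - intros i Hi. unfold x.
    set (m := (M - S i)%nat). replace (M - i)%nat with (S m) by (unfold m, M; lia).
    assert (A1 := Hphi m ltac:(unfold m, M; lia)). assert (A2 := Hphi (S m) ltac:(unfold m, M; lia)).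
    assert (S1 := Hsin m ltac:(unfold m, M; lia)). assert (S2 := Hsin (S m) ltac:(unfold m, M; lia)).
    assert (L : phi m < phi (S m)).
    { unfold phi. rewrite S_INR. apply Rmult_lt_compat_r; [now apply Rinv_0_lt_compat|]. lra. }
    pose proof (cos_decreasing_1 (phi m) (phi (S m)) ltac:(lra) ltac:(lra) ltac:(lra) ltac:(lra) L) as C1.
    pose proof (sin_increasing_1 (phi m) (phi (S m)) ltac:(lra) ltac:(lra) ltac:(lra) ltac:(lra) L) as C2.
    pose proof (cos_ge_0 (phi (S m)) ltac:(lra) ltac:(lra)) as C3.
    set (c1 := cos (phi m)) in *. set (c2 := cos (phi (S m))) in *.
    set (s1 := sin (phi m)) in *. set (s2 := sin (phi (S m))) in *.
    apply Rle_lt_trans with (c2 ^ 2 / s1 ^ 2).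
    + apply Rmult_le_compat_l; [apply pow2_ge_0|]. apply Rinv_le_contravar; [now apply pow_lt|].
      apply pow_incr. lra.
    + apply Rmult_lt_compat_r; [now apply Rinv_0_lt_compat, pow_lt|]. nra.
  - intros i Hi. set (m := (M - i)%nat).
    assert (Hm : (1 <= m <= M)%nat) by (unfold m, M; lia).
    assert (S1 := Hsin m Hm).
    pose proof (dual_alternates b n m Hb ltac:(unfold M in Hm; lia)) as D.
    fold M in D. fold (phi m) in D. specialize (D ltac:(lra)).
    assert (S2 : 0 < sin (phi m) ^ 2) by now apply pow_lt.
    assert (EH := hom_poly_rev (dual_coef b n) n (cos (phi m) ^ 2) (sin (phi m) ^ 2) ltac:(lra)).
    change (cos (phi m) ^ 2 / sin (phi m) ^ 2) with (x i) in EH.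
    rewrite (is_poly_real n (dual_coef b n 0) (rev_poly (dual_coef b n) n) (x i)) in EH
      by apply is_poly_rev_poly.
    rewrite <- RtoC_mult in EH. apply RtoC_inj in EH. rewrite EH in D.
    assert (P : 0 < (sin (phi m) ^ 2) ^ n) by now apply pow_lt.
    apply Rmult_lt_reg_l with ((sin (phi m) ^ 2) ^ n); [exact P|]. rewrite Rmult_0_r.
    replace ((-1) ^ S M * (-1) ^ i) with (- (-1) ^ m).
    + lra.
    + replace (S M) with (S (m + i)) by (unfold m, M in *; lia).
      simpl. rewrite pow_add.
      replace (-1 * ((-1) ^ m * (-1) ^ i) * (-1) ^ i) with (- ((-1) ^ m * ((-1) ^ i * (-1) ^ i))) by ring.
      rewrite pow_m1_sqr. ring.
  - assert (F := poly_eval_factor _ _ _ Hl E).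
    assert (Hx0 : 0 <= x O).
    { unfold x. apply Rmult_le_pos; [apply pow2_ge_0|]. apply Rlt_le, Rinv_0_lt_compat, pow_lt.
      apply Hsin. unfold M; lia. }
    (* Up to the factor [2 q], the approximating polynomial is the dual one in the variable [q z]: a
       binomial coefficient divided by [(2 M) ^ (2 j + 2)] is [falling_ratio] over a factorial. *)
    set (q := / INR (2 * M) ^ 2).
    assert (Hq : 0 < q) by (apply Rinv_0_lt_compat, pow_lt, HM).
    exists (map (fun v => v * q) vs). split.
    + intros v Hin. apply in_map_iff in Hin. destruct Hin as [u [<- Hu]]. specialize (Hv u Hu).
      apply Rmult_lt_0_compat; lra.
    + intros z.
      assert (Ec : forall j, approx_coef b n j = 2 * q * (dual_coef b n j * q ^ j)).
      { intros j. unfold approx_coef, falling_ratio, dual_coef, phi_coef. fold M.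
        unfold q. rewrite pow_add, pow_mult, pow_inv.
        pose proof (INR_fact_neq_0 (2 * j + 2)). field. repeat split; first [assumption|lra|apply pow_nonzero, pow_nonzero; lra].
      }
      assert (Ee : forall k, poly_eval (approx_coef b n) k z =
         (RtoC (2 * q) * poly_eval (dual_coef b n) k (RtoC q * z))%C).
      { induction k as [|k IH].
        - simpl. rewrite Ec, <- RtoC_mult. f_equal. simpl. ring.
        - simpl poly_eval. rewrite IH, Ec. rewrite !RtoC_mult, RtoC_pow.
          rewrite Cpow_mult_l, Cpow_S. ring. }
      rewrite Ee, F.
      replace (prod_inv_roots vs (RtoC q * z)%C) with (prod_inv_roots (map (fun v => v * q) vs) z).
      * rewrite Cmult_assoc, <- RtoC_mult. do 2 f_equal.
        transitivity (approx_coef b n 0).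
        -- rewrite Ec. simpl. ring.
        -- unfold approx_coef. rewrite phi_coef_0. fold M. simpl (2 * 0 + 2)%nat. ring.
      * clear. induction vs as [|v vs IH]; [reflexivity|].
        change (((1 - RtoC (v * q) * z) * prod_inv_roots (map (fun u => (u * q)%R) vs) z)%C =
          ((1 - RtoC v * (RtoC q * z)) * prod_inv_roots vs (RtoC q * z))%C).
        rewrite IH, RtoC_mult. ring.
Qed.

(** * Inequalities for the hypergeometric function *)

Definition prod_inv_roots_R (vs : list R) (x : R) : R :=
  fold_right (fun v p => (1 - v * x) * p) 1 vs.

Lemma prod_inv_roots_RtoC (vs : list R) (x : R) :
  prod_inv_roots vs (RtoC x) = RtoC (prod_inv_roots_R vs x).
Proof.
  induction vs as [|v vs IH]; [reflexivity|].
  change ((1 - RtoC v * RtoC x) * prod_inv_roots vs (RtoC x) =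
    RtoC ((1 - v * x) * prod_inv_roots_R vs x))%C.
  rewrite IH, RtoC_mult, RtoC_minus, RtoC_mult. reflexivity.
Qed.

Lemma Cmod_1_minus_ge (z : C) : 1 - Cmod z <= Cmod (1 - z)%C.
Proof.
  pose proof (Cmod_triangle (1 - z) z) as T.
  replace (1 - z + z)%C with (RtoC 1) in T by ring. rewrite Cmod_1 in T. lra.
Qed.

Lemma prod_inv_roots_le (vs : list R) (z : C) :
  (forall v, In v vs -> 0 < v /\ v * Cmod z < 1) ->
  0 < prod_inv_roots_R vs (Cmod z) <= Cmod (prod_inv_roots vs z).
Proof.
  induction vs as [|v vs IH]; intros H.
  - simpl. rewrite Cmod_1. lra.
  - destruct (H v (or_introl eq_refl)) as [Hv Hvz].
    specialize (IH (fun u Hu => H u (or_intror Hu))).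
    change (0 < (1 - v * Cmod z) * prod_inv_roots_R vs (Cmod z) <=
      Cmod ((1 - RtoC v * z) * prod_inv_roots vs z)%C).
    rewrite Cmod_mult. pose proof (Cmod_1_minus_ge (RtoC v * z)) as B.
    rewrite Cmod_mult, Cmod_R, Rabs_pos_eq in B by lra.
    split; [apply Rmult_lt_0_compat; lra|apply Rmult_le_compat; lra].
Qed.

(** With [P], [p] the complex and real products and [x = |z|], this is
    [|P z / P (s z) - 1| <= p (s x) / p x - 1] without divisions. For one factor the left side is at
    most [v (1 - s) x / (1 - s v x)], and the right side has the smaller denominator [1 - v x]. Such
    bounds multiply, as [|u w - 1| <= (1 + |u - 1|) (1 + |w - 1|) - 1]. *)
Lemma prod_inv_roots_scaled (vs : list R) (z : C) (s : R) : 0 <= s <= 1 ->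
  (forall v, In v vs -> 0 < v /\ v * Cmod z < 1) ->
  Cmod (prod_inv_roots vs z - prod_inv_roots vs (s * z))%C * prod_inv_roots_R vs (Cmod z)
    <= (prod_inv_roots_R vs (s * Cmod z) - prod_inv_roots_R vs (Cmod z))
       * Cmod (prod_inv_roots vs (s * z)%C).
Proof.
  intros Hs. induction vs as [|v vs IH]; intros H.
  - simpl. replace (1 - 1)%C with (RtoC 0) by ring. rewrite Cmod_0. lra.
  - destruct (H v (or_introl eq_refl)) as [Hv Hvz].
    assert (H' := fun u Hu => H u (or_intror Hu)). specialize (IH H').
    pose proof (prod_inv_roots_le vs z H') as [Hp1 Hp2].
    pose proof (Cmod_ge_0 z) as Hz.
    change (Cmod ((1 - RtoC v * z) * prod_inv_roots vs z -
        (1 - RtoC v * (RtoC s * z)) * prod_inv_roots vs (RtoC s * z))%C *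
        ((1 - v * Cmod z) * prod_inv_roots_R vs (Cmod z)) <=
      ((1 - v * (s * Cmod z)) * prod_inv_roots_R vs (s * Cmod z) -
       (1 - v * Cmod z) * prod_inv_roots_R vs (Cmod z)) *
      Cmod ((1 - RtoC v * (RtoC s * z)) * prod_inv_roots vs (RtoC s * z))%C).
    set (P := prod_inv_roots vs z) in *. set (Q := prod_inv_roots vs (RtoC s * z)%C) in *.
    set (p := prod_inv_roots_R vs (Cmod z)) in *. set (q := prod_inv_roots_R vs (s * Cmod z)) in *.
    set (x := Cmod z) in *. set (g := (1 - RtoC v * (RtoC s * z))%C).
    assert (B : 1 - v * s * x <= Cmod g).
    { pose proof (Cmod_1_minus_ge (RtoC v * (RtoC s * z))) as B.
      rewrite !Cmod_mult, !Cmod_R, !Rabs_pos_eq in B by lra. fold x in B. unfold g. lra. }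
    assert (D : Cmod (g - (1 - RtoC v * z))%C = v * (1 - s) * x).
    { unfold g. replace (1 - RtoC v * (RtoC s * z) - (1 - RtoC v * z))%C with (RtoC (v * (1 - s)) * z)%C
        by (rewrite RtoC_mult, RtoC_minus; ring).
      rewrite Cmod_mult, Cmod_R, Rabs_pos_eq; [reflexivity|]. apply Rmult_le_pos; lra. }
    assert (T : Cmod ((1 - RtoC v * z) * P - g * Q)%C <=
        (Cmod g + v * (1 - s) * x) * Cmod (P - Q)%C + v * (1 - s) * x * Cmod Q).
    { replace ((1 - RtoC v * z) * P - g * Q)%C
        with (g * (P - Q) + - ((g - (1 - RtoC v * z)) * (P - Q)) + - ((g - (1 - RtoC v * z)) * Q))%C by ring.
      eapply Rle_trans; [apply Cmod_triangle|]. eapply Rle_trans; [apply Rplus_le_compat_r, Cmod_triangle|].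
      rewrite !Cmod_opp, !Cmod_mult, D. lra. }
    rewrite (Cmod_mult g).
    pose proof (Cmod_ge_0 (P - Q)) as HPQ. pose proof (Cmod_ge_0 Q) as HQ. pose proof (Cmod_ge_0 g) as Hg.
    set (e := v * (1 - s) * x) in *.
    assert (He : 0 <= e) by (unfold e; repeat apply Rmult_le_pos; lra).
    assert (Hx1 : 0 < 1 - v * x) by lra.
    assert (Eg : 1 - v * (s * x) = 1 - v * x + e) by (unfold e; ring).
    rewrite Eg. assert (B' : 1 - v * x + e <= Cmod g) by (rewrite <- Eg; lra).
    apply Rle_trans with (((Cmod g + e) * Cmod (P - Q)%C + e * Cmod Q) * ((1 - v * x) * p)).
    { apply Rmult_le_compat_r; [|exact T]. apply Rmult_le_pos; lra. }
    set (a := 1 - v * x) in *. set (d := Cmod (P - Q)%C) in *. set (k := Cmod Q) in *. set (G := Cmod g) in *.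
    (* [|g| >= a + e] gives [(|g| + e) a <= (a + e) |g|] and [e a <= e |g|] *)
    assert (I1 : (G + e) * a <= (a + e) * G) by nra.
    assert (I2 : (G + e) * a * (d * p) <= (a + e) * G * ((q - p) * k)).
    { apply Rmult_le_compat; [nra| |exact I1|exact IH]. apply Rmult_le_pos; lra. }
    assert (I3 : e * a * (k * p) <= e * G * (k * p)).
    { apply Rmult_le_compat_r; [apply Rmult_le_pos; lra|]. apply Rmult_le_compat_l; lra. }
    lra.
Qed.

(** Factor by factor, [1 - u <= (1 - u / 2) ^ 2]. In the limit this is the inequality
    [phi x <= phi (x / 2) ^ 2]. *)
Lemma prod_inv_roots_half (vs : list R) (x : R) : 0 <= x ->
  (forall v, In v vs -> 0 < v /\ v * x < 1) ->
  0 <= prod_inv_roots_R vs x <= prod_inv_roots_R vs (x / 2) ^ 2.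
Proof.
  intros Hx. induction vs as [|v vs IH]; intros H; [simpl; lra|].
  destruct (H v (or_introl eq_refl)) as [Hv Hvz].
  specialize (IH (fun u Hu => H u (or_intror Hu))).
  change (0 <= (1 - v * x) * prod_inv_roots_R vs x <=
    ((1 - v * (x / 2)) * prod_inv_roots_R vs (x / 2)) ^ 2).
  split; [apply Rmult_le_pos; lra|].
  rewrite Rpow_mult_distr. apply Rmult_le_compat; try lra.
  pose proof (pow2_ge_0 (v * x / 2)). nra.
Qed.

Lemma prod_inv_roots_R_root (vs : list R) (v : R) : In v vs -> v <> 0 ->
  prod_inv_roots_R vs (/ v) = 0.
Proof.
  intros Hin Hv. induction vs as [|u vs IH]; [destruct Hin|].
  change ((1 - u * / v) * prod_inv_roots_R vs (/ v) = 0).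
  destruct Hin as [->|Hin]; [rewrite Rinv_r by exact Hv; ring|rewrite IH by exact Hin; ring].
Qed.

(** * Inequalities for the approximating polynomials and their limits *)

Definition approx_poly (b : R) (n : nat) (z : C) : C := poly_eval (approx_coef b n) n z.

(** Positivity up to [|z|] excludes the roots [/ v] from that interval, so every factor satisfies
    [v |z| < 1] and the product inequalities apply. *)
Lemma approx_poly_ineqs (b : R) (n : nat) (z : C) (s : R) : 1 <= b <= 2 -> 0 <= s <= 1 ->
  (forall t, 0 <= t <= Cmod z -> 0 < Re (approx_poly b n (RtoC t))) ->
  Re (approx_poly b n (RtoC (Cmod z))) <= Cmod (approx_poly b n z) /\
  Cmod (approx_poly b n z - approx_poly b n (s * z))%C * Re (approx_poly b n (RtoC (Cmod z)))
    <= (Re (approx_poly b n (RtoC (s * Cmod z))) - Re (approx_poly b n (RtoC (Cmod z))))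
       * Cmod (approx_poly b n (s * z)%C) /\
  falling_ratio (2 * S n) 2 * Re (approx_poly b n (RtoC (Cmod z)))
    <= Re (approx_poly b n (RtoC (Cmod z / 2))) ^ 2.
Proof.
  intros Hb Hs Hpos. destruct (approx_factor b n Hb) as [vs [Hvs E]].
  set (A := falling_ratio (2 * S n) 2) in *.
  assert (HA0 : 0 <= A) by (apply falling_ratio_bounds; lia).
  assert (E' : forall w, approx_poly b n w = (RtoC A * prod_inv_roots vs w)%C) by exact E.
  assert (ER : forall t, Re (approx_poly b n (RtoC t)) = A * prod_inv_roots_R vs t).
  { intros t. rewrite E', prod_inv_roots_RtoC, <- RtoC_mult. reflexivity. }
  pose proof (Cmod_ge_0 z) as Hz.
  assert (H : forall v, In v vs -> 0 < v /\ v * Cmod z < 1).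
  { intros v Hin. specialize (Hvs v Hin). split; [exact Hvs|].
    destruct (Rlt_le_dec (v * Cmod z) 1) as [L|L]; [exact L|exfalso].
    assert (Hi : 0 < / v) by now apply Rinv_0_lt_compat.
    specialize (Hpos (/ v)). rewrite ER, prod_inv_roots_R_root in Hpos by (auto; lra).
    assert (/ v <= Cmod z); [|lra].
    apply Rmult_le_reg_l with v; [exact Hvs|]. rewrite Rinv_r by lra. lra. }
  rewrite !ER, !E'.
  replace (RtoC A * prod_inv_roots vs z - RtoC A * prod_inv_roots vs (s * z))%C
    with (RtoC A * (prod_inv_roots vs z - prod_inv_roots vs (s * z)))%C by ring.
  rewrite !Cmod_mult, !Cmod_R, !(Rabs_pos_eq A) by exact HA0.
  split; [|split].
  - apply Rmult_le_compat_l; [exact HA0|]. now apply prod_inv_roots_le.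
  - pose proof (prod_inv_roots_scaled vs z s Hs H) as P. nra.
  - pose proof (prod_inv_roots_half vs (Cmod z) Hz H) as P. nra.
Qed.

Definition phi_real (b x : R) : R := PSeries (phi_coef b) x.
Definition Phi (b : R) (z : C) : C := CPS (phi_coef b) z.

Lemma Phi_RtoC (b x : R) : Phi b (RtoC x) = RtoC (phi_real b x).
Proof. apply CPS_RtoC. Qed.

Lemma is_lim_seq_inv_rate (u : nat -> R) (l K : R) :
  (forall n, Rabs (u n - l) <= K / INR (S n)) -> is_lim_seq u l.
Proof.
  intros H.
  assert (L : is_lim_seq (fun n => K / INR (S n)) 0).
  { apply -> (is_lim_seq_incr_1 (fun n => K / INR n)).
    replace (Finite 0) with (Rbar_mult K (Rbar_inv p_infty)) by (simpl; f_equal; ring).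
    apply (is_lim_seq_scal_l (fun n => / INR n) K).
    apply is_lim_seq_inv; [apply is_lim_seq_INR|discriminate]. }
  apply is_lim_seq_le_le with (fun n => l - K / INR (S n)) (fun n => l + K / INR (S n)).
  - intros n. specialize (H n). apply Rabs_le_between in H. lra.
  - replace (Finite l) with (Finite (l - 0)) by (f_equal; ring).
    apply is_lim_seq_minus'; [apply is_lim_seq_const|exact L].
  - replace (Finite l) with (Finite (l + 0)) by (f_equal; ring).
    apply is_lim_seq_plus'; [apply is_lim_seq_const|exact L].
Qed.

Lemma Rabs_Cmod_sub (z w : C) : Rabs (Cmod z - Cmod w) <= Cmod (z - w)%C.
Proof.
  apply Rabs_le_between.
  pose proof (Cmod_triangle (z - w) w) as T1. pose proof (Cmod_triangle (- (z - w)) z) as T2.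
  rewrite Cmod_opp in T2.
  replace (z - w + w)%C with z in T1 by ring. replace (- (z - w) + z)%C with w in T2 by ring. lra.
Qed.

Lemma approx_poly_conv (b : R) (n : nat) (z : C) (x : R) : 1 <= b -> Cmod z <= x ->
  Cmod (approx_poly b n z - Phi b z)%C <= approx_error b x / INR (S n).
Proof.
  intros Hb Hz. rewrite <- Cmod_opp.
  replace (- (approx_poly b n z - Phi b z))%C with (Phi b z - approx_poly b n z)%C by ring.
  now apply approx_error_bound.
Qed.

Lemma approx_poly_lim_mod (b : R) (z : C) : 1 <= b ->
  is_lim_seq (fun n => Cmod (approx_poly b n z)) (Cmod (Phi b z)).
Proof.
  intros Hb. apply is_lim_seq_inv_rate with (approx_error b (Cmod z)). intros n.
  eapply Rle_trans; [apply Rabs_Cmod_sub|]. apply approx_poly_conv; lra.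
Qed.

Lemma approx_poly_lim_mod_sub (b : R) (z w : C) : 1 <= b ->
  is_lim_seq (fun n => Cmod (approx_poly b n z - approx_poly b n w)%C) (Cmod (Phi b z - Phi b w)%C).
Proof.
  intros Hb.
  apply is_lim_seq_inv_rate with (approx_error b (Cmod z) + approx_error b (Cmod w)). intros n.
  eapply Rle_trans; [apply Rabs_Cmod_sub|].
  replace (approx_poly b n z - approx_poly b n w - (Phi b z - Phi b w))%C
    with (approx_poly b n z - Phi b z + - (approx_poly b n w - Phi b w))%C by ring.
  eapply Rle_trans; [apply Cmod_triangle|]. rewrite Cmod_opp.
  unfold Rdiv. rewrite Rmult_plus_distr_r.
  apply Rplus_le_compat; apply approx_poly_conv; lra.
Qed.

Lemma approx_poly_Re (b : R) (n : nat) (t x : R) : 1 <= b -> 0 <= t <= x ->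
  Rabs (Re (approx_poly b n (RtoC t)) - phi_real b t) <= approx_error b x / INR (S n).
Proof.
  intros Hb Ht. eapply Rle_trans; [|apply (approx_poly_conv b n (RtoC t) x Hb)].
  - rewrite Phi_RtoC. apply (re_le_Cmod (approx_poly b n (RtoC t) - RtoC (phi_real b t))%C).
  - rewrite Cmod_R, Rabs_pos_eq; lra.
Qed.

Lemma approx_poly_lim_Re (b t : R) : 1 <= b -> 0 <= t ->
  is_lim_seq (fun n => Re (approx_poly b n (RtoC t))) (phi_real b t).
Proof.
  intros Hb Ht. apply is_lim_seq_inv_rate with (approx_error b t). intros n.
  apply approx_poly_Re; lra.
Qed.

Lemma phi_real_derive (b x : R) : 1 <= b ->
  is_derive (phi_real b) x (PSeries (PS_derive (phi_coef b)) x).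
Proof.
  intros Hb. apply is_derive_PSeries. rewrite phi_coef_entire by exact Hb. exact I.
Qed.

Lemma phi_real_continuity (b x : R) : 1 <= b -> continuity_pt (phi_real b) x.
Proof.
  intros Hb. apply continuity_pt_filterlim.
  apply (ex_derive_continuous (V := R_NormedModule)). eexists. now apply phi_real_derive.
Qed.

(** On the compact interval [phi_real b] has a positive minimum and the approximation is uniform, so
    the polynomials are eventually positive there. Their inequalities then pass to the limit. *)
Theorem Phi_ineqs (b : R) (z : C) (s : R) : 1 <= b <= 2 -> 0 <= s <= 1 ->
  (forall t, 0 <= t <= Cmod z -> 0 < phi_real b t) ->
  phi_real b (Cmod z) <= Cmod (Phi b z) /\
  Cmod (Phi b z - Phi b (s * z))%C * phi_real b (Cmod z)
    <= (phi_real b (s * Cmod z) - phi_real b (Cmod z)) * Cmod (Phi b (s * z)%C) /\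
  phi_real b (Cmod z) <= phi_real b (Cmod z / 2) ^ 2.
Proof.
  intros Hb Hs Hpos. pose proof (Cmod_ge_0 z) as Hz. set (x := Cmod z) in *.
  assert (Hev : eventually (fun n => forall t, 0 <= t <= x -> 0 < Re (approx_poly b n (RtoC t)))).
  { destruct (continuity_ab_min (phi_real b) 0 x Hz) as [t0 [Hmin Ht0]].
    { intros c _. apply phi_real_continuity; lra. }
    specialize (Hpos t0 Ht0). set (mu := phi_real b t0) in *.
    assert (L : is_lim_seq (fun n => approx_error b x / INR (S n)) 0).
    { apply is_lim_seq_inv_rate with (Rabs (approx_error b x)). intros n.
      rewrite Rminus_0_r. unfold Rdiv. rewrite Rabs_mult, (Rabs_pos_eq (/ _)); [lra|].
      apply Rlt_le, Rinv_0_lt_compat, lt_0_INR. lia. }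
    apply is_lim_seq_spec in L. specialize (L (mkposreal mu Hpos)).
    destruct L as [N HN]. exists N. intros n Hn t Ht. specialize (HN n Hn). simpl in HN.
    rewrite Rminus_0_r in HN. pose proof (Rle_abs (approx_error b x / INR (S n))).
    pose proof (approx_poly_Re b n t x ltac:(lra) Ht) as B. apply Rabs_le_between in B.
    specialize (Hmin t Ht). simpl in *. lra. }
  assert (Hb1 : 1 <= b) by lra.
  assert (Hsx : 0 <= s * x) by (apply Rmult_le_pos; lra).
  split; [|split].
  - refine (is_lim_seq_le_loc _ _ (Finite _) (Finite _) _
      (approx_poly_lim_Re b x Hb1 Hz) (approx_poly_lim_mod b z Hb1)).
    destruct Hev as [N HN]. exists N. intros n Hn. apply (approx_poly_ineqs b n z s Hb Hs (HN n Hn)).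
  - refine (is_lim_seq_le_loc _ _ (Finite _) (Finite _) _
      (is_lim_seq_mult' _ _ _ _ (approx_poly_lim_mod_sub b z (s * z)%C Hb1) (approx_poly_lim_Re b x Hb1 Hz))
      (is_lim_seq_mult' _ _ _ _
        (is_lim_seq_minus' _ _ _ _ (approx_poly_lim_Re b (s * x) Hb1 Hsx) (approx_poly_lim_Re b x Hb1 Hz))
        (approx_poly_lim_mod b (s * z)%C Hb1))).
    destruct Hev as [N HN]. exists N. intros n Hn. apply (approx_poly_ineqs b n z s Hb Hs (HN n Hn)).
  - assert (LA : is_lim_seq (fun n => falling_ratio (2 * S n) 2) 1).
    { apply is_lim_seq_inv_rate with 4. intros n.
      destruct (falling_ratio_bounds (2 * S n) 2 ltac:(lia)) as [_ B].
      rewrite mult_INR in B. replace (INR 2) with 2 in B by (simpl; ring).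
      assert (0 < INR (S n)) by (apply lt_0_INR; lia).
      replace (2 ^ 2 / (2 * INR (S n))) with (2 / INR (S n)) in B by (field; lra).
      assert (0 < / INR (S n)) by now apply Rinv_0_lt_compat.
      apply Rabs_le_between. unfold Rdiv in *. lra. }
    assert (L2 := approx_poly_lim_Re b (x / 2) Hb1 ltac:(lra)).
    rewrite <- (Rmult_1_l (phi_real b x)). replace (phi_real b (x / 2) ^ 2)
      with (phi_real b (x / 2) * phi_real b (x / 2)) by ring.
    refine (is_lim_seq_le_loc _ _ (Finite _) (Finite _) _
      (is_lim_seq_mult' _ _ _ _ LA (approx_poly_lim_Re b x Hb1 Hz))
      (is_lim_seq_mult' _ _ _ _ L2 L2)).
    destruct Hev as [N HN]. exists N. intros n Hn.
    destruct (approx_poly_ineqs b n z s Hb Hs (HN n Hn)) as [_ [_ H]]. fold x in H. lra.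
Qed.

(** * The logarithmic derivative *)

Definition dphi_real (b x : R) : R := PSeries (PS_derive (phi_coef b)) x.
Definition dPhi (b : R) (z : C) : C := CPS (PS_derive (phi_coef b)) z.

Lemma dPhi_RtoC (b x : R) : dPhi b (RtoC x) = RtoC (dphi_real b x).
Proof. apply CPS_RtoC. Qed.

Lemma is_Cderive_Phi (b : R) (z : C) : 1 <= b -> is_derive (Phi b) z (dPhi b z).
Proof. intros Hb. apply is_Cderive_CPS. now apply phi_coef_entire. Qed.

Lemma phi_real_0 (b : R) : phi_real b 0 = 1.
Proof. unfold phi_real. now rewrite PSeries_0, phi_coef_0. Qed.

(** [log_gap b T x < 0] means that [- x phi'(x) / phi(x) < T], as long as [phi > 0]. *)
Definition log_gap (b T x : R) : R := - x * dphi_real b x - T * phi_real b x.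

Lemma log_gap_continuity (b T x : R) : 1 <= b -> continuity_pt (log_gap b T) x.
Proof.
  intros Hb. apply continuity_pt_filterlim.
  apply (ex_derive_continuous (V := R_NormedModule)).
  assert (H1 : ex_derive (phi_real b) x) by (eexists; now apply phi_real_derive).
  assert (H2 : ex_derive (dphi_real b) x).
  { eexists. apply is_derive_PSeries. rewrite CV_radius_derive, phi_coef_entire by exact Hb. exact I. }
  unfold log_gap. auto_derive. auto.
Qed.

Lemma first_root (f : R -> R) (X : R) : (forall x, continuity_pt f x) ->
  f 0 < 0 -> 0 <= X -> 0 <= f X ->
  exists x, 0 < x /\ f x = 0 /\ forall t, 0 <= t < x -> f t < 0.
Proof.
  intros Hf H0 HX HfX.
  set (S := fun x => 0 <= x <= X /\ forall t, 0 <= t <= x -> f t < 0).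
  assert (Hcont : forall x e, 0 < e -> exists d, 0 < d /\ forall y, Rabs (y - x) < d -> Rabs (f y - f x) < e).
  { intros x e He. destruct (Hf x e He) as [d [Hd H]]. exists d; split; [exact Hd|].
    intros y Hy. destruct (Req_dec y x) as [->|Hn].
    - rewrite Rminus_diag, Rabs_R0. exact He.
    - apply H. split; [split; [exact I|auto]|exact Hy]. }
  assert (S0 : S 0).
  { split; [lra|]. intros t Ht. replace t with 0 by lra. exact H0. }
  destruct (completeness S) as [l [Hl1 Hl2]].
  { exists X. intros x [Hx _]. lra. }
  { now exists 0. }
  assert (Hl0 : 0 <= l) by now apply Hl1.
  assert (HlX : l <= X) by (apply Hl2; intros x [Hx _]; lra).
  assert (Hbelow : forall t, 0 <= t < l -> f t < 0).
  { intros t Ht. destruct (Classical_Prop.classic (exists x, S x /\ t < x)) as [[x [[_ Hx] Htx]]|N].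
    - apply Hx. lra.
    - exfalso. assert (l <= t); [|lra]. apply Hl2. intros x Hx.
      destruct (Rle_lt_dec x t) as [L|L]; [exact L|]. exfalso. apply N. now exists x. }
  assert (Hfl : f l = 0).
  { destruct (Rtotal_order (f l) 0) as [L|[L|L]]; [exfalso|exact L|exfalso].
    - destruct (Hcont l (- f l) ltac:(lra)) as [d [Hd H]].
      assert (HlX' : l < X) by (destruct HlX as [?|E]; [assumption|rewrite E in L; lra]).
      set (y := Rmin (l + d / 2) X).
      assert (Hy : S y).
      { pose proof (Rmin_l (l + d / 2) X). pose proof (Rmin_r (l + d / 2) X). fold y in H1, H2.
        assert (l < y) by (apply Rmin_glb_lt; lra).
        split; [lra|]. intros t Ht. destruct (Rlt_le_dec t l) as [Q|Q]; [apply Hbelow; lra|].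
        specialize (H t). rewrite Rabs_pos_eq in H by lra. specialize (H ltac:(lra)).
        apply Rabs_lt_between in H. lra. }
      apply Hl1 in Hy. assert (l < y) by (apply Rmin_glb_lt; lra). lra.
    - destruct (Hcont l (f l) ltac:(lra)) as [d [Hd H]].
      assert (Hl : 0 < l) by (destruct Hl0 as [?|E]; [assumption|rewrite <- E in L; lra]).
      set (t := Rmax 0 (l - d / 2)).
      assert (Ht : 0 <= t < l) by (split; [apply Rmax_l|apply Rmax_lub_lt; lra]).
      assert (l - d / 2 <= t) by apply Rmax_r.
      specialize (Hbelow t Ht). specialize (H t). rewrite Rabs_left in H by lra.
      specialize (H ltac:(lra)). apply Rabs_lt_between in H. lra. }
  exists l. split; [|auto].
  destruct Hl0 as [?|E]; [assumption|rewrite <- E in Hfl; lra].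
Qed.

(** The derivative of [x ^ T * phi x] is [- x ^ (T - 1) * log_gap b T x]. No sign of [phi] is
    assumed, so that positivity can be deduced from this monotonicity. *)
Lemma power_phi_incr (b T X x y : R) : 1 <= b ->
  (forall t, 0 <= t < X -> log_gap b T t < 0) -> 0 < x <= y -> y <= X ->
  Rpower x T * phi_real b x <= Rpower y T * phi_real b y.
Proof.
  intros Hb HX Hxy HyX.
  assert (D : forall t, 0 < t -> is_derive (fun t => Rpower t T * phi_real b t) t
     (- (Rpower t T / t * log_gap b T t))).
  { intros t Ht.
    replace (- (Rpower t T / t * log_gap b T t))
      with (plus (mult (T * Rpower t T / t) (phi_real b t)) (mult (Rpower t T) (dphi_real b t)))
      by (unfold plus, mult, log_gap; simpl; field; lra).
    apply (is_derive_mult (fun t => Rpower t T) (phi_real b));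
      [|now apply phi_real_derive|exact Rmult_comm].
    unfold Rpower. auto_derive; [exact Ht|]. field. lra. }
  destruct (MVT_gen (fun t => Rpower t T * phi_real b t) x y
     (fun t => - (Rpower t T / t * log_gap b T t))) as [c [Hc E]].
  - intros t Ht. rewrite Rmin_left, Rmax_right in Ht by lra. apply D. lra.
  - intros t Ht. rewrite Rmin_left, Rmax_right in Ht by lra.
    apply continuity_pt_filterlim.
    apply (ex_derive_continuous (V := R_NormedModule) (fun t => Rpower t T * phi_real b t) t).
    eexists. apply D. lra.
  - rewrite Rmin_left, Rmax_right in Hc by lra.
    assert (G : log_gap b T c <= 0).
    { destruct (Rlt_le_dec c X) as [L|L]; [left; apply HX; lra|].
      (* at [c = X], by continuity from the left *)
      assert (c = X) by lra. subst c.
      destruct (Rle_lt_dec (log_gap b T X) 0) as [Q|Q]; [exact Q|exfalso].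
      destruct (log_gap_continuity b T X Hb _ Q) as [d [Hd H]].
      set (t := Rmax (X / 2) (X - d / 2)).
      assert (X / 2 <= t) by apply Rmax_l. assert (X - d / 2 <= t) by apply Rmax_r.
      assert (t < X) by (apply Rmax_lub_lt; lra).
      specialize (HX t ltac:(lra)). specialize (H t). simpl in H. unfold Rdist in H.
      rewrite Rabs_left in H by lra.
      specialize (H ltac:(split; [split; [exact I|lra]|lra])).
      apply Rabs_lt_between in H. lra. }
    assert (P : 0 < Rpower c T / c) by (apply Rdiv_lt_0_compat; [apply exp_pos|lra]).
    assert (0 <= - (Rpower c T / c * log_gap b T c) * (y - x)) by (apply Rmult_le_pos; nra).
    lra.
Qed.

(** Near 0 the function is positive because [phi 0 = 1], and from there [x ^ T * phi x] does not
    decrease. The endpoint [X] is included, since sharpness is tested at the radius itself. *)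
Lemma phi_real_pos (b T X y : R) : 1 <= b ->
  (forall t, 0 <= t < X -> log_gap b T t < 0) -> 0 <= y <= X -> 0 < phi_real b y.
Proof.
  intros Hb HX [[Hy0|Hy0] HyX]; [|subst y; rewrite phi_real_0; lra].
  destruct (phi_real_continuity b 0 Hb (1 / 2) ltac:(lra)) as [d [Hd H]].
  set (x := Rmin y (d / 2)).
  assert (Hx : 0 < x) by (apply Rmin_pos; lra).
  assert (x <= y) by apply Rmin_l. assert (x <= d / 2) by apply Rmin_r.
  assert (Px : 0 < phi_real b x).
  { specialize (H x). simpl in H. unfold Rdist in H. rewrite Rminus_0_r, Rabs_pos_eq in H by lra.
    specialize (H ltac:(split; [split; [exact I|lra]|lra])).
    rewrite phi_real_0 in H. apply Rabs_lt_between in H. lra. }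
  pose proof (power_phi_incr b T X x y Hb HX ltac:(lra) HyX) as M.
  assert (0 < Rpower x T) by apply exp_pos. assert (0 < Rpower y T) by apply exp_pos. nra.
Qed.

Lemma phi_real_half (b T X y : R) : 1 <= b ->
  (forall t, 0 <= t < X -> log_gap b T t < 0) -> 0 < y <= X ->
  phi_real b (y / 2) <= Rpower 2 T * phi_real b y.
Proof.
  intros Hb HX Hy.
  pose proof (power_phi_incr b T X (y / 2) y Hb HX ltac:(lra) ltac:(lra)) as M.
  replace (Rpower y T) with (Rpower (y / 2) T * Rpower 2 T) in M
    by (rewrite Rpower_mult_distr by lra; f_equal; field).
  rewrite Rmult_assoc in M. apply Rmult_le_reg_l in M; [exact M|apply exp_pos].
Qed.

Lemma phi_real_lt_1 (b : R) : 1 <= b -> exists y, 0 < y /\ phi_real b y < 1.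
Proof.
  intros Hb. pose proof (phi_real_derive b 0 Hb) as D.
  assert (E : PSeries (PS_derive (phi_coef b)) 0 < 0).
  { rewrite PSeries_0. unfold PS_derive. rewrite phi_coef_S, phi_coef_0 by lra. simpl.
    assert (0 < / (4 * (3 / 2 + 0) * (b + 0))) by (apply Rinv_0_lt_compat; nra).
    unfold Rdiv. nra. }
  set (l := PSeries (PS_derive (phi_coef b)) 0) in *.
  destruct (is_derive_eps_0 _ _ D (- l / 2) ltac:(lra)) as [d [Hd H]].
  exists (d / 2). split; [lra|]. specialize (H (d / 2)). rewrite Rabs_pos_eq in H by lra.
  specialize (H ltac:(lra)). rewrite phi_real_0 in H. apply Rabs_le_between in H. nra.
Qed.

(** If [log_gap] stayed negative, monotonicity would give [phi y <= 2 phi (2 y) <= 2 phi y ^ 2],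
    hence [phi >= 1/2] everywhere. But [phi] is below 1 somewhere, and repeated use of
    [phi (2 y) <= phi y ^ 2] then drives it to 0. *)
Lemma log_gap_root (b T : R) : 1 <= b <= 2 -> 0 < T <= 1 ->
  exists x, 0 < x /\ log_gap b T x = 0 /\ forall t, 0 <= t < x -> log_gap b T t < 0.
Proof.
  intros Hb HT. assert (Hb1 : 1 <= b) by lra.
  assert (G0 : log_gap b T 0 < 0) by (unfold log_gap; rewrite phi_real_0; lra).
  destruct (Classical_Prop.classic (exists X, 0 <= X /\ 0 <= log_gap b T X)) as [[X [HX0 HX]]|N].
  - apply first_root with X; auto. intros x. now apply log_gap_continuity.
  - exfalso.
    assert (Hneg : forall X t, 0 <= t < X -> log_gap b T t < 0).
    { intros X t Ht. destruct (Rlt_le_dec (log_gap b T t) 0) as [L|L]; [exact L|exfalso].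
      apply N. exists t. split; [lra|exact L]. }
    assert (Hpos : forall t, 0 <= t -> 0 < phi_real b t).
    { intros t Ht. apply (phi_real_pos b T (t + 1)); [exact Hb1|apply Hneg|lra]. }
    assert (Hsq : forall y, 0 <= y -> phi_real b (2 * y) <= phi_real b y ^ 2).
    { intros y Hy.
      destruct (Phi_ineqs b (RtoC (2 * y)) 0 Hb ltac:(lra)) as [_ [_ H]].
      - intros t Ht. apply Hpos. lra.
      - rewrite Cmod_R, Rabs_pos_eq in H by lra.
        replace (2 * y / 2) with y in H by field. exact H. }
    assert (Hhalf : forall y, 0 < y -> 1 / 2 <= phi_real b y).
    { intros y Hy.
      pose proof (phi_real_half b T (2 * y) (2 * y) Hb1 (Hneg (2 * y)) ltac:(lra)) as H.
      replace (2 * y / 2) with y in H by field.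
      specialize (Hsq y ltac:(lra)). pose proof (Hpos y ltac:(lra)) as P.
      assert (H2 : Rpower 2 T <= 2).
      { rewrite <- (Rpower_1 2) at 2 by lra. apply Rle_Rpower; lra. }
      assert (0 < Rpower 2 T) by apply exp_pos.
      assert (phi_real b y <= 2 * phi_real b y ^ 2) by nra. nra. }
    destruct (phi_real_lt_1 b Hb1) as [y [Hy0 Hy1]].
    set (q := phi_real b y) in *. pose proof (Hpos y ltac:(lra)) as Hq. fold q in Hq.
    assert (Hpow : forall n, 0 < phi_real b (2 ^ n * y) <= q ^ (2 ^ n)).
    { induction n as [|n IH]; [simpl; rewrite !Rmult_1_l, Rmult_1_r; fold q; lra|].
      assert (0 < 2 ^ n * y) by (apply Rmult_lt_0_compat; [apply pow_lt|]; lra).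
      simpl (2 ^ S n). rewrite Rmult_assoc. split; [apply Hpos; lra|].
      eapply Rle_trans; [apply Hsq; lra|].
      replace (2 ^ S n)%nat with (2 ^ n * 2)%nat by (simpl; lia). rewrite pow_mult.
      apply pow_incr. lra. }
    destruct (pow_lt_1_zero q ltac:(rewrite Rabs_pos_eq; lra) (1 / 2) ltac:(lra)) as [k Hk].
    specialize (Hk (2 ^ k)%nat). rewrite Rabs_pos_eq in Hk by (apply pow_le; lra).
    specialize (Hk ltac:(apply Nat.lt_le_incl, Nat.pow_gt_lin_r; lia)).
    specialize (Hpow k). specialize (Hhalf (2 ^ k * y) ltac:(apply Rmult_lt_0_compat; [apply pow_lt|]; lra)).
    lra.
Qed.

Lemma is_lim_seq_inv_INR : is_lim_seq (fun n => / INR (S n)) 0.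
Proof.
  apply is_lim_seq_inv_rate with 1. intros n.
  rewrite Rminus_0_r, Rabs_pos_eq; [unfold Rdiv; lra|].
  apply Rlt_le, Rinv_0_lt_compat, lt_0_INR. lia.
Qed.

(** The second inequality of [Phi_ineqs] with [s = 1 - t], divided by [t], becomes this one as [t]
    tends to 0. *)
Lemma Phi_log_derivative (b : R) (z : C) : 1 <= b <= 2 ->
  (forall t, 0 <= t <= Cmod z -> 0 < phi_real b t) ->
  Cmod (z * dPhi b z)%C * phi_real b (Cmod z) <= - Cmod z * dphi_real b (Cmod z) * Cmod (Phi b z).
Proof.
  intros Hb Hpos. assert (Hb1 : 1 <= b) by lra.
  set (x := Cmod z) in *. pose proof (Cmod_ge_0 z) as Hx. fold x in Hx.
  set (t := fun n => / INR (S n)).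
  assert (Ht : forall n, 0 < t n <= 1).
  { intros n. unfold t. assert (1 <= INR (S n)) by (apply (le_INR 1); lia).
    split; [apply Rinv_0_lt_compat; lra|]. rewrite <- Rinv_1. apply Rinv_le_contravar; lra. }
  assert (Lt : is_lim_seq t 0) by apply is_lim_seq_inv_INR.
  assert (Lev : forall d, 0 < d -> eventually (fun n => t n < d)).
  { intros d Hd. apply is_lim_seq_spec in Lt. destruct (Lt (mkposreal d Hd)) as [N HN].
    exists N. intros n Hn. specialize (HN n Hn). simpl in HN. apply Rabs_lt_between in HN. lra. }
  assert (L1 : is_lim_seq (fun n => Cmod (Phi b z - Phi b (RtoC (1 - t n) * z))%C / t n) (Cmod (z * dPhi b z)%C)).
  { apply is_lim_seq_spec. intros eps.
    assert (He : 0 < eps / (x + 1)) by (apply Rdiv_lt_0_compat; [apply cond_pos|lra]).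
    destruct (proj1 (is_Cderive_eps _ _ _) (is_Cderive_Phi b z Hb1) _ He) as [d [Hd H]].
    assert (Hd' : 0 < d / (x + 1)) by (apply Rdiv_lt_0_compat; lra).
    destruct (Lev _ Hd') as [N HN]. exists N. intros n Hn. specialize (HN n Hn).
    specialize (Ht n).
    assert (Em : Cmod (- (RtoC (t n) * z))%C = t n * x).
    { rewrite Cmod_opp, Cmod_mult, Cmod_R, Rabs_pos_eq by lra. reflexivity. }
    specialize (H (- (RtoC (t n) * z))%C). rewrite Em in H.
    assert (t n * x < d) by (apply Rlt_div_r in HN; lra).
    specialize (H ltac:(assumption)).
    replace (z + - (RtoC (t n) * z))%C with (RtoC (1 - t n) * z)%C in H by (rewrite RtoC_minus; ring).
    replace (Phi b (RtoC (1 - t n) * z) - Phi b z - dPhi b z * - (RtoC (t n) * z))%C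
      with (RtoC (t n) * (z * dPhi b z) - (Phi b z - Phi b (RtoC (1 - t n) * z)))%C in H by ring.
    pose proof (Rabs_Cmod_sub (RtoC (t n) * (z * dPhi b z)) (Phi b z - Phi b (RtoC (1 - t n) * z))) as T.
    rewrite (Cmod_mult (RtoC (t n))), Cmod_R, (Rabs_pos_eq (t n)) in T by lra.
    set (u := Cmod (Phi b z - Phi b (RtoC (1 - t n) * z))%C) in *.
    set (v := Cmod (z * dPhi b z)%C) in *.
    replace (u / t n - v) with (- ((t n * v - u) / t n)) by (field; lra).
    rewrite Rabs_Ropp. unfold Rdiv. rewrite Rabs_mult, (Rabs_pos_eq (/ t n)) by (apply Rlt_le, Rinv_0_lt_compat; lra).
    apply Rmult_lt_reg_r with (t n); [lra|]. rewrite Rmult_assoc, Rinv_l, Rmult_1_r by lra.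
    eapply Rle_lt_trans; [exact T|]. eapply Rle_lt_trans; [exact H|].
    replace (eps / (x + 1) * (t n * x)) with (eps * t n * (x / (x + 1))) by (field; lra).
    assert (x / (x + 1) < 1) by (apply Rlt_div_l; lra).
    assert (0 < eps * t n) by (apply Rmult_lt_0_compat; [apply cond_pos|lra]). nra. }
  assert (L2 : is_lim_seq (fun n => (phi_real b ((1 - t n) * x) - phi_real b x) / t n) (- x * dphi_real b x)).
  { assert (D : is_derive (fun h => phi_real b ((1 - h) * x)) 0 (- x * dphi_real b x)).
    { assert (D0 : ex_derive (phi_real b) ((1 - 0) * x)) by (eexists; now apply phi_real_derive).
      auto_derive; [exact D0|].
      rewrite (is_derive_unique (fun x0 : R => phi_real b x0) _ _ (phi_real_derive b _ Hb1)).
      replace ((1 + - 0) * x) with x by ring. unfold dphi_real. ring. }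
    apply is_lim_seq_spec. intros eps.
    assert (He : 0 < eps / 2) by (pose proof (cond_pos eps); lra).
    destruct (is_derive_eps_0 _ _ D _ He) as [d [Hd H]].
    destruct (Lev _ Hd) as [N HN]. exists N. intros n Hn. specialize (HN n Hn). specialize (Ht n).
    specialize (H (t n)). rewrite (Rabs_pos_eq (t n)) in H by lra. specialize (H HN).
    replace ((1 - 0) * x) with x in H by ring.
    replace ((phi_real b ((1 - t n) * x) - phi_real b x) / t n - - x * dphi_real b x)
      with ((phi_real b ((1 - t n) * x) - phi_real b x - - x * dphi_real b x * t n) / t n) by (field; lra).
    unfold Rdiv at 1. rewrite Rabs_mult, (Rabs_pos_eq (/ t n)) by (apply Rlt_le, Rinv_0_lt_compat; lra).
    apply Rmult_lt_reg_r with (t n); [lra|]. rewrite Rmult_assoc, Rinv_l, Rmult_1_r by lra.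
    eapply Rle_lt_trans; [exact H|]. pose proof (cond_pos eps). nra. }
  assert (L3 : is_lim_seq (fun n => Cmod (Phi b (RtoC (1 - t n) * z)%C)) (Cmod (Phi b z))).
  { apply is_lim_seq_spec. intros eps.
    destruct (Cderive_cont (Phi b) z) with (eps := pos eps) as [d [Hd H]].
    { eexists. now apply is_Cderive_Phi. }
    { apply cond_pos. }
    assert (Hd' : 0 < d / (x + 1)) by (apply Rdiv_lt_0_compat; lra).
    destruct (Lev _ Hd') as [N HN]. exists N. intros n Hn. specialize (HN n Hn). specialize (Ht n).
    specialize (H (- (RtoC (t n) * z))%C).
    rewrite Cmod_opp, Cmod_mult, Cmod_R, Rabs_pos_eq in H by lra. fold x in H.
    replace (z + - (RtoC (t n) * z))%C with (RtoC (1 - t n) * z)%C in H by (rewrite RtoC_minus; ring).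
    eapply Rle_lt_trans; [apply Rabs_Cmod_sub|]. apply H.
    apply Rlt_div_r in HN; lra. }
  refine (is_lim_seq_le _ _ (Finite _) (Finite _) _
    (is_lim_seq_mult' _ _ _ _ L1 (is_lim_seq_const (phi_real b x)))
    (is_lim_seq_mult' _ _ _ _ L2 L3)).
  intros n. specialize (Ht n).
  destruct (Phi_ineqs b z (1 - t n) Hb ltac:(lra) Hpos) as [_ [H _]]. fold x in H.
  apply Rmult_le_reg_r with (t n); [lra|].
  set (u := Cmod (Phi b z - Phi b (RtoC (1 - t n) * z))%C) in *.
  replace (u / t n * phi_real b x * t n) with (u * phi_real b x) by (field; lra).
  eapply Rle_trans; [exact H|]. right. field. lra.
Qed.

(** The distance from 1 to the lines [|Im| = Re] is [1 / sqrt 2], so both factors have argument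
    smaller than [PI / 4] in absolute value. *)
Lemma Re_mult_pos (p q : C) (k : R) : 0 <= k -> 2 * k ^ 2 < 1 ->
  Cmod (p - 1)%C <= k -> Cmod (q - 1)%C <= k -> 0 < Re (p * q)%C.
Proof.
  intros Hk Hk2 Hp Hq.
  assert (A : forall p : C, Cmod (p - 1)%C <= k -> Rabs (Im p) < Re p).
  { clear - Hk Hk2. intros p Hp.
    assert (Hs : Cmod (p - 1)%C ^ 2 <= k ^ 2) by (apply pow_incr; split; [apply Cmod_ge_0|exact Hp]).
    rewrite Cmod2_alt in Hs. destruct p as [x y]. simpl in Hs. simpl.
    destruct (Rlt_le_dec (Rabs y) x) as [L|L]; [exact L|exfalso].
    pose proof (pow2_abs y) as Ey. pose proof (Rabs_pos y) as Hy.
    assert (E : (x - 1) ^ 2 + Rabs y ^ 2 <= k ^ 2) by (rewrite Ey; simpl; lra).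
    destruct (Rle_lt_dec x 0) as [Hx|Hx]; [nra|].
    assert (x ^ 2 <= Rabs y ^ 2) by (apply pow_incr; lra).
    pose proof (pow2_ge_0 (x - 1 / 2)). lra. }
  apply A in Hp, Hq. destruct p as [a c], q as [a' c']. simpl in *.
  apply Rabs_lt_between in Hp, Hq. nra.
Qed.

(** Write [Phi z] as [(Phi z / Phi (z / 2)) * Phi (z / 2)]. With [x = |z|], the factors differ from
    1 by at most [phi (x / 2) / phi x - 1] and [1 / phi (x / 2) - 1]. By the squaring inequality the
    latter is no larger than the former, which is at most [2 ^ T - 1]. *)
Lemma Phi_Re_pos (b T X : R) (z : C) : 1 <= b <= 2 -> T <= 3 / 4 ->
  (forall t, 0 <= t < X -> log_gap b T t < 0) -> Cmod z <= X -> 0 < Re (Phi b z).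
Proof.
  intros Hb HT HX Hz. assert (Hb1 : 1 <= b) by lra.
  destruct (Ceq_dec z 0) as [->|Hz0]; [rewrite Phi_RtoC, phi_real_0; simpl; lra|].
  assert (Hx : 0 < Cmod z) by now apply Cmod_gt_0.
  assert (Hpos : forall t, 0 <= t <= Cmod z -> 0 < phi_real b t).
  { intros t Ht. apply (phi_real_pos b T X); [exact Hb1|exact HX|lra]. }
  set (z2 := (RtoC (1 / 2) * z)%C).
  assert (Ez2 : Cmod z2 = Cmod z / 2).
  { unfold z2. rewrite Cmod_mult, Cmod_R, Rabs_pos_eq by lra. lra. }
  assert (Hpos2 : forall t, 0 <= t <= Cmod z2 -> 0 < phi_real b t) by (intros t Ht; apply Hpos; lra).
  destruct (Phi_ineqs b z (1 / 2) Hb ltac:(lra) Hpos) as [_ [I1 I2]]. fold z2 in I1.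
  destruct (Phi_ineqs b z2 0 Hb ltac:(lra) Hpos2) as [I3 [I4 _]].
  replace (RtoC 0 * z2)%C with (RtoC 0) in I4 by ring.
  rewrite Phi_RtoC, Rmult_0_l, phi_real_0, Cmod_1, Rmult_1_r in I4. rewrite Ez2 in *.
  replace (1 / 2 * Cmod z) with (Cmod z / 2) in I1 by field.
  pose proof (phi_real_half b T X (Cmod z) Hb1 HX ltac:(lra)) as I5.
  pose proof (Hpos (Cmod z) ltac:(lra)) as P1. pose proof (Hpos (Cmod z / 2) ltac:(lra)) as P2.
  (* From [(k + 1) ^ 4 = 8 < (17 / 10) ^ 4] one gets [k < 7 / 10], just enough for [2 k ^ 2 < 1]. *)
  set (k := Rpower 2 (3 / 4) - 1).
  assert (Ek : k + 1 = Rpower 2 (3 / 4)) by (unfold k; ring).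
  assert (Hk : 0 <= k /\ 2 * k ^ 2 < 1).
  { assert (E4 : (k + 1) ^ 4 = 8).
    { rewrite Ek, <- Rpower_pow by apply exp_pos. rewrite Rpower_mult.
      replace (3 / 4 * INR 4) with (INR 3) by (simpl; field). rewrite Rpower_pow by lra. ring. }
    assert (0 < k + 1) by (rewrite Ek; apply exp_pos).
    assert (0 <= k).
    { destruct (Rle_lt_dec 0 k) as [L|L]; [exact L|exfalso].
      assert ((k + 1) ^ 4 <= 1 ^ 4) by (apply pow_incr; lra). lra. }
    assert (k < 7 / 10).
    { destruct (Rlt_le_dec k (7 / 10)) as [L|L]; [exact L|exfalso].
      assert ((17 / 10) ^ 4 <= (k + 1) ^ 4) by (apply pow_incr; lra). lra. }
    split; [assumption|nra]. }
  assert (HT2 : Rpower 2 T <= k + 1).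
  { rewrite Ek. apply Rle_Rpower; lra. }
  assert (N2 : Phi b z2 <> 0%C) by (apply Cmod_gt_0; lra).
  replace (Phi b z) with (Phi b z / Phi b z2 * Phi b z2)%C by (field; exact N2).
  apply Re_mult_pos with k; [tauto|tauto| |].
  - replace (Phi b z / Phi b z2 - 1)%C with ((Phi b z - Phi b z2) / Phi b z2)%C by (field; exact N2).
    rewrite Cmod_div by exact N2.
    apply Rle_div_l; [lra|].
    apply Rmult_le_reg_r with (phi_real b (Cmod z)); [exact P1|].
    eapply Rle_trans; [exact I1|].
    assert (phi_real b (Cmod z / 2) - phi_real b (Cmod z) <= k * phi_real b (Cmod z)) by nra.
    nra.
  - apply Rmult_le_reg_r with (phi_real b (Cmod z / 2)); [exact P2|].
    eapply Rle_trans; [exact I4|].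
    (* [1 / phi(x/2) <= phi(x/2) / phi(x)] *)
    assert (phi_real b (Cmod z / 2) <= (k + 1) * phi_real b (Cmod z)) by nra.
    assert (phi_real b (Cmod z / 2) * 1 <= phi_real b (Cmod z / 2) * ((k + 1) * phi_real b (Cmod z / 2))) by nra.
    apply Rmult_le_reg_l in H0; [|exact P2]. lra.
Qed.

(** * The Gamma function *)

Definition gamma_integrand (x t : R) : R := Rpower t (x - 1) * exp (- t).

Lemma gamma_integrand_continuous (x t : R) : 0 < t -> continuous (gamma_integrand x) t.
Proof.
  intros Ht. apply (ex_derive_continuous (V := R_NormedModule)).
  unfold gamma_integrand, Rpower. auto_derive. exact Ht.
Qed.

Definition gamma_primitive (x u : R) : R := RInt (gamma_integrand x) 1 u.

Lemma gamma_primitive_derive (x u : R) : 0 < u ->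
  is_derive (gamma_primitive x) u (gamma_integrand x u).
Proof.
  intros Hu. apply (is_derive_RInt _ _ 1); [|now apply gamma_integrand_continuous].
  exists (mkposreal u Hu). intros y Hy. change (Rabs (y - u) < u) in Hy.
  apply Rabs_lt_between in Hy.
  apply (RInt_correct (V := R_CompleteNormedModule)).
  apply (ex_RInt_continuous (V := R_CompleteNormedModule)). intros z Hz. apply gamma_integrand_continuous.
  assert (0 < Rmin 1 y) by (apply Rmin_pos; lra). lra.
Qed.

Lemma gamma_primitive_incr (x u v : R) : 0 < u < v -> gamma_primitive x u < gamma_primitive x v.
Proof.
  intros Huv.
  destruct (MVT_gen (gamma_primitive x) u v (gamma_integrand x)) as [c [Hc E]].
  - intros t Ht. rewrite Rmin_left, Rmax_right in Ht by lra. apply gamma_primitive_derive. lra.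
  - intros t Ht. rewrite Rmin_left, Rmax_right in Ht by lra.
    apply continuity_pt_filterlim. apply (ex_derive_continuous (V := R_NormedModule) (gamma_primitive x)).
    eexists. apply gamma_primitive_derive. lra.
  - assert (0 < gamma_integrand x c) by (apply Rmult_lt_0_compat; apply exp_pos). nra.
Qed.

(** For these [x] the integrand is at most [(1 + t) exp (- t)], which has the bounded primitive
    [- (2 + t) exp (- t)]. *)
Lemma gamma_primitive_bound (x u : R) : 1 <= x <= 2 -> 0 < u -> -3 <= gamma_primitive x u <= 3.
Proof.
  intros Hx Hu.
  set (G := fun t => gamma_primitive x t + (2 + t) * exp (- t)).
  assert (D : forall t, 0 < t -> is_derive G t (gamma_integrand x t - (1 + t) * exp (- t))).
  { intros t Ht. unfold G.
    replace (gamma_integrand x t - (1 + t) * exp (- t))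
      with (plus (gamma_integrand x t) (- ((1 + t) * exp (- t)))) by (unfold plus; simpl; ring).
    apply (is_derive_plus (V := R_NormedModule)); [now apply gamma_primitive_derive|].
    auto_derive; [exact I|ring]. }
  assert (Dneg : forall t, 0 < t -> gamma_integrand x t - (1 + t) * exp (- t) <= 0).
  { intros t Ht. unfold gamma_integrand. pose proof (exp_pos (- t)) as P.
    assert (Rpower t (x - 1) <= 1 + t); [|nra].
    destruct (Rle_lt_dec t 1) as [L|L].
    - assert (Rpower t (x - 1) <= 1); [|lra].
      assert (ln t <= 0) by (rewrite <- ln_1; apply ln_le; lra).
      unfold Rpower. apply Rle_trans with (exp 0); [|rewrite exp_0; lra].
      assert (Hn : (x - 1) * ln t <= 0) by nra.
      destruct Hn as [Hn|Hn]; [left; now apply exp_increasing|right; now rewrite Hn].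
    - assert (Rpower t (x - 1) <= t); [|lra].
      rewrite <- (Rpower_1 t) at 2 by lra. apply Rle_Rpower; lra. }
  assert (Mono : forall s t, 0 < s < t -> G t <= G s).
  { intros s t Hst.
    destruct (MVT_gen G s t (fun t => gamma_integrand x t - (1 + t) * exp (- t))) as [c [Hc E]].
    - intros r Hr. rewrite Rmin_left, Rmax_right in Hr by lra. apply D. lra.
    - intros r Hr. rewrite Rmin_left, Rmax_right in Hr by lra.
      apply continuity_pt_filterlim. apply (ex_derive_continuous (V := R_NormedModule) G).
      eexists. apply D. lra.
    - rewrite Rmin_left, Rmax_right in Hc by lra. specialize (Dneg c ltac:(lra)).
      assert (0 <= - (gamma_integrand x c - (1 + c) * exp (- c)) * (t - s)) by (apply Rmult_le_pos; lra).
      lra. }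
  assert (F1 : gamma_primitive x 1 = 0) by (unfold gamma_primitive; exact (RInt_point (V := R_CompleteNormedModule) 1 _)).
  assert (Ee : forall t, 0 < t -> 0 < exp (- t) < 1).
  { intros t Ht. split; [apply exp_pos|].
    pose proof (exp_increasing (- t) 0 ltac:(lra)) as Q. now rewrite exp_0 in Q. }
  pose proof (Ee u Hu). pose proof (Ee 1 Rlt_0_1).
  destruct (Rtotal_order u 1) as [L|[L|L]].
  - pose proof (gamma_primitive_incr x u 1 ltac:(lra)). specialize (Mono u 1 ltac:(lra)).
    unfold G in Mono. nra.
  - subst u. lra.
  - pose proof (gamma_primitive_incr x 1 u ltac:(lra)). specialize (Mono 1 u ltac:(lra)).
    unfold G in Mono. nra.
Qed.

(** [RInt_gen] is meaningful only once convergence is known. The primitive is increasing and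
    bounded, so it has limits at 0 and at infinity, and their difference is at least the integral
    over [[1/2, 1]]. *)
Lemma Gamma_pos (x : R) : 1 <= x <= 2 -> 0 < Gamma x.
Proof.
  intros Hx. set (F := gamma_primitive x).
  assert (Hle : forall u v, 0 < u <= v -> F u <= F v).
  { intros u v [H1 [H2|H2]]; [left; apply gamma_primitive_incr; lra|subst; lra]. }
  destruct (completeness (fun y => exists u, 0 < u /\ y = F u)) as [Lb [Hb1 Hb2]].
  { exists 3. intros y [u [Hu ->]]. now apply gamma_primitive_bound. }
  { exists (F 1), 1. split; [lra|reflexivity]. }
  destruct (completeness (fun y => exists u, 0 < u /\ y = - F u)) as [La [Ha1 Ha2]].
  { exists 3. intros y [u [Hu ->]]. pose proof (gamma_primitive_bound x u Hx Hu). unfold F. lra. }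
  { exists (- F 1), 1. split; [lra|reflexivity]. }
  assert (Fb : filterlim F (Rbar_locally p_infty) (locally Lb)).
  { apply filterlim_locally. intros eps.
    destruct (Classical_Prop.classic (exists u, 0 < u /\ Lb - eps < F u)) as [[u [Hu HF]]|N].
    - exists u. intros v Hv. change (Rabs (F v - Lb) < eps). apply Rabs_lt_between.
      assert (F v <= Lb) by (apply Hb1; exists v; split; [lra|reflexivity]).
      specialize (Hle u v ltac:(lra)). pose proof (cond_pos eps). lra.
    - exfalso. assert (Lb <= Lb - eps); [|pose proof (cond_pos eps); lra].
      apply Hb2. intros y [u [Hu ->]]. destruct (Rle_lt_dec (F u) (Lb - eps)) as [L|L]; [exact L|].
      exfalso. apply N. now exists u. }
  assert (Fa : filterlim F (at_right 0) (locally (- La))).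
  { apply filterlim_locally. intros eps.
    destruct (Classical_Prop.classic (exists u, 0 < u /\ La - eps < - F u)) as [[u [Hu HF]]|N].
    - exists (mkposreal u Hu). intros v Hv Hv0. change (Rabs (v - 0) < u) in Hv.
      apply Rabs_lt_between in Hv.
      change (Rabs (F v - - La) < eps). apply Rabs_lt_between.
      assert (- F v <= La) by (apply Ha1; exists v; split; [lra|reflexivity]).
      specialize (Hle v u ltac:(lra)). pose proof (cond_pos eps). lra.
    - exfalso. assert (La <= La - eps); [|pose proof (cond_pos eps); lra].
      apply Ha2. intros y [u [Hu ->]]. destruct (Rle_lt_dec (- F u) (La - eps)) as [L|L]; [exact L|].
      exfalso. apply N. now exists u. }
  assert (Hprod : forall P : R -> Prop, (forall y, 0 < y -> P y) ->
    filter_prod (at_right 0) (Rbar_locally p_infty)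
      (fun ab => forall y, Rmin (fst ab) (snd ab) <= y <= Rmax (fst ab) (snd ab) -> P y)).
  { intros P HP. apply Filter_prod with (fun a => 0 < a) (fun b => 0 < b).
    - exists (mkposreal 1 Rlt_0_1). intros y _ Hy. exact Hy.
    - exists 0. auto.
    - intros a b Ha Hb y Hy. simpl in Hy. apply HP.
      assert (0 < Rmin a b) by now apply Rmin_pos. lra. }
  assert (Eder : forall t, 0 < t -> Derive F t = gamma_integrand x t).
  { intros t Ht. apply is_derive_unique. now apply gamma_primitive_derive. }
  assert (I : is_RInt_gen (gamma_integrand x) (at_right 0) (Rbar_locally p_infty) (Lb - - La)).
  { apply (is_RInt_gen_ext (Derive F)).
    - apply (filter_imp (fun ab => forall y, Rmin (fst ab) (snd ab) <= y <= Rmax (fst ab) (snd ab) ->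
          Derive F y = gamma_integrand x y)); [|now apply Hprod].
      intros ab H y Hy. apply H. lra.
    - apply is_RInt_gen_Derive; auto.
      + apply (Hprod (fun y => ex_derive F y)). intros y Hy. eexists. now apply gamma_primitive_derive.
      + apply (Hprod (fun y => continuous (Derive F) y)). intros y Hy.
        apply (continuous_ext_loc _ (gamma_integrand x)); [|now apply gamma_integrand_continuous].
        exists (mkposreal y Hy). intros z Hz. change (Rabs (z - y) < y) in Hz.
        apply Rabs_lt_between in Hz. symmetry. apply Eder. lra. }
  unfold Gamma. fold (gamma_integrand x).
  rewrite (is_RInt_gen_unique (V := R_CompleteNormedModule) _ _ I).
  assert (F 1 <= Lb) by (apply Hb1; exists 1; split; [lra|reflexivity]).
  assert (- F (1 / 2) <= La) by (apply Ha1; exists (1 / 2); split; [lra|reflexivity]).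
  pose proof (gamma_primitive_incr x (1 / 2) 1 ltac:(lra)) as Q. fold F in Q. lra.
Qed.

(** * The Struve function *)

Lemma hyp1F2_Phi (b : R) (w : C) : 0 < b -> hyp1F2 1 (3 / 2) b (- w / 4)%C = Phi b w.
Proof.
  intros Hb. apply CSeries_ext. intros n. rewrite <- phi_coef_hyp by exact Hb.
  replace (- w / 4)%C with (RtoC (- (1 / 4)) * w)%C.
  - rewrite Cpow_mult_l, <- RtoC_pow, RtoC_mult. ring.
  - rewrite RtoC_opp, RtoC_div by lra. field.
Qed.

Lemma struve_const_pos (beta : R) : Rabs beta <= 1 / 2 -> 0 < struve_const beta.
Proof.
  intros Hb. apply Rabs_le_between in Hb. unfold struve_const.
  assert (0 < Gamma (beta + 3 / 2)) by (apply Gamma_pos; lra).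
  repeat apply Rmult_lt_0_compat; [apply sqrt_lt_R0, PI_RGT_0|apply exp_pos|assumption].
Qed.

(** The power of 2 in [(z / 2) ^ (beta + 1)] can be split off the principal power because it is a
    positive factor, and [struve_const beta * 2 ^ (- beta - 1)] is the denominator in [struveH]. *)
Lemma struve_normalized (beta : R) (z : C) : Rabs beta <= 1 / 2 -> z <> 0%C ->
  (RtoC (struve_const beta) * struveH beta z)%C =
  (Cexp (RtoC (beta + 1) * Clog z) * Phi (beta + 3 / 2) (z ^ 2))%C.
Proof.
  intros Hb Hz. pose proof Hb as Hb'. apply Rabs_le_between in Hb'.
  assert (HG : 0 < Gamma (beta + 3 / 2)) by (apply Gamma_pos; lra).
  pose proof PI_RGT_0 as Hpi.
  unfold struveH. rewrite hyp1F2_Phi by lra.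
  unfold Cpower. destruct (Ceq_dec (z / 2) 0) as [E|_].
  { exfalso. apply Hz. replace z with (z / 2 * 2)%C by field. rewrite E. ring. }
  replace (z / 2)%C with (RtoC (/ 2) * z)%C by (rewrite RtoC_inv by lra; field).
  rewrite Clog_scal by (try lra; exact Hz).
  rewrite Cmult_plus_distr_l, Cexp_plus, <- RtoC_mult, Cexp_RtoC.
  assert (Hc : struve_const beta * exp ((beta + 1) * ln (/ 2)) = sqrt (PI / 4) * Gamma (beta + 3 / 2)).
  { unfold struve_const, Rpower.
    replace (sqrt (PI / 4)) with (sqrt PI / 2).
    - rewrite ln_Rinv by lra.
      replace (sqrt PI * exp (beta * ln 2) * Gamma (beta + 3 / 2) * exp ((beta + 1) * - ln 2))
        with (sqrt PI * Gamma (beta + 3 / 2) * (exp (beta * ln 2) * exp ((beta + 1) * - ln 2))) by ring.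
      rewrite <- exp_plus. replace (beta * ln 2 + (beta + 1) * - ln 2) with (- ln 2) by ring.
      rewrite exp_Ropp, exp_ln by lra. field.
    - rewrite sqrt_div_alt by lra. f_equal. replace 4 with (2 * 2) by ring. symmetry. apply sqrt_square. lra. }
  assert (Hd : RtoC (sqrt (PI / 4) * Gamma (beta + 3 / 2)) <> 0%C).
  { intros E. apply RtoC_inj in E.
    assert (0 < sqrt (PI / 4) * Gamma (beta + 3 / 2)); [|lra].
    apply Rmult_lt_0_compat; [apply sqrt_lt_R0; lra|exact HG]. }
  rewrite <- Hc in *. rewrite RtoC_mult in *. field.
  split; intros E; apply Hd; rewrite E; ring.
Qed.

Lemma struve_at_0 (beta : R) : struveH beta 0%C = 0%C.
Proof.
  unfold struveH, Cpower. destruct (Ceq_dec (0 / 2) 0) as [_|N].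
  - unfold Cdiv. ring.
  - exfalso. apply N. unfold Cdiv. ring.
Qed.

Lemma V_Phi (beta : R) (z : C) : Rabs beta <= 1 / 2 ->
  V beta z = (z * Phi (beta + 3 / 2) (z ^ 2))%C.
Proof.
  intros Hb. destruct (Ceq_dec z 0) as [->|Hz].
  - unfold V. rewrite struve_at_0. ring.
  - transitivity (Cpower z (- beta) * (RtoC (struve_const beta) * struveH beta z))%C.
    + unfold V, struve_const. rewrite !RtoC_mult. ring.
    + rewrite struve_normalized by assumption.
      unfold Cpower. destruct (Ceq_dec z 0) as [E|_]; [contradiction|].
      rewrite Cmult_assoc, <- Cexp_plus.
      replace (RtoC (- beta) * Clog z + RtoC (beta + 1) * Clog z)%C with (Clog z)
        by (rewrite RtoC_opp, RtoC_plus; ring).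
      now rewrite Cexp_Clog.
Qed.

Lemma W_Phi (beta : R) (z : C) : Rabs beta <= 1 / 2 ->
  W beta z = (z * Phi (beta + 3 / 2) z)%C.
Proof.
  intros Hb. destruct (Ceq_dec z 0) as [->|Hz].
  - unfold W. unfold Cpower at 1. destruct (Ceq_dec 0 0) as [_|N]; [ring|now destruct N].
  - transitivity (Cpower z ((1 - beta) / 2) *
      (RtoC (struve_const beta) * struveH beta (Cpower z (1 / 2))))%C.
    + unfold W, struve_const. rewrite !RtoC_mult. ring.
    + unfold Cpower. destruct (Ceq_dec z 0) as [E|_]; [contradiction|].
      rewrite struve_normalized by (try assumption; apply Cexp_neq_0).
      (* The principal square root has argument [Carg z / 2], within the principal range, so its
         [Clog] is exactly half of [Clog z]. *)
      pose proof (Carg_bound z Hz) as Ha. pose proof PI_RGT_0.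
      rewrite Clog_Cexp.
      * rewrite Cmult_assoc, <- Cexp_plus.
        replace (RtoC ((1 - beta) / 2) * Clog z + RtoC (beta + 1) * (RtoC (1 / 2) * Clog z))%C with (Clog z).
        -- rewrite Cexp_Clog by exact Hz. do 2 f_equal.
           transitivity (Cexp (RtoC (1 / 2) * Clog z) * Cexp (RtoC (1 / 2) * Clog z))%C; [ring|].
           rewrite <- Cexp_plus.
           replace (RtoC (1 / 2) * Clog z + RtoC (1 / 2) * Clog z)%C with (Clog z); [now apply Cexp_Clog|].
           rewrite RtoC_div by lra. field.
        -- rewrite !RtoC_div, RtoC_minus, RtoC_plus by lra. field.
      * replace (Im (RtoC (1 / 2) * Clog z)%C) with (Carg z / 2) by (simpl; field). lra.
Qed.

Lemma Clog_RtoC (r : R) : 0 < r -> Clog (RtoC r) = RtoC (ln r).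
Proof.
  intros Hr. rewrite <- (exp_ln r Hr) at 1. rewrite <- Cexp_RtoC. apply Clog_Cexp.
  simpl. pose proof PI_RGT_0. lra.
Qed.

(** Differentiating [r ^ (beta + 1) Phi (r ^ 2)] shows that all three equations are equations for
    [log_gap] at [r ^ 2], multiplied by a nonzero factor; they differ only in [k], and for [W] in
    having [sqrt r] in place of [r]. *)
Lemma struve_equation (beta k r : R) : Rabs beta <= 1 / 2 -> 0 < r ->
  (r * C_derive (struveH beta) r - RtoC k * struveH beta r)%C =
  RtoC (- 2 * (Rpower r (beta + 1) / struve_const beta)
          * log_gap (beta + 3 / 2) ((beta + 1 - k) / 2) (r ^ 2)).
Proof.
  intros Hb Hr. pose proof (struve_const_pos beta Hb) as Hc.
  pose proof Hb as Hb'. apply Rabs_le_between in Hb'.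
  set (b := beta + 3 / 2). set (c := struve_const beta) in *.
  assert (Hc' : RtoC c <> 0%C) by (intros E; apply RtoC_inj in E; lra).
  assert (Hr' : RtoC r <> 0%C) by (intros E; apply RtoC_inj in E; lra).
  assert (EH : forall z : C, z <> 0%C ->
    struveH beta z = (RtoC (/ c) * (Cexp (RtoC (beta + 1) * Clog z) * Phi b (z ^ 2)))%C).
  { intros z Hz. unfold b; rewrite <- (struve_normalized beta z Hb Hz). fold c. rewrite RtoC_inv by lra. field. exact Hc'. }
  assert (D : is_derive (struveH beta) (RtoC r)
     (RtoC (/ c) * (RtoC (beta + 1) * / r * Cexp (RtoC (beta + 1) * Clog r) * Phi b (RtoC r ^ 2)
        + Cexp (RtoC (beta + 1) * Clog r) * (2 * r * dPhi b (RtoC r ^ 2))))%C).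
  { apply (is_Cderive_ext_near
      (fun z : C => RtoC (/ c) * (Cexp (RtoC (beta + 1) * Clog z) * Phi b (z ^ 2)))%C _ _ _ r Hr).
    - intros z Hz. symmetry. apply EH. intros ->.
      replace (0 - RtoC r)%C with (RtoC (- r)) in Hz by (rewrite RtoC_opp; ring).
      rewrite Cmod_R, Rabs_Ropp, Rabs_pos_eq in Hz; lra.
    - apply is_Cderive_scal.
      apply (is_Cderive_mult (fun z : C => Cexp (RtoC (beta + 1) * Clog z)) (fun z : C => Phi b (z ^ 2)))%C.
      + apply (is_Cderive_comp Cexp (fun z : C => RtoC (beta + 1) * Clog z)%C); [apply is_Cderive_Cexp|].
        apply is_Cderive_scal, is_Cderive_Clog. exact Hr.
      + apply (is_Cderive_comp (Phi b) (fun z : C => z ^ 2)%C); [apply is_Cderive_Phi; unfold b; lra|].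
        apply is_Cderive_sqr. }
  rewrite (is_C_derive_unique _ _ _ D), (EH _ Hr').
  rewrite Clog_RtoC, <- RtoC_mult, Cexp_RtoC, <- RtoC_pow, Phi_RtoC, dPhi_RtoC by exact Hr.
  fold (Rpower r (beta + 1)).
  rewrite <- RtoC_inv by lra. rewrite <- !RtoC_mult, <- RtoC_plus, <- !RtoC_mult, <- RtoC_minus.
  f_equal. unfold log_gap. field. lra.
Qed.

Lemma smallest_root_sqrt (beta k x : R) (E : R -> C) : Rabs beta <= 1 / 2 ->
  (forall r, E r = (r * C_derive (struveH beta) r - RtoC k * struveH beta r)%C) ->
  0 < x -> log_gap (beta + 3 / 2) ((beta + 1 - k) / 2) x = 0 ->
  (forall t, 0 <= t < x -> log_gap (beta + 3 / 2) ((beta + 1 - k) / 2) t < 0) ->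
  smallest_positive_root E (sqrt x).
Proof.
  intros Hb HE Hx H0 Hneg.
  assert (Hs : 0 < sqrt x) by now apply sqrt_lt_R0.
  split; [exact Hs|]. split.
  - rewrite HE, struve_equation by assumption. rewrite pow2_sqrt by lra. rewrite H0, Rmult_0_r. reflexivity.
  - intros s Hs0 Es. rewrite HE, struve_equation in Es by assumption. apply RtoC_inj in Es.
    destruct (Rle_lt_dec (sqrt x) s) as [L|L]; [exact L|exfalso].
    assert (Q : log_gap (beta + 3 / 2) ((beta + 1 - k) / 2) (s ^ 2) < 0).
    { apply Hneg. split; [apply pow2_ge_0|]. rewrite <- (pow2_sqrt x) by lra.
      simpl. nra. }
    assert (P : 0 < Rpower s (beta + 1) / struve_const beta)
      by (apply Rdiv_lt_0_compat; [apply exp_pos|now apply struve_const_pos]).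
    nra.
Qed.

Lemma smallest_root_eqW (beta r1 x : R) : Rabs beta <= 1 / 2 ->
  0 < x -> log_gap (beta + 3 / 2) r1 x = 0 ->
  (forall t, 0 <= t < x -> log_gap (beta + 3 / 2) r1 t < 0) ->
  smallest_positive_root (eqW beta r1) x.
Proof.
  intros Hb Hx H0 Hneg.
  assert (E : forall r, 0 < r -> eqW beta r1 r =
    RtoC (- 2 * (Rpower (sqrt r) (beta + 1) / struve_const beta) * log_gap (beta + 3 / 2) r1 r)).
  { intros r Hr. unfold eqW. rewrite struve_equation by (try assumption; now apply sqrt_lt_R0).
    rewrite pow2_sqrt by lra. do 3 f_equal. field. }
  split; [exact Hx|]. split.
  - rewrite E, H0, Rmult_0_r by exact Hx. reflexivity.
  - intros s Hs Es. rewrite E in Es by exact Hs. apply RtoC_inj in Es.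
    destruct (Rle_lt_dec x s) as [L|L]; [exact L|exfalso].
    specialize (Hneg s ltac:(lra)).
    assert (P : 0 < Rpower (sqrt s) (beta + 1) / struve_const beta)
      by (apply Rdiv_lt_0_compat; [apply exp_pos|now apply struve_const_pos]).
    nra.
Qed.

(** Since [z g' / g - 1 = z G' / G], the bound on [G] puts the quotient in the disk of radius [r1]
    about 1. *)
Lemma Sstar_in_of_log_derivative (psi g G dG : C -> C) (r1 R0 : R) :
  disk_in_image psi r1 -> (forall z, g z = z * G z)%C -> 0 < R0 -> G 0%C = 1%C ->
  (forall z, Cmod z < R0 -> is_derive G z (dG z)) ->
  (forall z, Cmod z < R0 -> z <> 0%C -> G z <> 0%C /\ Cmod (z * dG z)%C < r1 * Cmod (G z)) ->
  Sstar_in psi g R0.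
Proof.
  intros Hpsi Hg HR G0 HG HL.
  assert (D : forall z, Cmod z < R0 -> is_derive g z (G z + z * dG z)%C).
  { intros z Hz. apply (is_derive_ext (fun z => z * G z)%C); [intros t; symmetry; apply Hg|].
    eapply is_Cderive_eq.
    - apply (is_Cderive_mult (fun z => z)); [apply is_Cderive_id|now apply HG].
    - ring. }
  split; [|split].
  - intros z Hz. eexists. now apply D.
  - split; [rewrite Hg; ring|]. eapply is_Cderive_eq; [apply D; now rewrite Cmod_0|].
    rewrite G0. ring.
  - intros z Hz Hz0. destruct (HL z Hz Hz0) as [N B].
    assert (Ng : g z <> 0%C) by (rewrite Hg; now apply Cmult_neq_0).
    split; [exact Ng|]. apply Hpsi. rewrite (is_C_derive_unique _ _ _ (D z Hz)), Hg.
    replace (z * (G z + z * dG z) / (z * G z) - 1)%C with (z * dG z / G z)%C by (field; auto).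
    rewrite Cmod_div by exact N.
    apply Rlt_div_l; [now apply Cmod_gt_0|exact B].
Qed.

(** At the point [r] the quotient [z g' / g] equals [1 - r1], the boundary value at [-1], which the
    image omits. *)
Lemma Sstar_in_bound (psi g : C -> C) (l : C) (r1 r rho : R) : MaMinda psi ->
  boundary_value_at_m1 psi (RtoC (1 - r1)) -> 0 < r ->
  is_derive g (RtoC r) l -> (RtoC r * l)%C = (RtoC (1 - r1) * g (RtoC r))%C ->
  Sstar_in psi g rho -> rho <= r.
Proof.
  intros Hpsi Hb Hr Hl E [_ [_ H]].
  destruct (Rle_lt_dec rho r) as [L|L]; [exact L|exfalso].
  destruct (H (RtoC r)) as [N HI].
  - rewrite Cmod_R, Rabs_pos_eq; lra.
  - intros E0. apply RtoC_inj in E0. lra.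
  - rewrite (is_C_derive_unique _ _ _ Hl), E in HI.
    replace (RtoC (1 - r1) * g r / g r)%C with (RtoC (1 - r1)) in HI by (field; exact N).
    exact (boundary_value_not_in_image psi _ Hpsi Hb HI).
Qed.

(** * Moduli and logarithmic derivatives *)

Lemma Cderive_of_unimodular (h : C -> C) (z l : C) (d : R) : 0 < d ->
  (forall w, Cmod (w - z)%C < d -> Cmod (h w) = 1) -> is_derive h z l -> l = 0%C.
Proof.
  intros Hd Hh Hl. destruct (Ceq_dec l 0) as [E|N]; [exact E|exfalso].
  assert (Hm : 0 < Cmod l) by now apply Cmod_gt_0.
  destruct (proj1 (is_Cderive_eps _ _ _) Hl (Cmod l / 2) ltac:(lra)) as [e [He H]].
  assert (H0 : Cmod (h z) = 1).
  { apply Hh. replace (z - z)%C with (RtoC 0) by ring. now rewrite Cmod_0. }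
  set (t := Rmin d e / (2 * Cmod l)).
  assert (Hde : 0 < Rmin d e) by now apply Rmin_pos.
  assert (Ht : 0 < t) by (apply Rdiv_lt_0_compat; lra).
  (* moving along [h z / l] increases [|h|] to first order *)
  set (k := (RtoC t * (Cconj l * h z))%C).
  assert (Ek : Cmod k = t * Cmod l).
  { unfold k. rewrite !Cmod_mult, Cmod_R, Cmod_conj, H0, Rabs_pos_eq by lra. ring. }
  assert (Ek2 : t * Cmod l = Rmin d e / 2) by (unfold t; field; lra).
  pose proof (Rmin_l d e) as R1. pose proof (Rmin_r d e) as R2.
  specialize (H k ltac:(lra)). rewrite Ek in H.
  assert (H1 : Cmod (h (z + k)%C) = 1).
  { apply Hh. replace (z + k - z)%C with k by ring. lra. }
  assert (E1 : (h z + l * k)%C = (RtoC (1 + t * Cmod l ^ 2) * h z)%C).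
  { unfold k. rewrite RtoC_plus, (RtoC_mult t), Cmod2_conj. ring. }
  assert (E2 : Cmod (h z + l * k)%C = 1 + t * Cmod l ^ 2).
  { rewrite E1, Cmod_mult, H0, Cmod_R, Rabs_pos_eq; [ring|].
    assert (0 <= t * Cmod l ^ 2) by (apply Rmult_le_pos; [lra|apply pow2_ge_0]). lra. }
  pose proof (Cmod_triangle (- (h (z + k) - h z - l * k))%C (h (z + k)%C)) as T.
  rewrite Cmod_opp, H1 in T.
  replace (- (h (z + k) - h z - l * k) + h (z + k))%C with (h z + l * k)%C in T by ring.
  rewrite E2 in T.
  assert (0 < t * Cmod l ^ 2) by (apply Rmult_lt_0_compat; [exact Ht|now apply pow_lt]).
  simpl in *. nra.
Qed.

(** The quotient [f / g] has modulus 1 near [z], so its derivative vanishes. This compares two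
    branches of a power without relating the logarithms chosen for them. *)
Lemma log_derivative_of_mod (f g : C -> C) (z df dg : C) (d : R) : 0 < d ->
  (forall w, Cmod (w - z)%C < d -> g w <> 0%C /\ Cmod (f w) = Cmod (g w)) ->
  is_derive f z df -> is_derive g z dg -> (df * g z = f z * dg)%C.
Proof.
  intros Hd H Hf Hg.
  assert (N : g z <> 0%C).
  { apply H. replace (z - z)%C with (RtoC 0) by ring. now rewrite Cmod_0. }
  assert (E : ((df * g z - f z * dg) / (g z * g z))%C = 0%C).
  { apply (Cderive_of_unimodular (fun w => f w / g w)%C z _ d Hd).
    - intros w Hw. destruct (H w Hw) as [Nw Ew]. rewrite Cmod_div, Ew by exact Nw.
      field. apply Rgt_not_eq. now apply Cmod_gt_0.
    - now apply is_Cderive_div. }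
  replace (df * g z)%C with ((df * g z - f z * dg) / (g z * g z) * (g z * g z) + f z * dg)%C
    by (field; exact N).
  rewrite E. ring.
Qed.

(** * The radii *)

Lemma Phi_log_bound (b T X : R) (w : C) : 1 <= b <= 2 ->
  (forall t, 0 <= t < X -> log_gap b T t < 0) -> Cmod w < X ->
  Phi b w <> 0%C /\ Cmod (w * dPhi b w)%C < T * Cmod (Phi b w).
Proof.
  intros Hb HX Hw. pose proof (Cmod_ge_0 w) as Hw0.
  assert (Hpos : forall t, 0 <= t <= Cmod w -> 0 < phi_real b t).
  { intros t Ht. apply (phi_real_pos b T X); [lra|exact HX|lra]. }
  destruct (Phi_ineqs b w 0 Hb ltac:(lra) Hpos) as [H1 _].
  pose proof (Phi_log_derivative b w Hb Hpos) as H2.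
  specialize (Hpos (Cmod w) ltac:(lra)). specialize (HX (Cmod w) ltac:(lra)).
  unfold log_gap in HX. split; [apply Cmod_gt_0; lra|].
  apply Rmult_lt_reg_r with (phi_real b (Cmod w)); [exact Hpos|].
  eapply Rle_lt_trans; [exact H2|]. nra.
Qed.

Lemma Cmod_sqr_lt (z : C) (x : R) : 0 < x -> Cmod z < sqrt x -> Cmod (z ^ 2)%C < x.
Proof.
  intros Hx Hz. rewrite Cmod_pow, <- (pow2_sqrt x) by lra.
  pose proof (Cmod_ge_0 z). simpl. nra.
Qed.

Lemma log_gap_eq_0 (b T x : R) : log_gap b T x = 0 ->
  (RtoC x * dPhi b (RtoC x))%C = (- (RtoC T * Phi b (RtoC x)))%C.
Proof.
  intros H. unfold log_gap in H.
  rewrite dPhi_RtoC, Phi_RtoC, <- !RtoC_mult, <- RtoC_opp. f_equal. lra.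
Qed.

Lemma is_Cderive_Phi_sqr (b : R) (z : C) : 1 <= b ->
  is_derive (fun z : C => Phi b (z ^ 2)%C) z (2 * z * dPhi b (z ^ 2))%C.
Proof.
  intros Hb. apply (is_Cderive_comp (Phi b) (fun z : C => z ^ 2)%C);
    [now apply is_Cderive_Phi|apply is_Cderive_sqr].
Qed.

Lemma is_radius_of_bound (P : R -> Prop) (r : R) : 0 < r -> P r ->
  (forall rho, P rho -> rho <= r) -> is_radius P r.
Proof.
  intros Hr HP Hb. split.
  - intros rho [_ H]. now apply Hb.
  - intros m Hm. apply Hm. auto.
Qed.

Lemma radius_V (beta : R) (hbeta : Rabs beta <= 1 / 2) (psi : C -> C) (hpsi : MaMinda psi)
  (r1 : R) (hr1 : largest_disk_radius psi r1) : exists rV : R,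
  smallest_positive_root (eqV beta r1) rV /\ Sstar_in psi (V beta) rV /\
  (boundary_value_at_m1 psi (RtoC (1 - r1)) -> is_radius (Sstar_in psi (V beta)) rV).
Proof.
  pose proof hbeta as Hbeta. apply Rabs_le_between in Hbeta.
  set (b := beta + 3 / 2). assert (Hb : 1 <= b <= 2) by (unfold b; lra).
  assert (Hr1 := largest_disk_radius_bounds psi r1 hpsi hr1).
  destruct (log_gap_root b (r1 / 2) Hb ltac:(lra)) as [x [Hx [H0 Hneg]]].
  assert (Hs : 0 < sqrt x) by now apply sqrt_lt_R0.
  assert (HS : Sstar_in psi (V beta) (sqrt x)).
  { apply (Sstar_in_of_log_derivative psi (V beta) (fun z => Phi b (z ^ 2))%C
      (fun z => 2 * z * dPhi b (z ^ 2))%C r1).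
    - apply hr1.
    - intros z. now apply V_Phi.
    - exact Hs.
    - replace (0 ^ 2)%C with (RtoC 0) by ring. now rewrite Phi_RtoC, phi_real_0.
    - intros z _. apply is_Cderive_Phi_sqr. lra.
    - intros z Hz _. destruct (Phi_log_bound b _ x (z ^ 2)%C Hb Hneg (Cmod_sqr_lt z x Hx Hz)) as [N B].
      split; [exact N|].
      replace (z * (2 * z * dPhi b (z ^ 2)))%C with (RtoC 2 * (z ^ 2 * dPhi b (z ^ 2)))%C by ring.
      rewrite Cmod_mult, Cmod_R, Rabs_pos_eq by lra. lra. }
  exists (sqrt x). split; [|split].
  - apply (smallest_root_sqrt beta (1 + beta - r1)); [exact hbeta|reflexivity|exact Hx|..];
      replace ((beta + 1 - (1 + beta - r1)) / 2) with (r1 / 2) by field; assumption.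
  - exact HS.
  - intros Hbd. apply is_radius_of_bound; [exact Hs|exact HS|]. intros rho.
    eapply (Sstar_in_bound psi (V beta) _ r1 (sqrt x) rho hpsi Hbd Hs).
    + apply (is_derive_ext (fun z : C => z * Phi b (z ^ 2))%C); [intros z; symmetry; now apply V_Phi|].
      apply (is_Cderive_mult (fun z => z)); [apply is_Cderive_id|apply is_Cderive_Phi_sqr; lra].
    + rewrite V_Phi by exact hbeta. fold b. cbv beta.
      assert (E2 : (RtoC (sqrt x) ^ 2)%C = RtoC x) by (rewrite <- RtoC_pow, pow2_sqrt; lra || reflexivity).
      transitivity (RtoC (sqrt x) * (Phi b (RtoC (sqrt x) ^ 2) + 2 * (RtoC (sqrt x) ^ 2 * dPhi b (RtoC (sqrt x) ^ 2))))%C; [ring|].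
      rewrite E2, (log_gap_eq_0 b _ x H0), RtoC_minus, RtoC_div by lra. field.
Qed.

Lemma radius_W (beta : R) (hbeta : Rabs beta <= 1 / 2) (psi : C -> C) (hpsi : MaMinda psi)
  (r1 : R) (hr1 : largest_disk_radius psi r1) : exists rW : R,
  smallest_positive_root (eqW beta r1) rW /\ Sstar_in psi (W beta) rW /\
  (boundary_value_at_m1 psi (RtoC (1 - r1)) -> is_radius (Sstar_in psi (W beta)) rW).
Proof.
  pose proof hbeta as Hbeta. apply Rabs_le_between in Hbeta.
  set (b := beta + 3 / 2). assert (Hb : 1 <= b <= 2) by (unfold b; lra).
  assert (Hr1 := largest_disk_radius_bounds psi r1 hpsi hr1).
  destruct (log_gap_root b r1 Hb Hr1) as [x [Hx [H0 Hneg]]].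
  assert (HS : Sstar_in psi (W beta) x).
  { apply (Sstar_in_of_log_derivative psi (W beta) (Phi b) (dPhi b) r1).
    - apply hr1.
    - intros z. now apply W_Phi.
    - exact Hx.
    - now rewrite Phi_RtoC, phi_real_0.
    - intros z _. apply is_Cderive_Phi. lra.
    - intros z Hz _. now apply (Phi_log_bound b _ x). }
  exists x. split; [|split].
  - now apply smallest_root_eqW.
  - exact HS.
  - intros Hbd. apply is_radius_of_bound; [exact Hx|exact HS|]. intros rho.
    eapply (Sstar_in_bound psi (W beta) _ r1 x rho hpsi Hbd Hx).
    + apply (is_derive_ext (fun z : C => z * Phi b z)%C); [intros z; symmetry; now apply W_Phi|].
      apply (is_Cderive_mult (fun z => z)); [apply is_Cderive_id|apply is_Cderive_Phi; lra].
    + rewrite W_Phi by exact hbeta. fold b. cbv beta.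
      transitivity (RtoC x * (Phi b (RtoC x) + RtoC x * dPhi b (RtoC x)))%C; [ring|].
      rewrite (log_gap_eq_0 b _ x H0), RtoC_minus. ring.
Qed.

(** The explicit branch of [U] is [z * U_factor beta z]: the root of [z ^ (beta + 1)] is taken as
    [z], and only [Phi] goes through the principal logarithm. *)
Definition U_factor (beta : R) (z : C) : C :=
  Cexp (RtoC (1 / (beta + 1)) * Clog (Phi (beta + 3 / 2) (z ^ 2)))%C.

Lemma is_Cderive_U_factor (beta : R) (z : C) : Rabs beta <= 1 / 2 ->
  0 < Re (Phi (beta + 3 / 2) (z ^ 2)%C) ->
  is_derive (U_factor beta) z
    (RtoC (1 / (beta + 1)) * (2 * z * dPhi (beta + 3 / 2) (z ^ 2) / Phi (beta + 3 / 2) (z ^ 2))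
     * U_factor beta z)%C.
Proof.
  intros Hb Hz. apply Rabs_le_between in Hb.
  apply (is_Cderive_comp Cexp
    (fun z : C => RtoC (1 / (beta + 1)) * Clog (Phi (beta + 3 / 2) (z ^ 2)))%C);
    [apply is_Cderive_Cexp|].
  apply is_Cderive_scal.
  apply (is_Cderive_comp Clog (fun z : C => Phi (beta + 3 / 2) (z ^ 2))%C); [now apply is_Cderive_Clog|].
  apply is_Cderive_Phi_sqr. lra.
Qed.

Lemma U_power_value (beta : R) (z : C) : Rabs beta <= 1 / 2 ->
  Phi (beta + 3 / 2) (z ^ 2)%C <> 0%C ->
  is_power_value (struve_const beta * struveH beta z)%C (1 / (beta + 1)) (z * U_factor beta z)%C.
Proof.
  intros Hb N. destruct (Ceq_dec z 0) as [->|Hz].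
  - left. rewrite struve_at_0. split; ring.
  - right. exists (RtoC (beta + 1) * Clog z + Clog (Phi (beta + 3 / 2) (z ^ 2)))%C. split.
    + rewrite Cexp_plus, Cexp_Clog by exact N. symmetry. now apply struve_normalized.
    + unfold U_factor. rewrite <- (Cexp_Clog z) at 1 by exact Hz. rewrite <- Cexp_plus. f_equal.
      rewrite Cmult_plus_distr_l, Cmult_assoc, <- RtoC_mult.
      replace (1 / (beta + 1) * (beta + 1)) with 1; [ring|]. field.
      apply Rabs_le_between in Hb. lra.
Qed.

(** Logarithms of [w] differ in their imaginary parts only, and the exponent is real. *)
Lemma Cmod_power_value (w v : C) (a : R) : w <> 0%C -> is_power_value w a v ->
  Cmod v = Rpower (Cmod w) a.
Proof.
  intros Hw [[E _]|[l [<- ->]]]; [contradiction|].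
  rewrite !Cmod_Cexp. unfold Rpower. rewrite ln_exp. f_equal. unfold Re. simpl. ring.
Qed.

Lemma radius_U (beta : R) (hbeta : Rabs beta <= 1 / 2) (psi : C -> C) (hpsi : MaMinda psi)
  (r1 : R) (hr1 : largest_disk_radius psi r1) : exists rU : R,
  smallest_positive_root (eqU beta r1) rU /\ U_Sstar_in psi beta rU /\
  (boundary_value_at_m1 psi (RtoC (1 - r1)) -> is_radius (U_Sstar_in psi beta) rU).
Proof.
  pose proof hbeta as Hbeta. apply Rabs_le_between in Hbeta.
  set (b := beta + 3 / 2). assert (Hb : 1 <= b <= 2) by (unfold b; lra).
  set (p := 1 / (beta + 1)).
  assert (Hr1 := largest_disk_radius_bounds psi r1 hpsi hr1).
  (* As [r1 <= 1] and [beta + 1 <= 3 / 2], this is at most the [3 / 4] allowed by [Phi_Re_pos]. *)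
  set (T := r1 * (beta + 1) / 2).
  assert (HT : 0 < T <= 3 / 4) by (unfold T; nra).
  assert (HpT : p * T * 2 = r1) by (unfold p, T; field; lra).
  assert (Hp : 0 < p) by (apply Rdiv_lt_0_compat; lra).
  destruct (log_gap_root b T Hb ltac:(lra)) as [x [Hx [H0 Hneg]]].
  assert (Hs : 0 < sqrt x) by now apply sqrt_lt_R0.
  assert (HRe : forall z, Cmod z < sqrt x -> 0 < Re (Phi b (z ^ 2)%C)).
  { intros z Hz. apply (Phi_Re_pos b T x); [exact Hb|lra|exact Hneg|].
    left. now apply Cmod_sqr_lt. }
  assert (HS : Sstar_in psi (fun z => z * U_factor beta z)%C (sqrt x)).
  { apply (Sstar_in_of_log_derivative psi _ (U_factor beta)
      (fun z => RtoC p * (2 * z * dPhi b (z ^ 2) / Phi b (z ^ 2)) * U_factor beta z)%C r1).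
    - apply hr1.
    - reflexivity.
    - exact Hs.
    - unfold U_factor. fold b. replace (0 ^ 2)%C with (RtoC 0) by ring.
      rewrite Phi_RtoC, phi_real_0, Clog_RtoC, ln_1, Cmult_0_r, Cexp_RtoC, exp_0 by lra. reflexivity.
    - intros z Hz. apply is_Cderive_U_factor; [exact hbeta|now apply HRe].
    - intros z Hz _. destruct (Phi_log_bound b _ x (z ^ 2)%C Hb Hneg (Cmod_sqr_lt z x Hx Hz)) as [N B].
      assert (NU : U_factor beta z <> 0%C) by apply Cexp_neq_0.
      split; [exact NU|].
      replace (z * (RtoC p * (2 * z * dPhi b (z ^ 2) / Phi b (z ^ 2)) * U_factor beta z))%C
        with (RtoC (p * 2) * (z ^ 2 * dPhi b (z ^ 2) / Phi b (z ^ 2)) * U_factor beta z)%C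
        by (rewrite RtoC_mult; field; exact N).
      rewrite Cmod_mult. apply Rmult_lt_compat_r; [now apply Cmod_gt_0|].
      rewrite Cmod_mult, Cmod_R, Rabs_pos_eq, Cmod_div by (exact N || lra).
      rewrite <- HpT. replace (p * T * 2) with (p * 2 * T) by ring.
      apply Rmult_lt_compat_l; [lra|]. apply Cmod_gt_0 in N.
      now apply Rlt_div_l. }
  assert (HU : U_Sstar_in psi beta (sqrt x)).
  { exists (fun z => z * U_factor beta z)%C. split; [|exact HS].
    destruct HS as [HS1 [HS2 _]]. split; [exact HS1|]. split; [exact HS2|].
    intros z Hz. apply U_power_value; [exact hbeta|].
    apply (Phi_log_bound b _ x (z ^ 2)%C Hb Hneg (Cmod_sqr_lt z x Hx Hz)). }
  exists (sqrt x). split; [|split].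
  - apply (smallest_root_sqrt beta ((1 - r1) * (beta + 1))); [exact hbeta|reflexivity|exact Hx|..];
      replace ((beta + 1 - (1 - r1) * (beta + 1)) / 2) with T by (unfold T; field); assumption.
  - exact HU.
  - intros Hbd. apply is_radius_of_bound; [exact Hs|exact HU|]. intros rho [u [[Hu1 [Hu2 Hu3]] Hu]].
    destruct (Rle_lt_dec rho (sqrt x)) as [L|L]; [exact L|].
    set (r := RtoC (sqrt x)).
    assert (Er2 : (r ^ 2)%C = RtoC x).
    { unfold r. rewrite <- RtoC_pow, pow2_sqrt by lra. reflexivity. }
    assert (Hmr : Cmod r = sqrt x) by (unfold r; rewrite Cmod_R, Rabs_pos_eq; lra).
    assert (HRer : 0 < Re (Phi b (r ^ 2)%C)).
    { apply (Phi_Re_pos b T x); [exact Hb|lra|exact Hneg|]. rewrite Er2, Cmod_R, Rabs_pos_eq; lra. }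
    (* near [r], any branch [u] has the same modulus as the explicit one *)
    destruct (Cderive_cont (fun z : C => Phi b (z ^ 2)%C) r) with (eps := Re (Phi b (r ^ 2)%C))
      as [d [Hd Hc]]; [eexists; apply is_Cderive_Phi_sqr; lra|exact HRer|].
    (* The three bounds keep [Phi b (w ^ 2)] and [w] away from 0 and [w] inside the disk where [u]
       is a branch. *)
    set (d' := Rmin d (Rmin (sqrt x) (rho - sqrt x))).
    assert (Hd' : 0 < d') by (unfold d'; repeat apply Rmin_pos; lra).
    destruct (Hu1 r) as [l Hl]; [lra|].
    assert (Dg := is_Cderive_U_factor beta r hbeta HRer).
    assert (D0 : is_derive (fun z : C => z * U_factor beta z)%C r
      (1 * U_factor beta r + r * (RtoC p * (2 * r * dPhi b (r ^ 2) / Phi b (r ^ 2)) * U_factor beta r))%C).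
    { apply (is_Cderive_mult (fun z => z)); [apply is_Cderive_id|exact Dg]. }
    assert (Nr : r <> 0%C) by (apply Cmod_gt_0; lra).
    assert (NU : forall z, U_factor beta z <> 0%C) by (intros z; apply Cexp_neq_0).
    assert (NP : Phi b (r ^ 2)%C <> 0%C) by (intros E; rewrite E in HRer; simpl in HRer; lra).
    assert (Hnear : forall w, Cmod (w - r)%C < d' ->
      (w * U_factor beta w)%C <> 0%C /\ Cmod (u w) = Cmod (w * U_factor beta w)%C).
    { intros w Hw. unfold d' in Hw. apply Rmin_Rgt in Hw. destruct Hw as [W1 W2].
      apply Rmin_Rgt in W2. destruct W2 as [W2 W3].
      assert (Nw : w <> 0%C).
      { intros ->. replace (0 - r)%C with (- r)%C in W2 by ring. rewrite Cmod_opp in W2. lra. }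
      specialize (Hc (w - r)%C W1).
      assert (Ew : (r + (w - r))%C = w) by ring. rewrite Ew in Hc.
      assert (NPw : Phi b (w ^ 2)%C <> 0%C).
      { intros E. rewrite E in Hc. replace (0 - Phi b (r ^ 2))%C with (- Phi b (r ^ 2))%C in Hc by ring.
        rewrite Cmod_opp in Hc. pose proof (re_le_Cmod (Phi b (r ^ 2)%C)) as Q.
        rewrite Rabs_pos_eq in Q by lra. lra. }
      assert (Hwr : Cmod w < rho).
      { pose proof (Cmod_triangle (w - r) r) as Q. replace (w - r + r)%C with w in Q by ring. lra. }
      split; [apply Cmult_neq_0; auto|].
      assert (NS : (struve_const beta * struveH beta w)%C <> 0%C).
      { rewrite struve_normalized by assumption. apply Cmult_neq_0; [apply Cexp_neq_0|exact NPw]. }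
      rewrite (Cmod_power_value _ _ _ NS (Hu3 w Hwr)).
      symmetry. apply Cmod_power_value; [exact NS|]. now apply U_power_value. }
    assert (E := log_derivative_of_mod u _ r l _ d' Hd' Hnear Hl D0).
    refine (Sstar_in_bound psi u l r1 (sqrt x) rho hpsi Hbd Hs Hl _ Hu).
    fold r.
    assert (NrU : (r * U_factor beta r)%C <> 0%C) by (apply Cmult_neq_0; auto).
    assert (El : @eq C l (u r * (1 + RtoC p * 2 * (r ^ 2 * dPhi b (r ^ 2)) / Phi b (r ^ 2)) / r)%C).
    { replace l with (l * (r * U_factor beta r) / (r * U_factor beta r))%C by (field; auto).
      rewrite E. field. auto. }
    rewrite El, Er2, (log_gap_eq_0 b _ x H0). rewrite <- HpT, RtoC_minus, !RtoC_mult.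
    rewrite Er2 in NP. field. auto.
Qed.

Theorem theorem2p2 (beta : R) (hbeta : Rabs beta <= 1 / 2)
  (psi : C -> C) (hpsi : MaMinda psi)
  (r1 : R) (hr1 : largest_disk_radius psi r1) :
  (exists rU : R,
     smallest_positive_root (eqU beta r1) rU /\
     U_Sstar_in psi beta rU /\
     (boundary_value_at_m1 psi (RtoC (1 - r1)) ->
      is_radius (U_Sstar_in psi beta) rU)) /\
  (exists rV : R,
     smallest_positive_root (eqV beta r1) rV /\
     Sstar_in psi (V beta) rV /\
     (boundary_value_at_m1 psi (RtoC (1 - r1)) ->
      is_radius (Sstar_in psi (V beta)) rV)) /\
  (exists rW : R,
     smallest_positive_root (eqW beta r1) rW /\
     Sstar_in psi (W beta) rW /\
     (boundary_value_at_m1 psi (RtoC (1 - r1)) ->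
      is_radius (Sstar_in psi (W beta)) rW)).
Proof.
  split; [now apply radius_U|]. split; [now apply radius_V|now apply radius_W].
Qed.
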